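(* Let $\mu$ be a finite, positive, Borel measure supported on the closed unit disk $\overline{\mathbb{D}}$, and let $b\in H^\infty$ be nonextreme with $\|b\|_\infty\le 1$. Then $D(\mu)=\mathcal{H}(b)$ with equality of norms if and only if there exist $\alpha\in\mathbb{C}$, $\lambda\in\overline{\mathbb{D}}$ and constants $A_\lambda,B_\lambda\in\mathbb{C}$ (depending on $\alpha$ and $\lambda$) such that $$\mu=|\alpha|^2\delta_\lambda,\qquad b(z)=\frac{A_\lambda z}{1-B_\lambda z}\quad (z\in\mathbb{D}),$$ where $$|A_\lambda|^2=\begin{cases}\dfrac{|\alpha|^2}{2|\lambda|^2}\left((1+|\alpha|^2+|\lambda|^2)-\sqrt{(1+|\alpha|^2+|\lambda|^2)^2-4|\lambda|^2}\right), & \text{if }\lambda\neq 0,\\[2ex] \dfrac{1}{1+|\alpha|^2}, & \text{if }\lambda=0,\end{cases}$$ and $$B_\lambda=\frac{|A_\lambda|^2\,\overline{\lambda}}{|\alpha|^2}$$ (with $B_\lambda$ read as $0$ if $\alpha=0$).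
   Context: $\mathbb{D}$ is the open unit disk in $\mathbb{C}$, $\mathbb{T}$ the unit circle, $H^2$ the Hardy space of analytic functions on $\mathbb{D}$ with square-summable Taylor coefficients (with its usual norm $\|\cdot\|_{H^2}$), and $H^\infty$ the space of bounded analytic functions on $\mathbb{D}$ with the sup norm. $\delta_\lambda$ is the unit point mass at $\lambda$. Local Dirichlet integral: for $\zeta\in\mathbb{D}$ and $f\in H^2$, $D_\zeta(f)=\left\|\frac{f-f(\zeta)}{z-\zeta}\right\|_{H^2}^2$. For $\zeta\in\mathbb{T}$, $D_\zeta(f)=\left\|\frac{f-f(\zeta)}{z-\zeta}\right\|_{H^2}^2$ if the nontangential limit $f(\zeta)$ of $f$ at $\zeta$ exists (with value $\infty$ if the quotient is not in $H^2$), and $D_\zeta(f)=\infty$ otherwise. Dirichlet-type space: for a finite nonnegative Borel measure $\mu$ supported on $\overline{\mathbb{D}}$, $D(\mu)$ is the space of those $f\in H^2$ with $\int D_\zeta(f)\,d\mu(\zeta)<\infty$, with norm $\|f\|^2=\|f\|_{H^2}^2+\int D_\zeta(f)\,d\mu(\zeta)$. De Branges–Rovnyak space: for $b\in H^\infty$ with $\|b\|_\infty\le1$, let $T_b$ be the Toeplitz operator on $H^2$ with symbol $b$ (multiplication by $b$) and $T_{\overline b}=T_b^*$. Then $\mathcal{H}(b)$ is the image of $H^2$ under $(I-T_bT_{\overline b})^{1/2}$, with inner product $\langle (I-T_bT_{\overline b})^{1/2}f,(I-T_bT_{\overline b})^{1/2}g\rangle_b=\langle f,g\rangle_{H^2}$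 for $f,g\in \ker((I-T_bT_{\overline b})^{1/2})^\perp$. ''Nonextreme'' means that $b$ is not an extreme point of the closed unit ball of $H^\infty$. ''$D(\mu)=\mathcal{H}(b)$ with equality of norms'' means that the two spaces consist of the same functions and their norms coincide.
   Formalization: For λ=0 the value of |A_λ|² is taken to be |α|²/(1+|α|²), the limit of the λ≠0 formula, instead of the printed 1/(1+|α|²), which makes the equivalence false unless |α|=1 (e.g. μ=2δ_0 requires |A|²=2/3, not 1/3). *)

(* Defs.v *)
From HB Require Import structures.
From mathcomp Require Import all_boot all_order all_algebra.
From mathcomp Require Import complex.
From mathcomp Require Import all_classical all_reals all_analysis.
From mathcomp Require Import lra ring.

Set Implicit Arguments.
Unset Strict Implicit.
Unset Printing Implicit Defensive.

Import Order.TTheory GRing.Theory Num.Theory.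
Import numFieldNormedType.Exports.

Local Open Scope classical_set_scope.
Local Open Scope ring_scope.

(* The library puts no topology on the concrete field R[i]; we give it that of
   the norm, as it does for abstract numeric fields. *)
HB.instance Definition _ (R : realType) := GRing.ComAlgebra.copy R[i] (R[i]^o).
HB.instance Definition _ (R : realType) := Vector.copy R[i] (R[i]^o).
HB.instance Definition _ (R : realType) := NormedModule.copy R[i] (R[i]^o).
HB.instance Definition _ (R : realType) := Num.ClosedField.on R[i].

(* The norm of R[i] takes its values in R[i]; [cmod z] is |z| as an element of
   R. *)
Definition cmod (R : realType) (z : R[i]) : R := complex.Re `|z|.

Definition borelC (R : realType) := g_sigma_algebraType (@open R[i]).

Definition disk (R : realType) : set R[i] := [set z | cmod z < 1].
Definition closed_disk (R : realType) : set R[i] := [set z | cmod z <= 1].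
Arguments disk {R}.
Arguments closed_disk {R}.

Section HardySpace.
Variable R : realType.
Local Notation C := R[i].

Definition square_summable : {pred nat -> C} :=
  [pred a | `[< cvgn (series (fun n => cmod (a n) ^+ 2)) >]].

Lemma cmod_ge0 (z : C) : 0 <= cmod z.
Proof. by rewrite /cmod complex.normc_def /= sqrtr_ge0. Qed.

Lemma cmodE (z : C) : (cmod z)%:C%C = `|z|.
Proof. by rewrite /cmod complex.normc_def. Qed.

Lemma cmodM (x y : C) : cmod (x * y) = cmod x * cmod y.
Proof.
apply: (@complex.complexI R).
by rewrite [RHS]rmorphM /= !cmodE normrM.
Qed.

Lemma ler_cmodD (x y : C) : cmod (x + y) <= cmod x + cmod y.
Proof. by rewrite -complex.lecR rmorphD /= !cmodE ler_normD. Qed.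

Lemma cmodD_sqr (x y : C) :
  cmod (x + y) ^+ 2 <= 2 * cmod x ^+ 2 + 2 * cmod y ^+ 2.
Proof.
have h := ler_cmodD x y; have h0 := cmod_ge0 (x + y).
apply: (@le_trans _ _ ((cmod x + cmod y) ^+ 2)).
  by rewrite ler_sqr ?nnegrE ?addr_ge0 ?cmod_ge0.
rewrite -subr_ge0.
have -> : 2 * cmod x ^+ 2 + 2 * cmod y ^+ 2 - (cmod x + cmod y) ^+ 2
          = (cmod x - cmod y) ^+ 2.
  by ring.
exact: sqr_ge0.
Qed.

Fact square_summable_submod : submod_closed square_summable.
Proof.
split=> [|k a b /asboolP ha /asboolP hb]; apply/asboolP.
  have -> : (fun n => cmod ((0 : nat -> C) n) ^+ 2) = (fun=> 0).
    by apply/funext => n; rewrite /cmod normr0 expr0n.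
  have -> : series (fun=> 0 : R) = (fun=> 0).
    by apply/funext => n; rewrite /series /= big1.
  exact: is_cvg_cst.
apply: (@series_le_cvg _ _
  (fun n => 2 * cmod k ^+ 2 * cmod (a n) ^+ 2 + 2 * cmod (b n) ^+ 2)).
- by move=> n; rewrite sqr_ge0.
- by move=> n; rewrite addr_ge0 // !mulr_ge0 // cmod_ge0.
- move=> n; apply: (le_trans (cmodD_sqr _ _)).
  by rewrite lerD2r [cmod (_ *: _)]cmodM exprMn mulrA.
have -> : series (fun n => 2 * cmod k ^+ 2 * cmod (a n) ^+ 2
                           + 2 * cmod (b n) ^+ 2)
  = (fun n => 2 * cmod k ^+ 2 * series (fun n => cmod (a n) ^+ 2) n
              + 2 * series (fun n => cmod (b n) ^+ 2) n).
  by apply/funext => n; rewrite /series /= big_split /= -!big_distrr.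
by apply: is_cvgD; apply: is_cvgM => //; exact: is_cvg_cst.
Qed.

HB.instance Definition _ :=
  GRing.isSubmodClosed.Build C (nat -> C) square_summable
    square_summable_submod.

(* An element of H^2 is given by its Taylor coefficients at 0, which determine
   it as a function on the disk. *)
Record hardy := Hardy {
  taylor : nat -> C;
  taylorP : taylor \in square_summable }.

HB.instance Definition _ := [isSub for taylor].
HB.instance Definition _ := [Choice of hardy by <:].
HB.instance Definition _ := [SubChoice_isSubLmodule of hardy by <:].

Definition heval (f : hardy) (z : C) : C :=
  limn (series (fun n => taylor f n * z ^+ n)).

Definition hdot (f g : hardy) : C :=
  limn (series (fun n => taylor f n * (taylor g n)^*)).

Definition hnorm (f : hardy) : R :=
  Num.sqrt (limn (series (fun n => cmod (taylor f n) ^+ 2))).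

Definition stolz (zeta : C) (M : R) : set C :=
  [set z | disk z /\ cmod (z - zeta) < M * (1 - cmod z)].

Definition nontangential_limit (f : C -> C) (zeta c : C) : Prop :=
  forall M : R, 1 < M ->
    f z @[z --> within (stolz zeta M) (nbhs zeta)] --> c.

Definition has_value (f : hardy) (zeta c : C) : Prop :=
  if cmod zeta < 1 then c = heval f zeta
  else nontangential_limit (heval f) zeta c.

(* q = (f - c) / (z - zeta); if zeta is in the disk, the value of q at zeta is
   determined by continuity. *)
Definition is_difference_quotient (f : hardy) (zeta c : C) (q : hardy) : Prop :=
  forall z, disk z -> (z - zeta) * heval q z = heval f z - c.

(* The set contains at most one element; its infimum is +oo if it is empty,
   i.e. if f has no value at zeta or the quotient is not in H^2. *)
Definition local_dirichlet (zeta : C) (f : hardy) : \bar R :=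
  ereal_inf [set ((hnorm q) ^+ 2)%:E | q in
    [set q | exists2 c, has_value f zeta c
                      & is_difference_quotient f zeta c q]].

Definition dirichlet_integral
    (mu : {finite_measure set (borelC R) -> \bar R}) (f : hardy) : \bar R :=
  (\int[mu]_(zeta in (closed_disk : set (borelC R))) local_dirichlet zeta f)%E.

Definition dirichlet_space
    (mu : {finite_measure set (borelC R) -> \bar R}) : set hardy :=
  [set f | (dirichlet_integral mu f < +oo)%E].

Definition dirichlet_norm
    (mu : {finite_measure set (borelC R) -> \bar R}) (f : hardy) : R :=
  Num.sqrt (hnorm f ^+ 2 + fine (dirichlet_integral mu f)).

Definition analytic_on_disk (f : C -> C) : Prop :=
  exists a : nat -> C, forall z, disk z ->
    series (fun n => a n * z ^+ n) @ \oo --> f z.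

Definition Hinf : set (C -> C) :=
  [set f | analytic_on_disk f /\
           exists M : R, forall z, disk z -> cmod (f z) <= M].

Definition Hinf_norm (f : C -> C) : R := sup [set cmod (f z) | z in disk].

Definition Hinf_ball : set (C -> C) := [set f | Hinf f /\ Hinf_norm f <= 1].

(* Elements of H^oo are functions on C of which only the restriction to the
   disk is relevant. *)
Definition extreme_point_Hinf_ball (b : C -> C) : Prop :=
  Hinf_ball b /\
  forall (f g : C -> C) (t : R), Hinf_ball f -> Hinf_ball g -> 0 < t < 1 ->
    (forall z, disk z -> b z = t%:C%C * f z + (1 - t)%:C%C * g z) ->
    forall z, disk z -> f z = b z /\ g z = b z.

Definition nonextreme (b : C -> C) : Prop := ~ extreme_point_Hinf_ball b.

Definition toeplitz (b : C -> C) (f : hardy) : hardy :=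
  xget 0 [set g | forall z, disk z -> heval g z = b z * heval f z].

Definition adjoint (T : hardy -> hardy) (g : hardy) : hardy :=
  xget 0 [set h | forall f, hdot (T f) g = hdot f h].

Definition bounded_operator (S : hardy -> hardy) : Prop :=
  linear S /\ exists M : R, forall f, hnorm (S f) <= M * hnorm f.

Definition positive_operator (S : hardy -> hardy) : Prop :=
  bounded_operator S /\ forall f, 0 <= hdot (S f) f.

Definition operator_sqrt (T : hardy -> hardy) : hardy -> hardy :=
  xget (fun=> 0) [set S | positive_operator S /\ forall f, S (S f) = T f].

Definition dbr_operator (b : C -> C) : hardy -> hardy :=
  operator_sqrt (fun f => f - toeplitz b (adjoint (toeplitz b) f)).

Definition dbr_space (b : C -> C) : set hardy := range (dbr_operator b).

Definition ker_orthogonal (S : hardy -> hardy) : set hardy :=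
  [set f | forall k, S k = 0 -> hdot f k = 0].

Definition dbr_lift (b : C -> C) (h : hardy) : hardy :=
  xget 0 [set f | dbr_operator b f = h /\ ker_orthogonal (dbr_operator b) f].

Definition dbr_dot (b : C -> C) (h k : hardy) : C :=
  hdot (dbr_lift b h) (dbr_lift b k).

Definition dbr_norm (b : C -> C) (h : hardy) : R :=
  Num.sqrt (complex.Re (dbr_dot b h h)).

(* The value at lambda = 0 is the limit of the general formula. It is what
   mu = |alpha|^2 delta_0 requires: 1 and z have norms 1 and
   (1 + |alpha|^2)^(1/2) in D(mu), and norms 1 and (1 - |A|^2)^(-1/2) in H(A z).
   The value 1 / (1 + |alpha|^2) found in print agrees with it only if
   |alpha| = 1. *)
Definition A_sqr (alpha lambda : C) : R :=
  let a := cmod alpha ^+ 2 in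
  let l := cmod lambda ^+ 2 in
  if lambda == 0 then a / (1 + a)
  else a / (2 * l) * ((1 + a + l) - Num.sqrt ((1 + a + l) ^+ 2 - 4 * l)).

Definition B_coef (alpha lambda A : C) : C :=
  if alpha == 0 then 0
  else (cmod A ^+ 2)%:C%C * lambda^* / (cmod alpha ^+ 2)%:C%C.

End HardySpace.

(* Main.v *)
(* Let T be multiplication by b on H^2, P = 1 - T T^*, and let S and L be the
   forward and backward shifts. A Hilbert space of functions in which
   <P g, f> = <g, f>_{H^2} is determined by P: it consists of the f for which
   2 Re <f, g> - <P g, g> is bounded above in g, and the supremum is the square
   of the norm of f. H(b) is such a space, since it is the range of P^{1/2}; for
   mu = a delta_lambda and b = A z / (1 - B z) so is D(mu), because with
   p = T T^* g the difference quotient of P g at lambda is (L p - conj lambda p) / a.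

   Conversely, suppose that D(mu) = H(b) isometrically. In D(mu) one has
   |S f|^2 = |f|^2 + int |f|^2 dmu, whereas in H(b) one has |S f| <= |f| as soon as
   f is orthogonal to L b. Hence some nonzero p + r z vanishes mu-almost
   everywhere and mu = a delta_lambda. Comparing the inner products of P z with
   the elements of both spaces turns into a three-term recurrence for the Taylor
   coefficients of b, whose square-summable solutions are geometric. *)

(* Elements of H^2 are coefficient sequences without boundary values, so the contractivity of
   multiplication by [b] is obtained from averages over roots of unity on circles of radius less
   than 1.

   The norm of H(b) is defined through a preimage under P^{1/2} orthogonal to the kernel. A
   maximizing sequence of the variational problem produces that preimage; the same maximization
   produces the difference quotient for D(mu). Measurability of zeta -> D_zeta(f) is not established
   for general [f]: integrals are evaluated only for polynomials of degree at most 2, where D_zeta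
   is explicit, and for point masses.

   Orthogonality to L b is one linear condition, so a nonzero combination of 1 and z meets it, and p
   + r z has at most one zero unless it vanishes identically.

   The constants are |A|^2 = a y and B = y conj lambda, where y is the smaller root of |lambda|^2
   y^2 - (1 + a + |lambda|^2) y + 1 (the only root if lambda = 0). The recurrence for the
   coefficients of [b] has the characteristic roots y conj lambda and, if lambda <> 0, 1 / (lambda
   y); the latter has modulus at least 1, so square-summability discards it. *)
Require Import Defs.
From mathcomp Require Import all_boot all_order all_algebra.
From mathcomp Require Import complex.
From mathcomp Require Import all_classical all_reals all_analysis.
From mathcomp Require Import cyclic separable cyclotomic.
From mathcomp Require Import measurable_realfun.
From mathcomp Require Import lra ring.

Set Implicit Arguments.
Unset Strict Implicit.
Unset Printing Implicit Defensive.

Import Order.TTheory GRing.Theory Num.Theory.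
Import numFieldNormedType.Exports.

Local Open Scope classical_set_scope.
Local Open Scope ring_scope.

(** * Real-valued modulus and convergence in R[i] *)

Section ComplexModulus.
Variable R : realType.
Local Notation C := R[i].
Implicit Types (x y z : C) (u : nat -> C).

Lemma ReD x y : complex.Re (x + y) = complex.Re x + complex.Re y.
Proof. by case: x; case: y. Qed.

Lemma ReN x : complex.Re (- x) = - complex.Re x.
Proof. by case: x. Qed.

Lemma ReZ (a : R) x : complex.Re (a%:C%C * x) = a * complex.Re x.
Proof. by case: x => p q /=; rewrite mul0r subr0. Qed.

Lemma Re_sum n (F : 'I_n -> C) :
  complex.Re (\sum_(i < n) F i) = \sum_(i < n) complex.Re (F i).
Proof. exact: (big_morph (@complex.Re R) ReD). Qed.

Lemma conjE x : x^* = conjc x.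
Proof. by []. Qed.

Lemma Re_conj x : complex.Re x^* = complex.Re x.
Proof. by rewrite conjE; case: x. Qed.

Lemma conjR (a : R) : (a%:C%C : C)^* = a%:C%C.
Proof. by rewrite conjE conjc_real. Qed.

Lemma cmod_sqrE x : cmod x ^+ 2 = complex.Re x ^+ 2 + complex.Im x ^+ 2.
Proof.
by rewrite /cmod complex.normc_def /= sqr_sqrtr // addr_ge0 // sqr_ge0.
Qed.

Lemma mul_conjC x : x * x^* = (cmod x ^+ 2)%:C%C.
Proof. by rewrite -normCK rmorphXn /= cmodE. Qed.

Lemma Re_mul_conj x : complex.Re (x * x^*) = cmod x ^+ 2.
Proof. by rewrite mul_conjC. Qed.

Lemma cmod0 : cmod (0 : C) = 0.
Proof. by rewrite /cmod normr0. Qed.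

Lemma cmod1 : cmod (1 : C) = 1.
Proof. by rewrite /cmod normr1. Qed.

Lemma cmodN x : cmod (- x) = cmod x.
Proof. by rewrite /cmod normrN. Qed.

Lemma cmodB x y : cmod (x - y) = cmod (y - x).
Proof. by rewrite -cmodN opprB. Qed.

Lemma cmod_conj x : cmod x^* = cmod x.
Proof. by rewrite /cmod norm_conjC. Qed.

Lemma cmodX x n : cmod (x ^+ n) = cmod x ^+ n.
Proof. by elim: n => [|n IH]; rewrite ?expr0 ?cmod1 // !exprS cmodM IH. Qed.

Lemma cmodR (a : R) : cmod a%:C%C = `|a|.
Proof. by apply: (@complex.complexI R); rewrite cmodE normc_def /= expr0n addr0 sqrtr_sqr. Qed.

Lemma cmod_eq0 x : (cmod x == 0) = (x == 0).
Proof. by rewrite -(inj_eq (@complex.complexI R)) cmodE normr_eq0. Qed.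

Lemma cmod_gt0 x : (0 < cmod x) = (x != 0).
Proof. by rewrite lt0r cmod_ge0 cmod_eq0 andbT. Qed.

Lemma cmod_sum n (F : 'I_n -> C) : cmod (\sum_(i < n) F i) <= \sum_(i < n) cmod (F i).
Proof.
elim: n F => [|n IH] F; first by rewrite !big_ord0 cmod0.
by rewrite !big_ord_recr (le_trans (ler_cmodD _ _)) // lerD2r.
Qed.

Lemma Re_le_cmod x : `|complex.Re x| <= cmod x.
Proof.
rewrite -ler_sqr ?nnegrE ?cmod_ge0 // cmod_sqrE real_normK ?num_real //.
by rewrite lerDl sqr_ge0.
Qed.

Lemma Im_le_cmod x : `|complex.Im x| <= cmod x.
Proof.
rewrite -ler_sqr ?nnegrE ?cmod_ge0 // cmod_sqrE real_normK ?num_real //.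
by rewrite lerDr sqr_ge0.
Qed.

Lemma cmod_le_ReIm x : cmod x <= `|complex.Re x| + `|complex.Im x|.
Proof.
rewrite -ler_sqr ?nnegrE ?cmod_ge0 ?addr_ge0 // cmod_sqrE sqrrD.
rewrite !real_normK ?num_real //; have := mulr_ge0 (normr_ge0 (complex.Re x)) (normr_ge0 (complex.Im x)).
by lra.
Qed.

Lemma ler_cmodB x y : cmod x - cmod y <= cmod (x - y).
Proof. by rewrite lerBlDr (le_trans _ (ler_cmodD _ _)) // subrK. Qed.

(** The norm of R[i] takes values in R[i], so its epsilons are positive elements of R[i]; these are
    real, which lets limits be handled in R from here on. *)
Lemma cvgC_cmod (T : Type) (F : set_system T) (f : T -> C) (l : C) {FF : Filter F} :
  (f @ F --> l) <-> ((fun t => cmod (f t - l)) @ F --> (0 : R)).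
Proof.
split=> [/cvgrPdist_lt h|/cvgrPdist_lt h]; apply/cvgrPdist_lt => e e0.
  have e0' : 0 < (e%:C%C : C) by rewrite (ltcR 0 e).
  apply: filterS (h _ e0') => t; rewrite -cmodE ltcR sub0r normrN ger0_norm ?cmod_ge0 //.
  by rewrite cmodB.
have [e1 e1E] : exists e1, e = e1%:C%C.
  by exists (complex.Re e); rewrite RRe_real // gtr0_real.
rewrite e1E (ltcR 0) in e0 *.
apply: filterS (h _ e0) => t; rewrite -cmodE ltcR sub0r normrN ger0_norm ?cmod_ge0 //.
by rewrite cmodB.
Qed.

Lemma cvg_Re (T : Type) (F : set_system T) (f : T -> C) (l : C) {FF : Filter F} :
  f @ F --> l -> (fun t => complex.Re (f t)) @ F --> complex.Re l.
Proof.
move=> /cvgC_cmod /cvgrPdist_lt h; apply/cvgrPdist_lt => e /h; apply: filterS => t.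
rewrite sub0r normrN ger0_norm ?cmod_ge0 // cmodB; apply: le_lt_trans.
by rewrite -ReN -ReD Re_le_cmod.
Qed.

Lemma cvg_cmod (T : Type) (F : set_system T) (f : T -> C) (l : C) {FF : Filter F} :
  f @ F --> l -> (fun t => cmod (f t)) @ F --> cmod l.
Proof.
move=> /cvgC_cmod /cvgrPdist_lt h; apply/cvgrPdist_lt => e /h; apply: filterS => t.
rewrite sub0r normrN ger0_norm ?cmod_ge0 //; apply: le_lt_trans.
have := ler_cmodB (f t) l; have := ler_cmodB l (f t); rewrite (cmodB l) ler_norml.
by move=> h1 h2; apply/andP; split; lra.
Qed.

Lemma cvgC_ReIm (f : nat -> C) (a b : R) :
  (fun n => complex.Re (f n)) @ \oo --> a -> (fun n => complex.Im (f n)) @ \oo --> b ->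
  f @ \oo --> (Complex a b : C).
Proof.
move=> ha hb; apply/cvgC_cmod.
have h : (fun n => `|complex.Re (f n) - a| + `|complex.Im (f n) - b|) @ \oo --> (0 : R).
  rewrite -[X in _ --> X](addr0 (0:R)); apply: cvgD.
    by apply/norm_cvg0P; rewrite -(subrr a); apply: cvgB => //; exact: cvg_cst.
  by apply/norm_cvg0P; rewrite -(subrr b); apply: cvgB => //; exact: cvg_cst.
apply: squeeze_cvgr h; last exact: cvg_cst.
near=> n; rewrite cmod_ge0 (le_trans (cmod_le_ReIm _)) //.
by case: (f n).
Unshelve. all: by end_near. Qed.

Lemma is_cvg_seriesC u : cvgn (series (fun n => cmod (u n))) -> cvgn (series u).
Proof.
move=> h.
have hRe : cvgn (series (fun n => complex.Re (u n))).
  apply: normed_cvg; apply: series_le_cvg h => [n|n|n] /=; rewrite ?normr_ge0 ?cmod_ge0 //.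
  exact: Re_le_cmod.
have hIm : cvgn (series (fun n => complex.Im (u n))).
  apply: normed_cvg; apply: series_le_cvg h => [n|n|n] /=; rewrite ?normr_ge0 ?cmod_ge0 //.
  exact: Im_le_cmod.
apply/cvg_ex; eexists; apply: cvgC_ReIm.
  have -> : (fun n => complex.Re (series u n)) = series (fun n => complex.Re (u n)).
    apply/funext => n; rewrite /series /=; elim/big_ind2: _ => //= a b c d <- <-.
    exact: ReD.
  exact: hRe.
have -> : (fun n => complex.Im (series u n)) = series (fun n => complex.Im (u n)).
  apply/funext => n; rewrite /series /=; elim/big_ind2: _ => //= a b c d <- <-.
  by case: b; case: d.
exact: hIm.
Qed.

Lemma cvgC_unique u (l l' : C) : u @ \oo --> l -> u @ \oo --> l' -> l = l'.
Proof. by move=> /cvg_lim <- // /cvg_lim <-. Qed.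

End ComplexModulus.

(** * The inner product and norm of H^2 *)

Section SquareSummable.
Variable R : realType.
Local Notation C := R[i].
Implicit Types (f g h : hardy R).

Lemma taylorD f g n : taylor (f + g) n = taylor f n + taylor g n.
Proof. by []. Qed.

Lemma taylorN f n : taylor (- f) n = - taylor f n.
Proof. by []. Qed.

Lemma taylorB f g n : taylor (f - g) n = taylor f n - taylor g n.
Proof. by []. Qed.

Lemma taylorZ (a : C) f n : taylor (a *: f) n = a * taylor f n.
Proof. by []. Qed.

Lemma taylor0 n : taylor (0 : hardy R) n = 0.
Proof. by []. Qed.

Lemma hardyP f g : (forall n, taylor f n = taylor g n) -> f = g.
Proof. by move=> fg; apply/val_inj/funext. Qed.

Lemma is_cvg_sqr f : cvgn (series (fun n => cmod (taylor f n) ^+ 2)).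
Proof. by have /asboolP := taylorP f. Qed.

Arguments is_cvg_sqr : clear implicits.

Lemma hnorm_ge0 f : 0 <= hnorm f.
Proof. exact: sqrtr_ge0. Qed.

Lemma nondecreasing_series_ge0 (u : R^nat) : (forall n, 0 <= u n) ->
  nondecreasing_seq (series u).
Proof.
move=> u0; apply/nondecreasing_seqP => n.
by rewrite /series /= big_nat_recr //= lerDl.
Qed.

Lemma sum_le_lim (u : R^nat) N : (forall n, 0 <= u n) -> cvgn (series u) ->
  \sum_(i < N) u i <= limn (series u).
Proof.
move=> u0 cu; have := nondecreasing_cvgn_le (nondecreasing_series_ge0 u0) cu N.
by rewrite /series /= big_mkord.
Qed.

Lemma bounded_series (u : R^nat) K : (forall n, 0 <= u n) ->
  (forall N, \sum_(i < N) u i <= K) -> cvgn (series u) /\ limn (series u) <= K.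
Proof.
move=> u0 uK; have cu : cvgn (series u).
  apply: nondecreasing_is_cvgn; first exact: nondecreasing_series_ge0.
  by exists K => _ [n _ <-]; rewrite /series /= big_mkord.
split=> //; apply: limr_le => //; near=> n; rewrite /series /= big_mkord //.
Unshelve. all: by end_near. Qed.

Lemma hnorm_sqr f : hnorm f ^+ 2 = limn (series (fun n => cmod (taylor f n) ^+ 2)).
Proof.
rewrite sqr_sqrtr // (le_trans _ (sum_le_lim 0 _ (is_cvg_sqr f))) ?big_ord0 //.
by move=> n; rewrite sqr_ge0.
Qed.

Lemma sum_sqr_le f N : \sum_(i < N) cmod (taylor f i) ^+ 2 <= hnorm f ^+ 2.
Proof. by rewrite hnorm_sqr; apply: sum_le_lim (is_cvg_sqr f) => n; rewrite sqr_ge0. Qed.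

Lemma taylor_le f n : cmod (taylor f n) <= hnorm f.
Proof.
rewrite -ler_sqr ?nnegrE ?cmod_ge0 ?hnorm_ge0 // (le_trans _ (sum_sqr_le f n.+1)) //.
by rewrite big_ord_recr /= lerDr sumr_ge0 // => i _; rewrite sqr_ge0.
Qed.

Lemma hnorm_sqr_le f K : (forall N, \sum_(i < N) cmod (taylor f i) ^+ 2 <= K) ->
  hnorm f ^+ 2 <= K.
Proof. by move=> h; rewrite hnorm_sqr; apply: (bounded_series _ h).2 => n; rewrite sqr_ge0. Qed.

(** Monomials, shifts, kernels, limits and Riesz representatives are all built from a uniform bound
    on partial sums. The result is a [sig2], so that definitions can extract the witness. *)
Lemma hardy_of_bound (a : nat -> C) K :
  (forall N, \sum_(i < N) cmod (a i) ^+ 2 <= K) ->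
  {f | taylor f = a & hnorm f ^+ 2 <= K}.
Proof.
move=> h; have ha : a \in @square_summable R.
  by apply/asboolP; apply: (bounded_series _ h).1 => n; rewrite sqr_ge0.
by exists (Hardy ha) => //; apply: hnorm_sqr_le.
Qed.

Lemma is_cvg_normed_dot f g :
  cvgn (series (fun n => cmod (taylor f n * (taylor g n)^*))).
Proof.
have h : cvgn (series (fun n => cmod (taylor f n) ^+ 2 + cmod (taylor g n) ^+ 2)).
  have -> : series (fun n => cmod (taylor f n) ^+ 2 + cmod (taylor g n) ^+ 2) =
    (fun n => series (fun n => cmod (taylor f n) ^+ 2) n
              + series (fun n => cmod (taylor g n) ^+ 2) n).
    by apply/funext => n; rewrite /series /= big_split.
  by apply: is_cvgD; exact: is_cvg_sqr.
apply: series_le_cvg h => n.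
- exact: cmod_ge0.
- by rewrite addr_ge0 ?sqr_ge0.
rewrite cmodM cmod_conj.
have := sqr_ge0 (cmod (taylor f n) - cmod (taylor g n)).
have := mulr_ge0 (cmod_ge0 (taylor f n)) (cmod_ge0 (taylor g n)).
by rewrite sqrrB; lra.
Qed.

Lemma is_cvg_dot f g : cvgn (series (fun n => taylor f n * (taylor g n)^*)).
Proof. exact/is_cvg_seriesC/is_cvg_normed_dot. Qed.

Arguments is_cvg_dot : clear implicits.

Lemma hdotDl f1 f2 g : hdot (f1 + f2) g = hdot f1 g + hdot f2 g.
Proof.
rewrite /hdot -limD; [|exact: is_cvg_dot|exact: is_cvg_dot].
congr (limn _); apply/funext => n; rewrite /series /= fctE -big_split /=.
by apply: eq_bigr => i _; rewrite mulrDl.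
Qed.

Lemma hdotZl (a : C) f g : hdot (a *: f) g = a * hdot f g.
Proof.
apply: cvg_lim => //.
have -> : series (fun n => taylor (a *: f) n * (taylor g n)^*) =
  (fun n => a * series (fun n => taylor f n * (taylor g n)^*) n).
  apply/funext => n; rewrite /series /= big_distrr /=.
  by apply: eq_bigr => i _; rewrite mulrA.
by apply: cvgM; [exact: cvg_cst|exact: is_cvg_dot].
Qed.

Lemma cvg_conj (u : nat -> C) (l : C) : u @ \oo --> l -> (fun n => (u n)^*) @ \oo --> l^*.
Proof.
move=> /cvgC_cmod h; apply/cvgC_cmod; apply: cvg_trans h; apply: near_eq_cvg.
by near=> n; rewrite -rmorphB cmod_conj.
Unshelve. all: by end_near. Qed.

Lemma hdotC f g : hdot g f = (hdot f g)^*.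
Proof.
apply: cvg_lim => //; have := cvg_conj (is_cvg_dot f g); apply: cvg_trans.
apply: near_eq_cvg; near=> n; rewrite /series /= rmorph_sum /=.
by apply: eq_bigr => i _; rewrite rmorphM /= conjCK mulrC.
Unshelve. all: by end_near. Qed.

Lemma hdotff f : hdot f f = (hnorm f ^+ 2)%:C%C.
Proof.
apply: cvg_lim => //; rewrite hnorm_sqr.
have -> : series (fun n => taylor f n * (taylor f n)^*) =
   (fun n => (series (fun n => cmod (taylor f n) ^+ 2) n)%:C%C).
  apply/funext => n; rewrite /series /= rmorph_sum /=.
  by apply: eq_bigr => i _; rewrite mul_conjC.
apply: cvgC_ReIm => /=; [exact: is_cvg_sqr | exact: cvg_cst].
Qed.

Lemma hdotZr (a : C) f g : hdot f (a *: g) = a^* * hdot f g.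
Proof. by rewrite hdotC hdotZl rmorphM /= -hdotC. Qed.

Lemma hdotDr f g1 g2 : hdot f (g1 + g2) = hdot f g1 + hdot f g2.
Proof. by rewrite hdotC hdotDl rmorphD /= -!hdotC. Qed.

Lemma hdotNl f g : hdot (- f) g = - hdot f g.
Proof. by rewrite -scaleN1r hdotZl mulN1r. Qed.

Lemma hdotNr f g : hdot f (- g) = - hdot f g.
Proof. by rewrite hdotC hdotNl rmorphN /= -hdotC. Qed.

Lemma hdotBl f1 f2 g : hdot (f1 - f2) g = hdot f1 g - hdot f2 g.
Proof. by rewrite hdotDl hdotNl. Qed.

Lemma hdotBr f g1 g2 : hdot f (g1 - g2) = hdot f g1 - hdot f g2.
Proof. by rewrite hdotDr hdotNr. Qed.

Lemma hdot0l g : hdot 0 g = 0.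
Proof. by rewrite -(scale0r (0 : hardy R)) hdotZl mul0r. Qed.

Lemma hdot0r f : hdot f 0 = 0.
Proof. by rewrite hdotC hdot0l rmorph0. Qed.

(** The norm expansions involve only the real part of the inner product, and the real part already
    determines a vector, since multiples by i are allowed as test vectors. *)
Definition rdot f g : R := complex.Re (hdot f g).

Lemma rdotC f g : rdot f g = rdot g f.
Proof. by rewrite /rdot hdotC Re_conj. Qed.

Lemma rdotDl f1 f2 g : rdot (f1 + f2) g = rdot f1 g + rdot f2 g.
Proof. by rewrite /rdot hdotDl ReD. Qed.

Lemma rdotDr f g1 g2 : rdot f (g1 + g2) = rdot f g1 + rdot f g2.
Proof. by rewrite /rdot hdotDr ReD. Qed.

Lemma rdotNl f g : rdot (- f) g = - rdot f g.
Proof. by rewrite /rdot hdotNl ReN. Qed.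

Lemma rdotNr f g : rdot f (- g) = - rdot f g.
Proof. by rewrite /rdot hdotNr ReN. Qed.

Lemma rdotBl f1 f2 g : rdot (f1 - f2) g = rdot f1 g - rdot f2 g.
Proof. by rewrite rdotDl rdotNl. Qed.

Lemma rdotBr f g1 g2 : rdot f (g1 - g2) = rdot f g1 - rdot f g2.
Proof. by rewrite rdotDr rdotNr. Qed.

Lemma rdotZl (a : R) f g : rdot (a%:C%C *: f) g = a * rdot f g.
Proof. by rewrite /rdot hdotZl ReZ. Qed.

Lemma rdotZr (a : R) f g : rdot f (a%:C%C *: g) = a * rdot f g.
Proof. by rewrite rdotC rdotZl rdotC. Qed.

Lemma rdot0l g : rdot 0 g = 0.
Proof. by rewrite /rdot hdot0l. Qed.

Lemma rdotff f : rdot f f = hnorm f ^+ 2.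
Proof. by rewrite /rdot hdotff. Qed.

Lemma hnorm_eq0 f : hnorm f = 0 -> f = 0.
Proof.
move=> f0; apply: hardyP => n; apply/eqP; rewrite -cmod_eq0 eq_le cmod_ge0 andbT.
by rewrite -f0 taylor_le.
Qed.

Lemma hnorm0 : hnorm (0 : hardy R) = 0.
Proof. by apply/eqP; rewrite -sqrf_eq0 -rdotff rdot0l. Qed.

Lemma hnormD_sqr f g : hnorm (f + g) ^+ 2 = hnorm f ^+ 2 + 2 * rdot f g + hnorm g ^+ 2.
Proof. by rewrite -!rdotff rdotDl !rdotDr (rdotC g f); ring. Qed.

Lemma hnormB_sqr f g : hnorm (f - g) ^+ 2 = hnorm f ^+ 2 - 2 * rdot f g + hnorm g ^+ 2.
Proof. by rewrite -!rdotff rdotBl !rdotBr (rdotC g f); ring. Qed.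

Lemma hnormZ_sqr (a : C) f : hnorm (a *: f) ^+ 2 = cmod a ^+ 2 * hnorm f ^+ 2.
Proof.
by rewrite -!rdotff /rdot hdotZl hdotZr mulrA mul_conjC ReZ.
Qed.

Lemma hnormZ (a : C) f : hnorm (a *: f) = cmod a * hnorm f.
Proof.
apply/eqP; rewrite -(@eqrXn2 _ 2) ?mulr_ge0 ?hnorm_ge0 ?cmod_ge0 //.
by rewrite hnormZ_sqr exprMn.
Qed.

Lemma hnormN f : hnorm (- f) = hnorm f.
Proof. by rewrite -scaleN1r hnormZ cmodN cmod1 mul1r. Qed.

Lemma hnormB f g : hnorm (f - g) = hnorm (g - f).
Proof. by rewrite -hnormN opprB. Qed.

Lemma rdot_le f g : rdot f g <= hnorm f * hnorm g.
Proof.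
have [f0|f0] := eqVneq (hnorm f) 0.
  by rewrite (hnorm_eq0 f0) rdot0l hnorm0 mul0r.
have [g0|g0] := eqVneq (hnorm g) 0.
  by rewrite (hnorm_eq0 g0) rdotC rdot0l hnorm0 mulr0.
have fp : 0 < hnorm f by rewrite lt0r f0 hnorm_ge0.
have gp : 0 < hnorm g by rewrite lt0r g0 hnorm_ge0.
have := sqr_ge0 (hnorm ((hnorm g)%:C%C *: f - (hnorm f)%:C%C *: g)).
rewrite hnormB_sqr rdotZl rdotZr !hnormZ !cmodR !ger0_norm ?hnorm_ge0 //.
have -> : (hnorm g * hnorm f) ^+ 2 - 2 * (hnorm g * (hnorm f * rdot f g)) +
  (hnorm f * hnorm g) ^+ 2 = 2 * ((hnorm f * hnorm g) * (hnorm f * hnorm g - rdot f g)) by ring.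
by rewrite pmulr_rge0 // pmulr_rge0 ?mulr_gt0 // subr_ge0.
Qed.

(** Multiplying [f] by the conjugate of <f, g> turns the product into |<f, g>|^2, which is real, so
    the bound for [rdot] applies. *)
Lemma hdot_le f g : cmod (hdot f g) <= hnorm f * hnorm g.
Proof.
have [h0|h0] := eqVneq (hdot f g) 0.
  by rewrite h0 cmod0 mulr_ge0 ?hnorm_ge0.
have hp : 0 < cmod (hdot f g) by rewrite cmod_gt0.
have := rdot_le ((hdot f g)^* *: f) g.
rewrite /rdot hdotZl mulrC Re_mul_conj hnormZ cmod_conj expr2 -mulrA.
by rewrite ler_pM2l.
Qed.

Lemma ler_hnormD f g : hnorm (f + g) <= hnorm f + hnorm g.
Proof.
rewrite -ler_sqr ?nnegrE ?addr_ge0 ?hnorm_ge0 // hnormD_sqr sqrrD.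
by have := rdot_le f g; lra.
Qed.

Lemma ler_hnorm_dist f g h : hnorm (f - h) <= hnorm (f - g) + hnorm (g - h).
Proof. by rewrite (le_trans _ (ler_hnormD _ _)) // addrA subrK. Qed.

End SquareSummable.
Arguments is_cvg_dot {R} f g.
Arguments is_cvg_sqr {R} f.


(** * Completeness, polynomials and Riesz representation in H^2 *)

Section Hilbert.
Variable R : realType.
Local Notation C := R[i].
Implicit Types (f g h : hardy R).

Lemma is_cvg_cauchy (u : R^nat) :
  (forall e, 0 < e -> exists N, forall m n, (N <= m)%N -> (N <= n)%N ->
     `|u m - u n| <= e) -> cvgn u.
Proof.
move=> h; apply/cauchy_cvgP/cauchy_exP => e e0.
have e20 : 0 < e / 2 by rewrite divr_gt0.
have [N hN] := h _ e20.
exists (u N); exists N => // n Nn; rewrite /ball /= (le_lt_trans (hN N n _ _)) //.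
by lra.
Qed.

Section LinearMap.
Variables (V : lmodType C) (T : hardy R -> V).
Hypothesis Tl : linear T.

Lemma linD f g : T (f + g) = T f + T g.
Proof. by have := Tl 1 f g; rewrite !scale1r. Qed.

Lemma lin0 : T 0 = 0.
Proof. by apply: (addIr (T 0)); rewrite -linD !add0r. Qed.

Lemma linZ (a : C) f : T (a *: f) = a *: T f.
Proof. by have := Tl a f 0; rewrite !addr0 lin0 addr0. Qed.

Lemma linN f : T (- f) = - T f.
Proof. by rewrite -[- f]scaleN1r linZ scaleN1r. Qed.

Lemma linB f g : T (f - g) = T f - T g.
Proof. by rewrite linD linN. Qed.

Lemma lin_sum n (F : 'I_n -> hardy R) :
  T (\sum_(i < n) F i) = \sum_(i < n) T (F i).
Proof. exact: (big_morph T linD lin0). Qed.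

End LinearMap.

Lemma cvg_sum_ord (u : nat -> R^nat) (l : R^nat) K :
  (forall i, u ^~ i @ \oo --> l i) ->
  (fun n => \sum_(i < K) u n i) @ \oo --> \sum_(i < K) l i.
Proof.
move=> h; elim: K => [|K IH].
  have -> : (fun n => \sum_(i < 0) u n i) = (fun=> 0).
    by apply/funext => n; rewrite big_ord0.
  by rewrite big_ord0; exact: cvg_cst.
have -> : (fun n => \sum_(i < K.+1) u n i) = (fun n => \sum_(i < K) u n i + u n K).
  by apply/funext => n; rewrite big_ord_recr.
by rewrite big_ord_recr; apply: cvgD.
Qed.

(** Norm convergence is expressed by a real sequence because [hardy] is given only its module
    structure, not a topology. *)
Definition hcvg (g : nat -> hardy R) (u : hardy R) :=
  (fun n => hnorm (g n - u)) @ \oo --> (0 : R).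

Lemma hcvgP (g : nat -> hardy R) u :
  (forall e, 0 < e -> exists N, forall n, (N <= n)%N -> hnorm (g n - u) <= e) ->
  hcvg g u.
Proof.
move=> h; apply/cvgrPdist_le => e /h [N hN]; exists N => // n /hN.
by rewrite sub0r normrN ger0_norm ?hnorm_ge0.
Qed.

Lemma hcvgE (g : nat -> hardy R) u : hcvg g u ->
  forall e, 0 < e -> exists N, forall n, (N <= n)%N -> hnorm (g n - u) <= e.
Proof.
move=> /cvgrPdist_le h e /h [N _ hN]; exists N => n /hN /=.
by rewrite sub0r normrN ger0_norm ?hnorm_ge0.
Qed.

Lemma hcvg_cauchy (g : nat -> hardy R) u : hcvg g u ->
  forall e, 0 < e -> exists N, forall m n, (N <= m)%N -> (N <= n)%N ->
     hnorm (g m - g n) <= e.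
Proof.
move=> /hcvgE h e e0; have e20 : 0 < e / 2 by rewrite divr_gt0.
have {h} [N hN] := h _ e20; exists N => m n Nm Nn.
apply: le_trans (ler_hnorm_dist (g m) u (g n)) _.
rewrite [leRHS]splitr; apply: lerD; first exact: hN.
by rewrite hnormB; apply: hN.
Qed.

Lemma cvg_taylor (g : nat -> hardy R) u k : hcvg g u ->
  (fun n => taylor (g n) k) @ \oo --> taylor u k.
Proof.
move=> h; apply/cvgC_cmod; apply: squeeze_cvgr h; last exact: cvg_cst.
by near=> n; rewrite cmod_ge0 -taylorB taylor_le.
Unshelve. all: by end_near. Qed.

Lemma hardy_complete (g : nat -> hardy R) :
  (forall e, 0 < e -> exists N, forall m n, (N <= m)%N -> (N <= n)%N ->
     hnorm (g m - g n) <= e) -> exists u, hcvg g u.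
Proof.
move=> h.
have coord k : exists l : C, (fun n => taylor (g n) k) @ \oo --> l.
  have hRe : cvgn (fun n => complex.Re (taylor (g n) k)).
    apply: is_cvg_cauchy => e /h [N hN]; exists N => m n Nm Nn.
    apply: le_trans (hN m n Nm Nn); apply: le_trans (taylor_le _ k).
    by rewrite taylorB -ReN -ReD Re_le_cmod.
  have hIm : cvgn (fun n => complex.Im (taylor (g n) k)).
    apply: is_cvg_cauchy => e /h [N hN]; exists N => m n Nm Nn.
    apply: le_trans (hN m n Nm Nn); apply: le_trans (taylor_le _ k).
    apply: le_trans (Im_le_cmod _); rewrite taylorB.
    by case: (taylor (g m) k) => ? ?; case: (taylor (g n) k).
  by eexists; apply: cvgC_ReIm; [exact: hRe|exact: hIm].
have [v hv] := choice coord.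
(* The partial sums are finite, so the Cauchy bound survives n -> oo with an index N that does not
   depend on K. *)
have close e : 0 < e -> exists N, forall m, (N <= m)%N ->
    forall K, \sum_(i < K) cmod (taylor (g m) i - v i) ^+ 2 <= e ^+ 2.
  move=> /h [N hN]; exists N => m Nm K.
  have hl : (fun n => \sum_(i < K) cmod (taylor (g m) i - taylor (g n) i) ^+ 2) @ \oo -->
      \sum_(i < K) cmod (taylor (g m) i - v i) ^+ 2.
    apply: (@cvg_sum_ord (fun n i => cmod (taylor (g m) i - taylor (g n) i) ^+ 2)
      (fun i => cmod (taylor (g m) i - v i) ^+ 2)) => i.
    by apply: cvgM; apply: cvg_cmod; apply: cvgB (hv i); exact: cvg_cst.
  apply: (ler_cvg_to hl (cvg_cst (e ^+ 2))); exists N => // n Nn /=.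
  apply: le_trans (sum_sqr_le (g m - g n) K) _.
  by rewrite ler_sqr ?nnegrE ?hnorm_ge0 ?(le_trans (hnorm_ge0 (g m - g n))) ?hN.
have [N0 /(_ N0 (leqnn _)) hN0] := close 1 ltr01.
(* The partial sums bounded so far are those of [g N0 - v], not of [v]; hence this difference is put
   in H^2 and the limit is written [g N0 - w]. *)
have [w wE _] := @hardy_of_bound R (fun i => taylor (g N0) i - v i) _ hN0.
exists (g N0 - w); apply: hcvgP => e e0; have [N hN] := close e e0.
exists N => m Nm; rewrite -ler_sqr ?nnegrE ?hnorm_ge0 ?(ltW e0) //.
apply: hnorm_sqr_le => K; rewrite -(@eq_bigr _ _ _ _ _ _ (fun i : 'I_K => cmod (taylor (g m) i - v i) ^+ 2)) ?hN // => i _.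
by rewrite !taylorB wE; congr (cmod _ ^+ 2); ring.
Qed.

Lemma hcvg_cst u : hcvg (fun=> u) u.
Proof. by rewrite /hcvg subrr hnorm0; exact: cvg_cst. Qed.

Lemma hcvg_dot (g : nat -> hardy R) u f : hcvg g u ->
  (fun n => hdot (g n) f) @ \oo --> hdot u f.
Proof.
move=> h; apply/cvgC_cmod.
have h' : (fun n => hnorm (g n - u) * hnorm f) @ \oo --> (0 : R).
  by rewrite -[X in _ --> X](mul0r (hnorm f)); apply: cvgM h (cvg_cst _).
apply: squeeze_cvgr h'; last exact: cvg_cst.
by near=> n; rewrite cmod_ge0 -hdotBl hdot_le.
Unshelve. all: by end_near. Qed.

Lemma hcvg_rdot (g : nat -> hardy R) u f : hcvg g u ->
  (fun n => rdot (g n) f) @ \oo --> rdot u f.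
Proof. by move=> /hcvg_dot h; exact: cvg_Re. Qed.

Lemma hcvg_hnorm (g : nat -> hardy R) u : hcvg g u ->
  (fun n => hnorm (g n)) @ \oo --> hnorm u.
Proof.
move=> /cvgrPdist_le h; apply/cvgrPdist_le => e /h; apply: filterS => n.
rewrite sub0r normrN ger0_norm ?hnorm_ge0 // => hn.
have h1 := ler_hnormD (g n - u) u; have h2 := ler_hnormD (u - g n) (g n).
rewrite !subrK (hnormB u) in h1 h2.
by rewrite ler_norml; apply/andP; split; lra.
Qed.

Lemma hcvg_unique (g : nat -> hardy R) u v : hcvg g u -> hcvg g v -> u = v.
Proof.
move=> hu hv; apply: hardyP => k; have := cvg_taylor (k := k) hu.
by move/cvg_lim => <- //; have /cvg_lim -> := cvg_taylor (k := k) hv.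
Qed.

Lemma hcvg_squeeze (g : nat -> hardy R) u (e : R^nat) :
  (forall n, hnorm (g n - u) <= e n) -> e @ \oo --> (0 : R) -> hcvg g u.
Proof.
move=> h he; apply: squeeze_cvgr he; last exact: cvg_cst.
by near=> n; rewrite hnorm_ge0 h.
Unshelve. all: by end_near. Qed.

Lemma hcvgD (g1 g2 : nat -> hardy R) u1 u2 : hcvg g1 u1 -> hcvg g2 u2 ->
  hcvg (fun n => g1 n + g2 n) (u1 + u2).
Proof.
move=> h1 h2; apply: (@hcvg_squeeze _ _ (fun n => hnorm (g1 n - u1) + hnorm (g2 n - u2))).
  by move=> n; rewrite opprD addrACA ler_hnormD.
by rewrite -[X in _ --> X](addr0 0); apply: cvgD.
Qed.

Lemma hcvg_lin (T : hardy R -> hardy R) K (g : nat -> hardy R) u :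
  linear T -> (forall f, hnorm (T f) <= K * hnorm f) -> hcvg g u ->
  hcvg (fun n => T (g n)) (T u).
Proof.
move=> Tl TK h; apply: (@hcvg_squeeze _ _ (fun n => K * hnorm (g n - u))).
  move=> n; apply: le_trans (TK _).
  by rewrite (linB Tl).
by rewrite -[X in _ --> X](mulr0 K); apply: cvgM h; exact: cvg_cst.
Qed.

Fact monom_bound (k : nat) N :
  \sum_(i < N) cmod (((i : nat) == k)%:R : C) ^+ 2 <= 1.
Proof.
have [kN|kN] := ltnP k N.
  rewrite (bigD1 (Ordinal kN)) //= eqxx cmod1 expr1n big1 ?addr0 // => i.
  by rewrite -val_eqE /= => /negbTE ->; rewrite cmod0 expr0n.
rewrite big1 // => i _; rewrite ltn_eqF ?cmod0 ?expr0n //.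
exact: leq_trans (ltn_ord i) kN.
Qed.

Definition monom (k : nat) : hardy R :=
  s2val (@hardy_of_bound R (fun i => (i == k)%:R) 1 (monom_bound k)).

Lemma taylor_monom k n : taylor (monom k) n = (n == k)%:R.
Proof. by rewrite /monom; case: hardy_of_bound => f /= ->. Qed.

Lemma hdot_monom f k : hdot f (monom k) = taylor f k.
Proof.
apply: cvg_lim => //; apply: cvg_near_cst.
exists k.+1 => // n kn; rewrite /series /= big_mkord (bigD1 (Ordinal kn)) //=.
rewrite taylor_monom eqxx rmorph1 mulr1 big1 ?addr0 // => i.
by rewrite -val_eqE taylor_monom /= => /negbTE ->; rewrite rmorph0 mulr0.
Qed.

Definition trunc N f : hardy R := \sum_(k < N) taylor f k *: monom k.

Lemma taylor_sum n (F : 'I_n -> hardy R) k :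
  taylor (\sum_(i < n) F i) k = \sum_(i < n) taylor (F i) k.
Proof. by apply: (big_morph (fun f => taylor f k)). Qed.

Lemma taylor_poly (a : nat -> C) N n :
  taylor (\sum_(i < N) a i *: monom i) n = if (n < N)%N then a n else 0.
Proof.
rewrite taylor_sum (eq_bigr (fun i : 'I_N => a i * (n == i)%:R)) => [|i _]; last first.
  by rewrite taylorZ taylor_monom.
case: ltnP => nN.
  rewrite (bigD1 (Ordinal nN)) //= eqxx mulr1 big1 ?addr0 // => i.
  by rewrite -val_eqE eq_sym /= => /negbTE ->; rewrite mulr0.
rewrite big1 // => i _; rewrite gtn_eqF ?mulr0 //; exact: leq_trans (ltn_ord i) nN.
Qed.

Lemma taylor_trunc N f n : taylor (trunc N f) n = if (n < N)%N then taylor f n else 0.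
Proof. exact: taylor_poly. Qed.

Lemma hnorm_trunc N f : hnorm (trunc N f) ^+ 2 = \sum_(k < N) cmod (taylor f k) ^+ 2.
Proof.
apply/eqP; rewrite eq_le; apply/andP; split.
  apply: hnorm_sqr_le => M.
  apply: (@le_trans _ _ (\sum_(i < N + M) cmod (taylor (trunc N f) i) ^+ 2)).
    by rewrite addnC big_split_ord lerDl sumr_ge0 // => i _; rewrite sqr_ge0.
  rewrite big_split_ord /= [X in _ + X]big1 ?addr0.
    by apply: ler_sum => i _; rewrite taylor_trunc ltn_ord.
  by move=> i _; rewrite taylor_trunc ltnNge leq_addr cmod0 expr0n.
apply: le_trans (sum_sqr_le (trunc N f) N); apply: ler_sum => i _.
by rewrite taylor_trunc ltn_ord.
Qed.

Lemma rdot_trunc N f : rdot (trunc N f) f = hnorm (trunc N f) ^+ 2.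
Proof.
have dl : linear (fun g => hdot g f : C^o) by move=> a x y; rewrite hdotDl hdotZl.
rewrite hnorm_trunc /rdot /trunc (lin_sum dl) Re_sum; apply: eq_bigr => i _.
by rewrite hdotZl hdotC hdot_monom Re_mul_conj.
Qed.

Lemma hcvg_trunc f : hcvg (fun N => trunc N f) f.
Proof.
have h : (fun N => hnorm (trunc N f) ^+ 2) @ \oo --> hnorm f ^+ 2.
  have -> : (fun N => hnorm (trunc N f) ^+ 2) = series (fun n => cmod (taylor f n) ^+ 2).
    by apply/funext => N; rewrite hnorm_trunc /series /= big_mkord.
  by rewrite hnorm_sqr; exact: is_cvg_sqr.
have h2 : (fun N => hnorm (trunc N f - f) ^+ 2) @ \oo --> (0 : R).
  have -> : (fun N => hnorm (trunc N f - f) ^+ 2) = (fun N => hnorm f ^+ 2 - hnorm (trunc N f) ^+ 2).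
    by apply/funext => N; rewrite hnormB_sqr rdot_trunc; ring.
  by rewrite -(subrr (hnorm f ^+ 2)); apply: cvgB => //; exact: cvg_cst.
rewrite /hcvg.
have -> : (fun N => hnorm (trunc N f - f)) = (fun N => Num.sqrt (hnorm (trunc N f - f) ^+ 2)).
  by apply/funext => N; rewrite sqrtr_sqr ger0_norm ?hnorm_ge0.
rewrite -(sqrtr0 R); apply: (continuous_cvg _ _ h2); exact: sqrt_continuous.
Qed.

(** The representative has the coefficients conj (phi (z^n)). If s is the sum of the first N squared
    moduli, testing phi on the polynomial with these coefficients gives s <= K sqrt s, hence s <=
    K^2; density of the truncations does the rest. *)
Lemma riesz (phi : hardy R -> C) K :
  (forall (a : C) f g, phi (a *: f + g) = a * phi f + phi g) ->
  (forall f, cmod (phi f) <= K * hnorm f) ->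
  exists h, forall f, phi f = hdot f h.
Proof.
move=> phil phiK.
have phil' : linear (phi : hardy R -> C^o) by move=> a f g; rewrite phil.
pose a n := (phi (monom n))^*.
have bound N : \sum_(i < N) cmod (a i) ^+ 2 <= K ^+ 2.
  pose s : R := \sum_(i < N) cmod (a i) ^+ 2.
  have s0 : 0 <= s by apply: sumr_ge0 => i _; rewrite sqr_ge0.
  pose p : hardy R := \sum_(i < N) a i *: monom i.
  have tp n : taylor p n = if (n < N)%N then a n else 0 by exact: taylor_poly.
  have pE : p = trunc N p.
    by apply: eq_bigr => i _; rewrite tp ltn_ord.
  have np : hnorm p ^+ 2 = s.
    by rewrite pE hnorm_trunc; apply: eq_bigr => i _; rewrite tp ltn_ord.
  have php : phi p = s%:C%C.
    rewrite /p (lin_sum phil') rmorph_sum; apply: eq_bigr => i _.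
    by rewrite (linZ phil') -[RHS]mul_conjC /a conjCK.
  have := phiK p; rewrite php cmodR ger0_norm // => h.
  have h2 : s ^+ 2 <= K ^+ 2 * s.
    rewrite -np -exprMn ler_sqr ?nnegrE ?sqr_ge0 ?np // (le_trans s0) //.
  have [s_eq0|s_neq0] := eqVneq s 0; first by rewrite -/s s_eq0 sqr_ge0.
  by move: h2; rewrite expr2 ler_pM2r // lt0r s_neq0.
have [h hE _] := hardy_of_bound bound.
exists h => f.
have h1 : (fun N => phi (trunc N f)) @ \oo --> hdot f h.
  have -> : (fun N => phi (trunc N f)) = (fun N => hdot (trunc N f) h).
    apply/funext => N; rewrite /trunc (lin_sum phil').
    have dl : linear (fun g => hdot g h : C^o) by move=> b x y; rewrite hdotDl hdotZl.
    rewrite (lin_sum dl); apply: eq_bigr => i _; rewrite (linZ phil') (linZ dl); congr (_ *: _).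
    by rewrite hdotC hdot_monom hE conjCK.
  exact/hcvg_dot/hcvg_trunc.
have h2 : (fun N => phi (trunc N f)) @ \oo --> phi f.
  apply/cvgC_cmod.
  have h3 : (fun N => K * hnorm (trunc N f - f)) @ \oo --> (0 : R).
    by rewrite -[X in _ --> X](mulr0 K); apply: cvgM (hcvg_trunc f); exact: cvg_cst.
  apply: squeeze_cvgr h3; last exact: cvg_cst.
  by near=> N; rewrite cmod_ge0 -(linB phil') phiK.
by rewrite -(cvg_lim _ h1) // (cvg_lim _ h2).
Unshelve. all: by end_near. Qed.

End Hilbert.
Arguments monom {R} k.


(** * The two shifts, the Szego kernel and point evaluation *)

Section Shift.
Variable R : realType.
Local Notation C := R[i].
Implicit Types (f g h : hardy R) (z : C).

Fact shift_bound f N :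
  \sum_(i < N) cmod (if (i : nat) is m.+1 then taylor f m else 0) ^+ 2 <= hnorm f ^+ 2.
Proof.
case: N => [|N]; first by rewrite big_ord0 sqr_ge0.
by rewrite big_ord_recl /= cmod0 expr0n add0r sum_sqr_le.
Qed.

Definition shift f : hardy R :=
  s2val (@hardy_of_bound R (fun i => if i is m.+1 then taylor f m else 0) _ (shift_bound f)).

Lemma taylor_shift f n : taylor (shift f) n = if n is m.+1 then taylor f m else 0.
Proof. by rewrite /shift; case: hardy_of_bound => g /= ->. Qed.

Fact lshift_bound f N : \sum_(i < N) cmod (taylor f i.+1) ^+ 2 <= hnorm f ^+ 2.
Proof. by apply: le_trans (sum_sqr_le f N.+1); rewrite big_ord_recl lerDr sqr_ge0. Qed.

Definition lshift f : hardy R :=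
  s2val (@hardy_of_bound R (fun i => taylor f i.+1) _ (lshift_bound f)).

Lemma taylor_lshift f n : taylor (lshift f) n = taylor f n.+1.
Proof. by rewrite /lshift; case: hardy_of_bound => g /= ->. Qed.

Lemma shift_linear : linear shift.
Proof.
move=> a f g; apply: hardyP => -[|n]; rewrite taylorD taylorZ !taylor_shift //.
by rewrite mulr0 addr0.
Qed.

Lemma lshift_linear : linear lshift.
Proof. by move=> a f g; apply: hardyP => n; rewrite taylorD taylorZ !taylor_lshift. Qed.

Lemma lshiftK f : lshift (shift f) = f.
Proof. by apply: hardyP => n; rewrite taylor_lshift taylor_shift. Qed.

Lemma shift_lshift f : f = taylor f 0 *: monom 0 + shift (lshift f).
Proof.
apply: hardyP => -[|n]; rewrite taylorD taylorZ taylor_monom taylor_shift /= ?taylor_lshift.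
  by rewrite mulr1 addr0.
by rewrite mulr0 add0r.
Qed.

Lemma hdot_shift f g : hdot (shift f) g = hdot f (lshift g).
Proof.
apply: cvg_lim => //; rewrite -cvg_shiftS /=.
have -> : (fun n => series (fun n => taylor (shift f) n * (taylor g n)^*) n.+1) =
  series (fun n => taylor f n * (taylor (lshift g) n)^*).
  apply/funext => n; rewrite /series /= !big_mkord big_ord_recl /= taylor_shift mul0r add0r.
  by apply: eq_bigr => i _; rewrite taylor_shift taylor_lshift.
exact: is_cvg_dot.
Qed.

Lemma rdot_shift f g : rdot (shift f) g = rdot f (lshift g).
Proof. by rewrite /rdot hdot_shift. Qed.

Lemma hdot_lshift f g : hdot (lshift f) g = hdot f (shift g).
Proof. by rewrite hdotC -hdot_shift -hdotC. Qed.

Lemma hnorm_shift f : hnorm (shift f) = hnorm f.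
Proof.
apply/eqP; rewrite -(@eqrXn2 _ 2) ?hnorm_ge0 // -!rdotff.
by rewrite rdot_shift lshiftK.
Qed.

Lemma hnorm_lshift_sqr f : hnorm (lshift f) ^+ 2 = hnorm f ^+ 2 - cmod (taylor f 0) ^+ 2.
Proof.
rewrite -!rdotff /rdot hdot_lshift.
have -> : shift (lshift f) = f - taylor f 0 *: monom 0.
  by rewrite {2}(shift_lshift f) addrC addKr.
by rewrite hdotBr hdotZr hdot_monom ReD ReN mulrC Re_mul_conj.
Qed.

Lemma shift_monom k : shift (monom k) = monom k.+1.
Proof. by apply: hardyP => -[|n]; rewrite taylor_shift !taylor_monom. Qed.

Lemma hnorm_monom k : hnorm (monom k : hardy R) = 1.
Proof.
apply/eqP; rewrite -(@eqrXn2 _ 2) ?hnorm_ge0 // -rdotff /rdot hdot_monom.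
by rewrite taylor_monom eqxx expr1n.
Qed.

Lemma sum_geometric_le (q : R) N : 0 <= q < 1 -> \sum_(i < N) q ^+ i <= (1 - q)^-1.
Proof.
move=> /andP[q0 q1]; have q1' : 0 < 1 - q by rewrite subr_gt0.
rewrite -[leRHS]mul1r ler_pdivlMr // mulrC.
have -> : (1 - q) * \sum_(i < N) q ^+ i = 1 - q ^+ N.
  by rewrite -(opprB q) mulNr -subrX1 opprB.
by rewrite gerBl exprn_ge0.
Qed.

Fact szego_bound z N : disk z ->
  \sum_(i < N) cmod (z^* ^+ i) ^+ 2 <= (1 - cmod z ^+ 2)^-1.
Proof.
move=> dz; rewrite (eq_bigr (fun i : 'I_N => (cmod z ^+ 2) ^+ i)) => [|i _].
  by apply: sum_geometric_le; rewrite sqr_ge0 expr_lt1 ?cmod_ge0.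
by rewrite cmodX cmod_conj -!exprM mulnC.
Qed.

(** The kernel is w -> 1 / (1 - conj z w), with coefficients conj z ^ n. Evaluation becomes an inner
    product, so its linearity, its bound and its continuity are inherited from [hdot]. *)
Lemma szegoP z : disk z ->
  {k | (forall f, heval f z = hdot f k) & hnorm k ^+ 2 <= (1 - cmod z ^+ 2)^-1}.
Proof.
move=> dz; have [k kE kn] := @hardy_of_bound R (fun i => z^* ^+ i) _ (fun N => szego_bound N dz).
exists k => // f; rewrite /heval /hdot; congr (limn _); apply/funext => n.
rewrite /series /=; apply: eq_bigr => i _.
by rewrite kE rmorphXn /= conjCK.
Qed.

Lemma heval_linear z : disk z -> linear (fun f => heval f z : C^o).
Proof. by move=> /szegoP[k kE _] a f g; rewrite !kE hdotDl hdotZl. Qed.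

Lemma hevalB f g z : disk z -> heval (f - g) z = heval f z - heval g z.
Proof. by move=> dz; rewrite (linB (heval_linear dz)). Qed.

Lemma hevalD f g z : disk z -> heval (f + g) z = heval f z + heval g z.
Proof. by move=> dz; rewrite (linD (heval_linear dz)). Qed.

Lemma hevalZ (a : C) f z : disk z -> heval (a *: f) z = a * heval f z.
Proof. by move=> dz; rewrite (linZ (heval_linear dz)). Qed.

Lemma heval_le f z : disk z -> cmod (heval f z) <= hnorm f * Num.sqrt (1 - cmod z ^+ 2)^-1.
Proof.
move=> dz; have [k kE kn] := szegoP dz; rewrite kE (le_trans (hdot_le _ _)) //.
rewrite ler_wpM2l ?hnorm_ge0 // -[leLHS]ger0_norm ?hnorm_ge0 // -sqrtr_sqr.
exact: ler_wsqrtr.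
Qed.

Lemma hcvg_heval (g : nat -> hardy R) u z : disk z -> hcvg g u ->
  (fun n => heval (g n) z) @ \oo --> heval u z.
Proof.
move=> dz gu; have [k kE _] := szegoP dz; rewrite kE.
have -> : (fun n => heval (g n) z) = (fun n => hdot (g n) k) by apply/funext => n; rewrite kE.
exact: hcvg_dot.
Qed.

Lemma is_cvg_heval f z : disk z -> cvgn (series (fun n => taylor f n * z ^+ n)).
Proof.
move=> dz; have [k kE kn] := @hardy_of_bound R (fun i => z^* ^+ i) _ (fun N => szego_bound N dz).
have <- : series (fun n => taylor f n * (taylor k n)^*) = series (fun n => taylor f n * z ^+ n).
  apply/funext => n; rewrite /series /=.
  by apply: eq_bigr => i _; rewrite kE rmorphXn /= conjCK.
exact: is_cvg_dot.
Qed.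

Lemma heval_monom k z : disk z -> heval (monom k) z = z ^+ k.
Proof.
move=> dz; apply: cvg_lim => //; apply: cvg_near_cst; exists k.+1 => // n kn.
rewrite /series /= big_mkord (bigD1 (Ordinal kn)) //= taylor_monom eqxx mul1r.
rewrite big1 ?addr0 // => i; rewrite -val_eqE taylor_monom /= => /negbTE ->.
by rewrite mul0r.
Qed.

Lemma heval_shift f z : disk z -> heval (shift f) z = z * heval f z.
Proof.
move=> dz; apply: cvg_lim => //; rewrite -cvg_shiftS /=.
have -> : (fun n => series (fun n => taylor (shift f) n * z ^+ n) n.+1) =
  (fun n => z * series (fun n => taylor f n * z ^+ n) n).
  apply/funext => n; rewrite /series /= !big_mkord big_ord_recl /= taylor_shift mul0r add0r.
  by rewrite big_distrr /=; apply: eq_bigr => i _; rewrite taylor_shift /= mulrCA exprS.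
by apply: cvgM; [exact: cvg_cst|exact: is_cvg_heval].
Qed.

Lemma heval_sum n (F : 'I_n -> hardy R) z : disk z ->
  heval (\sum_(i < n) F i) z = \sum_(i < n) heval (F i) z.
Proof. by move=> dz; rewrite (lin_sum (heval_linear dz)). Qed.

Lemma heval_poly (a : nat -> C) N z : disk z ->
  heval (\sum_(i < N) a i *: monom i) z = \sum_(i < N) a i * z ^+ i.
Proof.
by move=> dz; rewrite heval_sum //; apply: eq_bigr => i _; rewrite hevalZ // heval_monom.
Qed.

End Shift.

(** * Discrete Parseval identity over roots of unity *)

Section Parseval.
Variable R : realType.
Local Notation C := R[i].
Implicit Types (z : C).

(** X^n - 1 splits over R[i] and is separable in characteristic 0, so it has n distinct roots; such
    a family of n-th roots of unity contains a primitive one. *)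
Lemma prim_root_exists n : (0 < n)%N -> exists w : C, n.-primitive_root w.
Proof.
move=> n0; pose p : {poly C} := 'X^n - 1.
have [r Dp] := closed_field_poly_normal p.
rewrite (monicP _) ?monicXnsubC // scale1r in Dp.
have rn1 : all n.-unity_root r by apply/allP => z; rewrite -root_prod_XsubC -Dp.
have sz_r : (n < (size r).+1)%N by rewrite -(size_prod_XsubC r id) -Dp size_XnsubC.
have [|z] := hasP (has_prim_root n0 rn1 _ sz_r); last by exists z.
by rewrite -separable_prod_XsubC -Dp separable_Xn_sub_1 // pnatr_eq0 -lt0n.
Qed.

Lemma cmod_prim_root n (w : C) : n.-primitive_root w -> cmod w = 1.
Proof.
move=> pw; have n0 := prim_order_gt0 pw.
apply/eqP; rewrite -(@eqrXn2 _ n) ?cmod_ge0 // -cmodX (prim_expr_order pw) cmod1.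
by rewrite expr1n.
Qed.

(** The sum is geometric with ratio q = w^j conj (w^k). One has q^n = 1, and q = 1 only for j = k
    because both exponents are less than n. *)
Lemma sum_prim_root n (w : C) (j k : nat) : n.-primitive_root w ->
  (j < n)%N -> (k < n)%N ->
  \sum_(l < n) (w ^+ l) ^+ j * ((w ^+ l) ^+ k)^* = if j == k then n%:R else 0.
Proof.
move=> pw jn kn; have n0 := prim_order_gt0 pw.
have w1 := cmod_prim_root pw.
have wc m : w ^+ m * (w ^+ m)^* = 1 by rewrite mul_conjC cmodX w1 !expr1n.
pose q : C := w ^+ j * (w ^+ k)^*.
rewrite (eq_bigr (fun l : 'I_n => q ^+ l)) => [|l _]; last first.
  by rewrite exprMn -rmorphXn -!exprM [(l * j)%N]mulnC [(l * k)%N]mulnC.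
have [jk|jk] := eqVneq j k.
  rewrite (eq_bigr (fun=> 1)) => [|l _]; last by rewrite /q jk wc expr1n.
  by rewrite sumr_const card_ord.
have q1 : q != 1.
  apply: contra jk => /eqP q1.
  have /eqP : w ^+ j = w ^+ k by rewrite -[LHS]mulr1 -(wc k) mulrCA -/q q1 mulr1.
  by rewrite (eq_prim_root_expr pw) !modn_small.
have qn : q ^+ n = 1.
  rewrite exprMn -rmorphXn -!exprM mulnC exprM (prim_expr_order pw) expr1n.
  by rewrite mulnC exprM (prim_expr_order pw) expr1n rmorph1 mulr1.
have /eqP := subrX1 q n; rewrite qn subrr eq_sym mulf_eq0 subr_eq0 (negbTE q1) /=.
by move=> /eqP.
Qed.

(** This replaces the integral of |p|^2 over the circle of radius r; it is exact because the
    polynomial has no more coefficients than there are nodes. *)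
Lemma parseval n (w : C) (a : nat -> C) (r : R) : n.-primitive_root w ->
  \sum_(l < n) cmod (\sum_(j < n) a j * (r%:C%C * w ^+ l) ^+ j) ^+ 2 =
  n%:R * \sum_(j < n) cmod (a j) ^+ 2 * (r ^+ 2) ^+ j.
Proof.
move=> pw; apply: (@complex.complexI R); rewrite rmorph_sum rmorphM rmorph_sum /=.
pose c j : C := a j * r%:C%C ^+ j.
rewrite (eq_bigr (fun l : 'I_n => \sum_(j < n) \sum_(k < n)
    (c j * (c k)^*) * ((w ^+ l) ^+ j * ((w ^+ l) ^+ k)^*))) => [|l _]; last first.
  rewrite -mul_conjC rmorph_sum big_distrl /=; apply: eq_bigr => j _.
  rewrite big_distrr /=; apply: eq_bigr => k _.
  by rewrite /c !exprMn !rmorphM; ring.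
rewrite exchange_big /= big_distrr /=; apply: eq_bigr => j _.
rewrite exchange_big /= (bigD1 j) //= [X in _ + X]big1 ?addr0 => [|k kj].
  rewrite -big_distrr /= (sum_prim_root pw) // eqxx mul_conjC /c cmodM exprMn.
  rewrite cmodX cmodR rmorph_nat mulrC; congr (_ * _%:C%C).
  by rewrite -[in LHS]exprM mulnC exprM real_normK ?num_real.
rewrite -big_distrr /= (sum_prim_root pw) //.
by rewrite eq_sym val_eqE (negbTE kj) mulr0.
Qed.

End Parseval.

(** * Coefficient bounds from pointwise bounds on the disk *)

Section PowerSeriesBound.
Variable R : realType.
Local Notation C := R[i].
Variables (u : nat -> C) (U : C -> C).
Hypothesis uU : forall z, disk z -> series (fun n => u n * z ^+ n) @ \oo --> U z.

(** At the intermediate radius s = (1 + r) / 2 the terms tend to 0 and are bounded by some B, so at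
    radius r they are dominated by B (r / s)^n. *)
Lemma is_cvg_power_series (r : R) : 0 <= r < 1 ->
  cvgn (series (fun n => cmod (u n) * r ^+ n)).
Proof.
move=> /andP[r0 r1]; pose s := (1 + r) / 2.
have s0 : 0 < s by rewrite /s; lra.
have s1 : s < 1 by rewrite /s; lra.
have rs : r < s by rewrite /s; lra.
have ds : disk (s%:C%C : C) by rewrite /disk /= cmodR gtr0_norm.
have ht : (fun n => u n * s%:C%C ^+ n) @ \oo --> (0 : C).
  apply: (@cvg_series_cvg_0 C); by apply/cvg_ex; exists (U s%:C%C); exact: uU.
have [B B0 hB] : exists2 B, 0 <= B & forall n, cmod (u n) * s ^+ n <= B.
  have : cvgn (fun n => cmod (u n * s%:C%C ^+ n)).
    by apply/cvg_ex; exists (cmod (0 : C)); exact: cvg_cmod.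
  move=> /cvg_seq_bounded[M [_ hM]].
  exists (`|M| + 1); first by rewrite addr_ge0.
  have M1 : M < `|M| + 1 by rewrite (le_lt_trans (ler_norm _)) // ltrDl.
  move=> n; have := hM _ M1 n I => /=; rewrite ger0_norm ?cmod_ge0 //.
  by rewrite cmodM cmodX cmodR gtr0_norm.
have q01 : 0 <= r / s < 1 by rewrite divr_ge0 ?(ltW s0) //= ltr_pdivrMr // mul1r.
apply: (bounded_series (K := B * (1 - r / s)^-1) _ _).1 => [n|N].
  by rewrite mulr_ge0 ?cmod_ge0 ?exprn_ge0.
apply: (@le_trans _ _ (\sum_(i < N) B * (r / s) ^+ i)).
  apply: ler_sum => i _; rewrite expr_div_n mulrA ler_pdivlMr ?exprn_gt0 //.
  by rewrite mulrAC ler_wpM2r ?exprn_ge0.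
by rewrite -big_distrr ler_wpM2l //; exact: sum_geometric_le.
Qed.

Lemma power_series_tail (z : C) K : disk z ->
  cmod (U z - \sum_(n < K) u n * z ^+ n) <=
  limn (series (fun n => cmod (u n) * cmod z ^+ n)) - \sum_(n < K) cmod (u n) * cmod z ^+ n.
Proof.
move=> dz; have az : 0 <= cmod z < 1 by rewrite cmod_ge0.
have a0 n : 0 <= cmod (u n) * cmod z ^+ n by rewrite mulr_ge0 ?exprn_ge0 ?cmod_ge0.
set P := \sum_(n < K) u n * z ^+ n.
have h : (fun m => cmod (series (fun n => u n * z ^+ n) m - P)) @ \oo --> cmod (U z - P).
  by apply: cvg_cmod; apply: cvgB; [exact: uU|exact: cvg_cst].
apply: (ler_cvg_to h (cvg_cst _)); exists K => // m Km.
rewrite /series /= big_mkord.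
have := sum_le_lim m a0 (is_cvg_power_series az).
rewrite -(subnKC Km) !big_split_ord /= -/P [P + _ - P]addrAC subrr add0r => le.
rewrite lerBrDl (le_trans _ le) // lerD2l (le_trans (cmod_sum _)) //.
by apply: ler_sum => i _; rewrite cmodM cmodX.
Qed.

(** At radius r < 1 the K-th partial sum of U is within [e K] of U, and averaging over the K-th
    roots of unity compares the two sums of squares; then K -> oo, and finally r -> 1. The cases p =
    0, p = 1 and general p give the injectivity of [heval], the membership of [b] in H^2 and the
    contractivity of multiplication by [b]. *)
Lemma sum_sqr_le_of_poly_bound (p : nat -> C) N M :
  (forall z, disk z -> cmod (U z) <= cmod (\sum_(k < N) p k * z ^+ k)) ->
  \sum_(n < M) cmod (u n) ^+ 2 <= \sum_(k < N) cmod (p k) ^+ 2.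
Proof.
move=> Up; pose B := \sum_(k < N) cmod (p k).
have B0 : 0 <= B by apply: sumr_ge0 => i _; exact: cmod_ge0.
pose S := \sum_(k < N) cmod (p k) ^+ 2.
have circle r : 0 <= r < 1 -> \sum_(n < M) cmod (u n) ^+ 2 * (r ^+ 2) ^+ n <= S.
  move=> r01; have /andP[r0 r1] := r01.
  pose L := limn (series (fun n => cmod (u n) * r ^+ n)).
  pose e K := L - \sum_(n < K) cmod (u n) * r ^+ n.
  have he : e @ \oo --> (0 : R).
    rewrite -(subrr L); apply: cvgB; first exact: cvg_cst.
    have -> : (fun K => \sum_(n < K) cmod (u n) * r ^+ n) = series (fun n => cmod (u n) * r ^+ n).
      by apply/funext => K; rewrite /series /= big_mkord.
    exact: is_cvg_power_series.
  have e0 K : 0 <= e K.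
    rewrite subr_ge0; apply: sum_le_lim (is_cvg_power_series r01) => n.
    by rewrite mulr_ge0 ?cmod_ge0 ?exprn_ge0.
  (* On the disk |p(z)| <= B, so (|p(z)| + e K)^2 is at most |p(z)|^2 + 2 B e K + (e K)^2. *)
  have h : (fun K => S + 2 * B * e K + e K ^+ 2) @ \oo --> S + 2 * B * 0 + 0 ^+ 2.
    apply: cvgD; last exact: cvgM.
    by apply: cvgD; [exact: cvg_cst|apply: cvgM => //; exact: cvg_cst].
  rewrite mulr0 expr0n /= !addr0 in h.
  apply: (ler_cvg_to (cvg_cst _) h); exists (maxn 1 (maxn M N)) => // K.
  rewrite /= !geq_max => /and3P[K0 MK NK].
  have [w pw] := prim_root_exists R K0.
  have wz l : cmod (r%:C%C * w ^+ l) = r.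
    by rewrite cmodM cmodX (cmod_prim_root pw) expr1n mulr1 cmodR ger0_norm.
  have wd l : disk (r%:C%C * w ^+ l) by rewrite /disk /= wz.
  (* Padding with zeros gives [p] as many coefficients as there are nodes, as [parseval]
     requires. *)
  pose pK k := if (k < N)%N then p k else 0.
  have sumpK z : \sum_(k < K) pK k * z ^+ k = \sum_(k < N) p k * z ^+ k.
    rewrite -(subnKC NK) big_split_ord /= [X in _ + X]big1 ?addr0.
      by apply: eq_bigr => i _; rewrite /pK ltn_ord.
    by move=> i _; rewrite /pK ltnNge leq_addr mul0r.
  have K0' : 0 < K%:R :> R by rewrite ltr0n.
  have : K%:R * \sum_(j < K) cmod (u j) ^+ 2 * (r ^+ 2) ^+ j <=
         K%:R * (S + 2 * B * e K + e K ^+ 2).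
    rewrite -(parseval _ _ pw).
    have : \sum_(l < K) cmod (\sum_(j < K) pK j * (r%:C%C * w ^+ l) ^+ j) ^+ 2 <= K%:R * S.
      rewrite (parseval _ _ pw) ler_pM2l // -(subnKC NK) big_split_ord /= [X in _ + X]big1 ?addr0.
        apply: ler_sum => i _; rewrite /pK ltn_ord ler_piMr ?sqr_ge0 //.
        by rewrite exprn_ile1 ?sqr_ge0 // expr_le1 // ltW.
      by move=> i _; rewrite /pK ltnNge leq_addr cmod0 expr0n mul0r.
    move=> hp; rewrite -[leRHS]/(_ * _) -addrA mulrDr; apply: le_trans (lerD hp (lexx _)).
    rewrite mulr_natl -[X in _ *+ X]card_ord -sumr_const -big_split /=; apply: ler_sum => l _.
    set z := _ * w ^+ l; rewrite sumpK.
    have hz := power_series_tail K (wd l); rewrite wz -/(e K) in hz.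
    have hU := Up _ (wd l); rewrite -/z in hU hz.
    have hB : cmod (\sum_(k < N) p k * z ^+ k) <= B.
      apply: le_trans (cmod_sum _) _; apply: ler_sum => i _.
      by rewrite cmodM cmodX wz ler_piMr ?cmod_ge0 // exprn_ile1 // (ltW r1).
    have hV := ler_cmodB (\sum_(n < K) u n * z ^+ n) (U z).
    rewrite cmodB in hV.
    have hV' : cmod (\sum_(n < K) u n * z ^+ n) <= cmod (\sum_(k < N) p k * z ^+ k) + e K by lra.
    apply: (@le_trans _ _ ((cmod (\sum_(k < N) p k * z ^+ k) + e K) ^+ 2)).
      by apply: lerXn2r hV'; rewrite nnegrE; [exact: cmod_ge0|apply: addr_ge0; [exact: cmod_ge0|exact: e0]].
    by rewrite sqrrD mulr2n; have := ler_wpM2r (e0 K) hB; lra.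
  rewrite ler_pM2l //; apply: le_trans.
  rewrite -(subnKC MK) big_split_ord /= lerDl sumr_ge0 // => i _.
  by rewrite mulr_ge0 ?exprn_ge0 ?cmod_ge0.
(* The radii 1 - 1 / (n + 1) lie in [0, 1) from n = 0 on; only finitely many coefficients are
   involved, so r -> 1 is taken term by term. *)
have rn : (fun n => 1 - (n.+1%:R)^-1 : R) @ \oo --> (1 : R).
  by rewrite -[X in _ --> X](subr0 1); apply: cvgB; [exact: cvg_cst|exact: cvg_harmonic].
have hl : (fun n => \sum_(i < M) cmod (u i) ^+ 2 * ((1 - (n.+1%:R)^-1 : R) ^+ 2) ^+ i) @ \oo -->
   \sum_(i < M) cmod (u i) ^+ 2.
  rewrite (eq_bigr (fun i : 'I_M => cmod (u i) ^+ 2 * (1 ^+ 2) ^+ i)); last first.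
    by move=> i _; rewrite !expr1n mulr1.
  apply: (@cvg_sum_ord R (fun n i => cmod (u i) ^+ 2 * ((1 - (n.+1%:R)^-1 : R) ^+ 2) ^+ i)
    (fun i => cmod (u i) ^+ 2 * (1 ^+ 2) ^+ i)) => i.
  apply: cvgM; first exact: cvg_cst.
  have pw k : (fun n => (1 - (n.+1%:R)^-1 : R) ^+ k) @ \oo --> (1 ^+ k : R).
    elim: k => [|k IH]; first by rewrite expr0; exact: cvg_cst.
    rewrite exprS (_ : (fun n => _) = (fun n => (1 - (n.+1%:R)^-1) * (1 - (n.+1%:R)^-1) ^+ k)).
      exact: cvgM.
    by apply/funext => n; rewrite exprS.
  by rewrite -exprM (_ : (fun n => _) = (fun n => (1 - (n.+1%:R)^-1 : R) ^+ (2 * i)));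
    [exact: pw|apply/funext => n; rewrite exprM].
apply: (ler_cvg_to hl (cvg_cst S)); near=> n; apply: circle.
have n0 : 0 < (n.+1%:R : R)^-1 by rewrite invr_gt0 ltr0n.
have n1 : (n.+1%:R : R)^-1 <= 1 by rewrite invf_le1 ?ltr0n // ler1n.
by rewrite subr_ge0 n1 gtrBl n0.
Unshelve. all: by end_near. Qed.

End PowerSeriesBound.

(** * Multiplication by b as a contraction of H^2 *)

Section Multiplication.
Variable R : realType.
Local Notation C := R[i].
Implicit Types (f g h : hardy R) (z : C).

Lemma heval_inj f g : (forall z, disk z -> heval f z = heval g z) -> f = g.
Proof.
move=> fg; apply/eqP; rewrite -subr_eq0; apply/eqP/hnorm_eq0/eqP.
rewrite -sqrf_eq0 eq_le sqr_ge0 andbT; apply: hnorm_sqr_le => M.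
(* The comparison polynomial is the empty sum, so every coefficient of [f - g] vanishes. *)
have := @sum_sqr_le_of_poly_bound R (taylor (f - g)) (heval (f - g)) _ (fun=> 0) 0 M.
rewrite big_ord0; apply => z dz; first exact: is_cvg_heval.
by rewrite hevalB // fg // subrr cmod0 cmod_ge0.
Qed.

Variable b : C -> C.
Hypothesis b_an : analytic_on_disk b.
Hypothesis b_le1 : forall z, disk z -> cmod (b z) <= 1.

Lemma symbolP : {beta : hardy R | forall z, disk z -> heval beta z = b z}.
Proof.
apply: cid; have [a ab] := b_an.
(* Here [b] is compared with the constant polynomial 1. *)
have bound M : \sum_(n < M) cmod (a n) ^+ 2 <= 1.
  have := @sum_sqr_le_of_poly_bound R a b ab (fun=> 1) 1 M.
  by rewrite !big_ord1 cmod1 expr1n; apply => z dz; rewrite big_ord1 expr0 mulr1 cmod1 b_le1.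
have [beta betaE _] := hardy_of_bound bound.
exists beta => z dz; apply: cvg_lim => //; rewrite betaE; exact: ab.
Qed.

Definition symbol : hardy R := sval symbolP.

Lemma heval_symbol z : disk z -> heval symbol z = b z.
Proof. exact: (svalP symbolP). Qed.

(** The product of [b] with the polynomial of coefficients [a], assembled from shifts of [symbol] so
    that it lies in H^2 by construction. *)
Let mulp (a : nat -> C) N : hardy R := \sum_(k < N) a k *: iter k (@shift R) symbol.

Let heval_mulp a N z : disk z -> heval (mulp a N) z = b z * \sum_(k < N) a k * z ^+ k.
Proof.
move=> dz; rewrite heval_sum // big_distrr; apply: eq_bigr => k _ /=.
rewrite hevalZ // mulrCA; congr (_ * _).
elim: (val k) => [|n IH]; first by rewrite expr0 mulr1 heval_symbol.
by rewrite iterS heval_shift // IH exprS mulrCA.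
Qed.

Let hnorm_mulp a N : hnorm (mulp a N) ^+ 2 <= \sum_(k < N) cmod (a k) ^+ 2.
Proof.
apply: hnorm_sqr_le => M.
apply: (sum_sqr_le_of_poly_bound (U := heval (mulp a N))) => z dz; first exact: is_cvg_heval.
by rewrite heval_mulp // cmodM ler_piMl ?cmod_ge0 ?b_le1.
Qed.

Let mulp_trunc f m K : (m <= K)%N -> mulp (taylor f) m = mulp (taylor (trunc m f)) K.
Proof.
move=> mK; rewrite /mulp -(subnKC mK) big_split_ord /= [X in _ + X]big1 ?addr0.
  by apply: eq_bigr => i _; rewrite taylor_trunc ltn_ord.
by move=> i _; rewrite taylor_trunc ltnNge leq_addr scale0r.
Qed.

Let mulpB a a' N : mulp a N - mulp a' N = mulp (fun n => a n - a' n) N.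
Proof. by rewrite /mulp -sumrB; apply: eq_bigr => i _; rewrite scalerBl. Qed.

(** For polynomials the contraction bound is [hnorm_mulp]. It makes the products of [b] with the
    truncations of [f] a Cauchy sequence; evaluation is continuous, so the limit is b f
    pointwise. *)
Lemma mul_symbol_exists f :
  exists2 g, forall z, disk z -> heval g z = b z * heval f z & hnorm g <= hnorm f.
Proof.
have [|g hg] := @hardy_complete R (mulp (taylor f)).
  move=> e /(hcvg_cauchy (hcvg_trunc f))[N hN]; exists N => m n Nm Nn.
  apply: le_trans (hN m n Nm Nn); rewrite -ler_sqr ?nnegrE ?hnorm_ge0 //.
  (* Both products are brought to the common length max(m, n), so that their difference is again [b]
     times one polynomial. *)
  rewrite (@mulp_trunc f m (maxn m n)) ?leq_maxl // (@mulp_trunc f n (maxn m n)) ?leq_maxr //.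
  by rewrite mulpB (le_trans (hnorm_mulp _ _)) //; exact: (sum_sqr_le (trunc m f - trunc n f)).
exists g => [z dz|].
  have h1 := hcvg_heval dz hg; have h2 := hcvg_heval dz (hcvg_trunc f).
  have h3 : (fun n => heval (mulp (taylor f) n) z) @ \oo --> b z * heval f z.
    have -> : (fun n => heval (mulp (taylor f) n) z) = (fun n => b z * heval (trunc n f) z).
      by apply/funext => n; rewrite heval_mulp // heval_poly.
    by apply: cvgM h2; exact: cvg_cst.
  by rewrite -(cvg_lim _ h1) // (cvg_lim _ h3).
apply: (ler_cvg_to (hcvg_hnorm hg) (cvg_cst _)); near=> n.
rewrite -ler_sqr ?nnegrE ?hnorm_ge0 // (le_trans (hnorm_mulp _ _)) // sum_sqr_le.
Unshelve. all: by end_near. Qed.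

(** [toeplitz] is an [xget] with default 0; the existence of the product shows that the default is
    never taken. *)
Lemma heval_toeplitz f z : disk z -> heval (toeplitz b f) z = b z * heval f z.
Proof.
have [g gP _] := mul_symbol_exists f.
pose S : set (hardy R) := [set g | forall z, disk z -> heval g z = b z * heval f z].
exact: (@xgetPex _ 0 S (ex_intro _ g gP)).
Qed.

Lemma hnorm_toeplitz f : hnorm (toeplitz b f) <= hnorm f.
Proof.
have [g gP gn] := mul_symbol_exists f; suff -> : toeplitz b f = g by [].
by apply: heval_inj => z dz; rewrite gP // heval_toeplitz.
Qed.

Lemma toeplitz_linear : linear (toeplitz b).
Proof.
move=> a f g; apply: heval_inj => z dz.
by rewrite hevalD // hevalZ // !heval_toeplitz // hevalD // hevalZ // mulrDr mulrCA.
Qed.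

Lemma toeplitz_shift f : toeplitz b (shift f) = shift (toeplitz b f).
Proof.
by apply: heval_inj => z dz; rewrite heval_shift // !heval_toeplitz // heval_shift // mulrCA.
Qed.

Lemma toeplitz1 : toeplitz b (monom 0) = symbol.
Proof.
apply: heval_inj => z dz.
by rewrite heval_toeplitz // heval_monom // mulr1 heval_symbol.
Qed.

End Multiplication.

(** * Adjoints of contractions *)

Section Adjoint.
Variable R : realType.
Local Notation C := R[i].
Implicit Types (f g h : hardy R).

Lemma hdot_inj g h : (forall f, hdot f g = hdot f h) -> g = h.
Proof.
move=> gh; apply/eqP; rewrite -subr_eq0; apply/eqP/hnorm_eq0/eqP.
by rewrite -sqrf_eq0 -rdotff /rdot hdotBr gh subrr.
Qed.

Variables (T : hardy R -> hardy R).
Hypotheses (Tl : linear T) (T1 : forall f, hnorm (T f) <= hnorm f).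

Lemma hdot_adjoint f g : hdot (T f) g = hdot f (adjoint T g).
Proof.
have [h hP] : exists h, forall f, hdot (T f) g = hdot f h.
  apply: (@riesz R (fun f => hdot (T f) g) (hnorm g)) => [a x y|x].
    by rewrite (linD Tl) (linZ Tl) hdotDl hdotZl.
  by rewrite (le_trans (hdot_le _ _)) // mulrC ler_wpM2l ?hnorm_ge0.
pose S : set (hardy R) := [set h | forall f, hdot (T f) g = hdot f h].
exact: (@xgetPex _ 0 S (ex_intro _ h hP)).
Qed.

Lemma hdot_adjointl f g : hdot (adjoint T f) g = hdot f (T g).
Proof. by rewrite hdotC -hdot_adjoint -hdotC. Qed.

Lemma adjoint_linear : linear (adjoint T).
Proof.
move=> a f g; apply: hdot_inj => h.
by rewrite hdotDr hdotZr -!hdot_adjoint hdotDr hdotZr.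
Qed.

(** With h = [adjoint T f] one has |h|^2 = <T h, f> <= |h| |f|; divide by |h| unless it is 0. *)
Lemma hnorm_adjoint f : hnorm (adjoint T f) <= hnorm f.
Proof.
have [h0|h0] := eqVneq (hnorm (adjoint T f)) 0; first by rewrite h0 hnorm_ge0.
have hp : 0 < hnorm (adjoint T f) by rewrite lt0r h0 hnorm_ge0.
rewrite -(ler_pM2l hp) -expr2 -rdotff /rdot -hdot_adjoint.
by rewrite (le_trans (rdot_le _ _)) // ler_wpM2r ?hnorm_ge0.
Qed.

End Adjoint.

Local Opaque hnorm hdot heval cmod shift lshift monom toeplitz adjoint.

Lemma rdot_inj (R : realType) (f g : hardy R) : (forall h, rdot f h = rdot g h) -> f = g.
Proof.
move=> fg; apply/eqP; rewrite -subr_eq0; apply/eqP/hnorm_eq0/eqP.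
by rewrite -sqrf_eq0 -rdotff rdotBl fg subrr.
Qed.

(** * The variational problem common to both spaces *)

Section QuadraticMaximization.
Variable R : realType.
Implicit Types (f g h : hardy R).
Variables (J1 J2 : hardy R -> hardy R).
Hypotheses (J1l : linear J1) (J2l : linear J2).

(** A pair of maps lets one maximization serve twice: for H(b) with (P^{1/2}, 0), and for D(mu) with
    P and sqrt a times the difference quotient of P g. *)
Let Q g := hnorm (J1 g) ^+ 2 + hnorm (J2 g) ^+ 2.
Let B g h := rdot (J1 g) (J1 h) + rdot (J2 g) (J2 h).

Let QD g h : Q (g + h) = Q g + 2 * B g h + Q h.
Proof.
have e J : linear J -> hnorm (J (g + h)) ^+ 2 =
    hnorm (J g) ^+ 2 + 2 * rdot (J g) (J h) + hnorm (J h) ^+ 2.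
  by move=> Jl; rewrite (linD Jl) hnormD_sqr.
rewrite /Q /B (e _ J1l) (e _ J2l); ring.
Qed.

Let QB g h : Q (g - h) = Q g - 2 * B g h + Q h.
Proof.
have e J : linear J -> hnorm (J (g - h)) ^+ 2 =
    hnorm (J g) ^+ 2 - 2 * rdot (J g) (J h) + hnorm (J h) ^+ 2.
  by move=> Jl; rewrite (linB Jl) hnormB_sqr.
rewrite /Q /B (e _ J1l) (e _ J2l); ring.
Qed.

Let QZ (t : R) g : Q (t%:C%C *: g) = t ^+ 2 * Q g.
Proof.
have h J : linear J -> hnorm (J (t%:C%C *: g)) ^+ 2 = t ^+ 2 * hnorm (J g) ^+ 2.
  by move=> Jl; rewrite (linZ Jl) hnormZ_sqr cmodR real_normK ?num_real.
by rewrite /Q (h _ J1l) (h _ J2l) mulrDr.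
Qed.

Let BZr g (t : R) h : B g (t%:C%C *: h) = t * B g h.
Proof.
have e J : linear J -> rdot (J g) (J (t%:C%C *: h)) = t * rdot (J g) (J h).
  by move=> Jl; rewrite (linZ Jl) rdotZr.
by rewrite /B (e _ J1l) (e _ J2l) mulrDr.
Qed.

(* A maximizing sequence of the concave functional [2 Re <f, g> - |J g|^2] has
   images under [J] that are Cauchy, by the parallelogram law; their limit
   represents [f]. *)
Lemma quadratic_maximizer f (K : R) :
  (forall g, 2 * rdot f g - (hnorm (J1 g) ^+ 2 + hnorm (J2 g) ^+ 2) <= K) ->
  exists G : nat -> hardy R, exists u1 u2 : hardy R,
    [/\ hcvg (fun n => J1 (G n)) u1, hcvg (fun n => J2 (G n)) u2,
        forall h, rdot f h = rdot u1 (J1 h) + rdot u2 (J2 h)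
      & hnorm u1 ^+ 2 + hnorm u2 ^+ 2 <= K].
Proof.
move=> hK; pose Phi g := 2 * rdot f g - Q g.
have hs : has_sup [set Phi g | g in [set: hardy R]].
  by split; [exists (Phi 0); exists 0 | exists K => _ [g _ <-]; exact: hK].
pose s := sup [set Phi g | g in [set: hardy R]].
have Phis g : Phi g <= s by apply: sup_ubound; [case: hs | exists g].
have hG n : exists g, s - n.+1%:R^-1 < Phi g.
  have n0 : 0 < (n.+1%:R : R)^-1 by rewrite invr_gt0 ltr0n.
  have [_ [g _ <-] hg] := sup_adherent n0 hs; by exists g.
have {hG} [G hG] := choice hG.
have close m n : Q (G m - G n) <= 2 * m.+1%:R^-1 + 2 * n.+1%:R^-1.
  have hm := hG m; have hn := hG n.
  (* The value at the midpoint of [G m] and [G n] is at most [s], while the values at the two points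
     are nearly [s]; what is left bounds Q of their difference. *)
  have := Phis ((2^-1)%:C%C *: (G m + G n)).
  rewrite /Phi in hm hn *; rewrite rdotZr QZ QD QB rdotDr expr2 -[2^-1 * 2^-1]invfM.
  move: (Q (G m)) (Q (G n)) (B _ _) (rdot _ _) (rdot _ _) hm hn => a c d x y.
  move: (m.+1%:R^-1 : R) (n.+1%:R^-1 : R) => im iN; lra.
have small e : 0 < e -> exists N, forall m n, (N <= m)%N -> (N <= n)%N ->
    Q (G m - G n) <= e ^+ 2.
  move=> e0; have e2 : 0 < e ^+ 2 / 4 by rewrite divr_gt0 ?exprn_gt0.
  have /cvgrPdist_le/(_ _ e2)[N _ hN] := @cvg_harmonic R.
  exists N => m n Nm Nn; have := close m n; have := hN _ Nm; have := hN _ Nn.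
  rewrite /= !sub0r !normrN !ger0_norm ?invr_ge0 ?ler0n //.
  move: (m.+1%:R^-1 : R) (n.+1%:R^-1 : R) (Q _) => im iN q; lra.
have cv J : linear J -> (forall g, hnorm (J g) ^+ 2 <= Q g) ->
    exists u, hcvg (fun n => J (G n)) u.
  move=> Jl JQ; apply: hardy_complete => e e0; have [N hN] := small _ e0.
  exists N => m n Nm Nn; rewrite -ler_sqr ?nnegrE ?hnorm_ge0 ?(ltW e0) // -(linB Jl).
  exact: le_trans (JQ _) (hN _ _ Nm Nn).
have [u1 hu1] : exists u, hcvg (fun n => J1 (G n)) u.
  by apply: cv => // g; rewrite lerDl sqr_ge0.
have [u2 hu2] : exists u, hcvg (fun n => J2 (G n)) u.
  by apply: cv => // g; rewrite lerDr sqr_ge0.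
exists G, u1, u2.
have rep h : rdot f h = rdot u1 (J1 h) + rdot u2 (J2 h).
  pose D := rdot f h - (rdot u1 (J1 h) + rdot u2 (J2 h)).
  have lim_D : (fun n => rdot f h - B (G n) h) @ \oo --> D.
    by apply: cvgB; [exact: cvg_cst|apply: cvgD; exact: hcvg_rdot].
  (* Moving [G n] by t h raises the functional by less than 1 / (n + 1); the limit in n leaves an
     inequality between a linear and a quadratic term in t. *)
  have bound t : 2 * t * D <= t ^+ 2 * Q h.
    have l1 : (fun n => 2 * t * (rdot f h - B (G n) h)) @ \oo --> 2 * t * D.
      by apply: cvgM lim_D; exact: cvg_cst.
    have l2 : (fun n => t ^+ 2 * Q h + (n.+1%:R^-1 : R)) @ \oo --> t ^+ 2 * Q h + 0.
      by apply: cvgD; [exact: cvg_cst|exact: cvg_harmonic].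
    rewrite -[leRHS]addr0; apply: (ler_cvg_to l1 l2); near=> n.
    have := Phis (G n + t%:C%C *: h); have := hG n; rewrite /Phi rdotDr rdotZr QD QZ BZr.
    move: (Q (G n)) (Q h) (B _ _) (rdot f (G n)) (rdot f h) => a c d x y.
    move: (n.+1%:R^-1 : R) => iN; lra.
  have Q0 : 0 <= Q h by rewrite addr_ge0 ?sqr_ge0.
  have Q1 : 0 < Q h + 1 by rewrite ltr_wpDl.
  (* This t forces D = 0: the left side is 2 D^2 / (Q h + 1), the right side at most D^2 / (Q h +
     1). The summand 1 covers the case Q h = 0. *)
  have := bound (D / (Q h + 1)).
  rewrite expr_div_n -[2 * _ * D]mulrA mulrAC -expr2.
  have -> : D ^+ 2 / (Q h + 1) ^+ 2 * Q h = D ^+ 2 / (Q h + 1) * (Q h / (Q h + 1)).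
    by field; rewrite gt_eqF.
  have X0 : 0 <= D ^+ 2 / (Q h + 1) by rewrite divr_ge0 ?sqr_ge0 // ltW.
  have q1 : Q h / (Q h + 1) <= 1 by rewrite ler_pdivrMr // mul1r lerDl.
  have := ler_wpM2l X0 q1; rewrite mulr1 => h1 h2.
  have /eqP : D ^+ 2 / (Q h + 1) = 0 by lra.
  rewrite mulf_eq0 invr_eq0 (gt_eqF Q1) orbF sqrf_eq0 subr_eq0 => /eqP; exact.
split=> //.
(* Applying the representation of [f] to [G n] itself shows that the functional tends to 2 |u|^2 -
   |u|^2, where u = (u1, u2). *)
have lim_Phi : (fun n => Phi (G n)) @ \oo --> hnorm u1 ^+ 2 + hnorm u2 ^+ 2.
  have -> : hnorm u1 ^+ 2 + hnorm u2 ^+ 2 =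
     2 * (rdot u1 u1 + rdot u2 u2) - (hnorm u1 ^+ 2 + hnorm u2 ^+ 2).
    by rewrite !rdotff; ring.
  apply: cvgB; last by apply: cvgD; apply: cvgM; exact: hcvg_hnorm.
  apply: cvgM; first exact: cvg_cst.
  have -> : (fun n => rdot f (G n)) = (fun n => rdot (J1 (G n)) u1 + rdot (J2 (G n)) u2).
    by apply/funext => n; rewrite rep [X in X + _]rdotC [X in _ + X]rdotC.
  by apply: cvgD; exact: hcvg_rdot.
by apply: (ler_cvg_to lim_Phi (cvg_cst K)); near=> n; exact: hK.
Unshelve. all: by end_near. Qed.

End QuadraticMaximization.

(** * Positive square roots of operators *)

Section SquareRoot.
Variable R : realType.
Local Notation C := R[i].
Implicit Types (f g h : hardy R).

Lemma linear_comp (T1 T2 : hardy R -> hardy R) : linear T1 -> linear T2 ->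
  linear (fun f => T1 (T2 f)).
Proof. by move=> l1 l2 a f g /=; rewrite l2 l1. Qed.

Lemma linear_add (T1 T2 : hardy R -> hardy R) : linear T1 -> linear T2 ->
  linear (fun f => T1 f + T2 f).
Proof. by move=> l1 l2 a f g /=; rewrite l2 l1 scalerDr addrACA. Qed.

Lemma linear_opp (T : hardy R -> hardy R) : linear T -> linear (fun f => - T f).
Proof. by move=> l a f g /=; rewrite l opprD scalerN. Qed.

Lemma linear_scale (c : C) (T : hardy R -> hardy R) : linear T ->
  linear (fun f => c *: T f).
Proof. by move=> l a f g /=; rewrite l scalerDr !scalerA mulrC. Qed.

Lemma linear_id : linear (fun f : hardy R => f).
Proof. by []. Qed.

Lemma linear_hcvg (Y : nat -> hardy R -> hardy R) (Z : hardy R -> hardy R) :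
  (forall n, linear (Y n)) -> (forall f, hcvg (Y ^~ f) (Z f)) -> linear Z.
Proof.
move=> Yl YZ a f g.
have h1 := YZ (a *: f + g).
have h2 : hcvg (fun n => a *: Y n f + Y n g) (a *: Z f + Z g).
  apply: hcvgD (YZ g); apply: (@hcvg_lin R _ (cmod a)) (YZ f).
    exact: linear_scale linear_id.
  by move=> h; rewrite hnormZ.
apply: hcvg_unique h1 _.
have -> : (Y ^~ (a *: f + g)) = (fun n => a *: Y n f + Y n g) by apply/funext => n; exact: Yl.
exact: h2.
Qed.

Variable X : hardy R -> hardy R.
Hypotheses (Xl : linear X) (Xsym : forall f g, hdot (X f) g = hdot f (X g)).
Hypothesis X1 : forall f, hnorm (X f) <= hnorm f.

Let half (f : hardy R) : hardy R := (2^-1%:C%C : C) *: f.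

Let hnorm_half f : hnorm (half f) = hnorm f / 2.
Proof. by rewrite /half hnormZ cmodR ger0_norm // mulrC. Qed.

Let half_linear : linear half.
Proof. exact: linear_scale linear_id. Qed.

Fixpoint sqrt_iter n : hardy R -> hardy R :=
  if n is m.+1 then fun f => half (X f + sqrt_iter m (sqrt_iter m f)) else fun=> 0.

Fixpoint sqrt_scalar n : R := if n is m.+1 then (1 + sqrt_scalar m ^+ 2) / 2 else 0.

Let Y := sqrt_iter.
Let y := sqrt_scalar.

Let Yl n : linear (Y n).
Proof.
elim: n => [|n IH]; first by move=> a f g /=; rewrite scaler0 addr0.
exact: (linear_comp half_linear (linear_add Xl (linear_comp IH IH))).
Qed.

Let Ysym n f g : hdot (Y n f) g = hdot f (Y n g).
Proof.
elim: n f g => [|n IH] f g; first by rewrite hdot0l hdot0r.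
rewrite /Y /= /half hdotZl hdotZr conjR hdotDl hdotDr Xsym.
by rewrite -!/(Y n) !IH.
Qed.

Let y0 n : 0 <= y n.
Proof. by case: n => [|n] //=; rewrite divr_ge0 // addr_ge0 // sqr_ge0. Qed.

Let y1 n : y n <= 1.
Proof.
elim: n => [|n IH] //=; rewrite ler_pdivrMr // mul1r -[leRHS]/(1 + 1) lerD2l.
by rewrite expr_le1 // -/y y0.
Qed.

Let yS n : y n <= y n.+1.
Proof.
rewrite /y /= ler_pdivlMr // -subr_ge0.
have -> : 1 + sqrt_scalar n ^+ 2 - sqrt_scalar n * 2 = (1 - sqrt_scalar n) ^+ 2 by ring.
exact: sqr_ge0.
Qed.

Let Yn n f : hnorm (Y n f) <= y n * hnorm f.
Proof.
elim: n f => [|n IH] f; first by rewrite /Y /= hnorm0 mul0r.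
rewrite /Y /= hnorm_half mulrAC ler_pM2r ?invr_gt0 // mulrDl mul1r.
apply: le_trans (ler_hnormD _ _) _; apply: lerD; first exact: X1.
apply: le_trans (IH _) _; rewrite expr2 -mulrA ler_wpM2l ?y0 //; exact: IH.
Qed.

Let YS n f : hnorm (Y n.+1 f - Y n f) <= (y n.+1 - y n) * hnorm f.
Proof.
elim: n f => [|n IH] f.
  rewrite /Y /= !subr0 addr0 hnorm_half expr0n addr0 mulrC mul1r.
  by rewrite ler_pM2l ?invr_gt0 ?X1.
(* The difference of squares is written U (U - V) + (U - V) V with U = Y_(n+1) and V = Y_n, which
   does not ask them to commute. Its norm bound (u + v)(u - v) / 2 is exactly the next scalar
   increment. *)
have -> : Y n.+2 f - Y n.+1 f =
    half (Y n.+1 (Y n.+1 f - Y n f) + (Y n.+1 (Y n f) - Y n (Y n f))).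
  rewrite (linB (Yl n.+1)) addrA subrK.
  have -> : Y n.+2 f = half (X f + Y n.+1 (Y n.+1 f)) by [].
  have -> : Y n.+1 f = half (X f + Y n (Y n f)) by [].
  by rewrite -(linB half_linear) opprD addrACA subrr add0r.
rewrite hnorm_half ler_pdivrMr //; apply: le_trans (ler_hnormD _ _) _.
have h1 : hnorm (Y n.+1 (Y n.+1 f - Y n f)) <= y n.+1 * ((y n.+1 - y n) * hnorm f).
  by apply: le_trans (Yn _ _) _; rewrite ler_wpM2l ?y0 //; exact: IH.
have h2 : hnorm (Y n.+1 (Y n f) - Y n (Y n f)) <= (y n.+1 - y n) * (y n * hnorm f).
  by apply: le_trans (IH _) _; rewrite ler_wpM2l ?subr_ge0 ?yS //; exact: Yn.
apply: le_trans (lerD h1 h2) _.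
have -> : y n.+2 - y n.+1 = ((1 + y n.+1 ^+ 2) - (1 + y n ^+ 2)) / 2 by rewrite mulrBl.
move: (y n.+1) (y n) (hnorm f) => u v F.
by rewrite le_eqVlt; apply/orP; left; apply/eqP; field.
Qed.

Let YD n k f : hnorm (Y (n + k) f - Y n f) <= (y (n + k) - y n) * hnorm f.
Proof.
elim: k => [|k IH]; first by rewrite addn0 !subrr hnorm0 mul0r.
rewrite addnS; apply: le_trans (ler_hnorm_dist _ (Y (n + k) f) _) _.
apply: le_trans (lerD (YS _ _) IH) _.
by rewrite -mulrDl addrA subrK.
Qed.

Let y_cvg : cvgn y.
Proof.
apply: nondecreasing_is_cvgn; first by apply/nondecreasing_seqP => n; exact: yS.
by exists 1 => _ [n _ <-]; exact: y1.
Qed.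

Let y_le_lim n : y n <= limn y.
Proof.
apply: nondecreasing_cvgn_le y_cvg n.
by apply/nondecreasing_seqP => n; exact: yS.
Qed.

Let Y_cvg f : exists u, hcvg (Y ^~ f) u.
Proof.
apply: hardy_complete => e e0.
pose F := hnorm f; have F0 : 0 <= F by exact: hnorm_ge0.
have d0 : 0 < e / (F + 1) by rewrite divr_gt0 // ltr_wpDl.
have /cvgrPdist_le/(_ _ d0)[N _ hN] := y_cvg.
have key m n : (N <= n)%N -> (n <= m)%N -> hnorm (Y m f - Y n f) <= e.
  move=> Nn nm; rewrite -(subnKC nm); apply: le_trans (YD _ _ _) _.
  have h1 : y (n + (m - n)) - y n <= e / (F + 1).
    have := hN _ Nn; rewrite /= ger0_norm ?subr_ge0 ?y_le_lim //; apply: le_trans.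
    by rewrite lerD2r y_le_lim.
  apply: le_trans (ler_wpM2r F0 h1) _.
  by rewrite mulrAC ler_pdivrMr ?ltr_wpDl // ler_pM2l // lerDl.
exists N => m n Nm Nn; case/orP: (leq_total m n) => mn; last exact: key.
by rewrite hnormB; exact: key.
Qed.

(* [I - sqrt (I - X)] is the limit of [Y_(n+1) = (X + Y_n ^ 2) / 2]; the norms of
   the increments are bounded by those of the scalar iteration for [X = 1]. *)
Lemma operator_sqrt_exists :
  exists S : hardy R -> hardy R, positive_operator S /\ forall f, S (S f) = f - X f.
Proof.
have [Z YZ] := choice Y_cvg.
have Zl := linear_hcvg Yl YZ.
have Z1 f : hnorm (Z f) <= hnorm f.
  apply: (ler_cvg_to (hcvg_hnorm (YZ f)) (cvg_cst _)); near=> n.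
  by apply: le_trans (Yn _ _) _; rewrite ler_piMl ?hnorm_ge0.
have Zsym f g : hdot (Z f) g = hdot f (Z g).
  have h1 := hcvg_dot (f := g) (YZ f).
  have h2 : (fun n => hdot (Y n f) g) @ \oo --> hdot f (Z g).
    have -> : (fun n => hdot (Y n f) g) = (fun n => (hdot (Y n g) f)^*).
      by apply/funext => n; rewrite Ysym hdotC.
    by rewrite hdotC; apply: cvg_conj; exact: hcvg_dot.
  by rewrite -(cvg_lim _ h1) // (cvg_lim _ h2).
have fixp f : Z f = half (X f + Z (Z f)).
  have h1 : hcvg (fun n => Y n.+1 f) (Z f).
    apply: hcvgP => e /(hcvgE (YZ f))[N hN]; exists N => n Nn.
    by apply: hN; exact: leqW.
  apply: hcvg_unique h1 _.
  have -> : (fun n => Y n.+1 f) = (fun n => half (X f + Y n (Y n f))) by [].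
  apply: (@hcvg_lin R _ 2^-1) half_linear _ _.
    by move=> g; rewrite hnorm_half mulrC.
  apply: hcvgD; first exact: hcvg_cst.
  (* Y_n (Y_n f) is compared with Y_n (Z f) by the contractivity of Y_n, then with Z (Z f) by
     convergence at the point Z f. *)
  apply: (@hcvg_squeeze _ _ _ (fun n => hnorm (Y n f - Z f) + hnorm (Y n (Z f) - Z (Z f)))).
    move=> n; apply: le_trans (ler_hnorm_dist _ (Y n (Z f)) _) _; rewrite lerD2r.
    by rewrite -(linB (Yl n)) (le_trans (Yn _ _)) // ler_piMl ?hnorm_ge0.
  rewrite -[X in _ --> X](addr0 0); apply: cvgD; exact: YZ.
exists (fun f => f - Z f).
have Sl : linear (fun f => f - Z f) by exact: linear_add linear_id (linear_opp Zl).
split; last first.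
  move=> f; rewrite (linB Zl); have := fixp f; rewrite /half => e.
  have e2 : Z f + Z f = X f + Z (Z f).
    rewrite {1 2}e -scalerDl -rmorphD /=.
    have -> : (2^-1 + 2^-1 : R) = 1 by field.
    by rewrite scale1r.
  have -> : X f = Z f + Z f - Z (Z f) by rewrite e2 addrK.
  by rewrite -addrA -opprD addrA.
split=> [|f].
  split=> //; exists 2 => f; apply: le_trans (ler_hnormD _ _) _.
  by rewrite hnormN mulrDl mul1r lerD2l.
rewrite hdotBl hdotff.
have -> : hdot (Z f) f = (rdot (Z f) f)%:C%C.
  by rewrite /rdot RRe_real // CrealE -hdotC Zsym.
rewrite -rmorphB ler0c subr_ge0; apply: le_trans (rdot_le _ _) _.
by rewrite expr2 ler_wpM2r ?hnorm_ge0.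
Unshelve. all: by end_near. Qed.

End SquareRoot.

(** [positive_operator] asks only for a nonnegative, hence real, quadratic form. Polarization
    recovers symmetry: f + g gives the sum of the two cross terms, i f + g their difference. *)
Lemma positive_operator_sym (R : realType) (S : hardy R -> hardy R) :
  positive_operator S -> forall f g, hdot (S f) g = hdot f (S g).
Proof.
move=> [[Sl _] S0] f g.
have real h : hdot (S h) h = hdot h (S h).
  by rewrite [RHS]hdotC; apply/esym/CrealP; exact: ger0_real.
have sum : hdot (S f) g + hdot (S g) f = hdot f (S g) + hdot g (S f).
  have := real (f + g); rewrite (linD Sl) !hdotDl !hdotDr real (real g).
  move: (hdot f (S f)) (hdot g (S g)) (hdot (S f) g) (hdot (S g) f) (hdot f (S g)) (hdot g (S f)).
  move=> a c x y z t e; have -> : x + y = (a + x + (y + c)) - a - c by ring.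
  by rewrite e; ring.
have diff : hdot (S f) g - hdot (S g) f = hdot f (S g) - hdot g (S f).
  have := real ('i%C *: f + g); rewrite (linD Sl) (linZ Sl) !hdotDl !hdotDr !hdotZl !hdotZr real (real g).
  have ic : ('i%C : R[i])^* = - 'i%C by rewrite conjE; apply/eqP; rewrite eq_complex /= oppr0 !eqxx.
  have i0 : 'i%C != 0 :> R[i] by rewrite eq_complex /= oner_eq0 andbF.
  rewrite ic.
  move: (hdot f (S f)) (hdot g (S g)) (hdot (S f) g) (hdot (S g) f) (hdot f (S g)) (hdot g (S f)).
  move=> a c x y z t e; apply: (mulfI i0).
  have -> : 'i%C * (x - y) = 'i%C * (- 'i%C * a) + 'i%C * x + (- 'i%C * y + c)
     - 'i%C * (- 'i%C * a) - c by ring.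
  by rewrite e; ring.
have -> : hdot (S f) g = 2^-1 * ((hdot (S f) g + hdot (S g) f) + (hdot (S f) g - hdot (S g) f)).
  by field.
by rewrite sum diff; field.
Qed.

(** * The space H(b) and its variational description *)

Section DeBrangesRovnyak.
Variable R : realType.
Local Notation C := R[i].
Implicit Types (f g h k u : hardy R).
Variable b : C -> C.
Hypothesis b_an : analytic_on_disk b.
Hypothesis b_le1 : forall z, disk z -> cmod (b z) <= 1.

Local Notation T := (toeplitz b).
Local Notation Ts := (adjoint (toeplitz b)).
Local Notation A := (dbr_operator b).

Let Tl : linear T := toeplitz_linear b_an b_le1.
Let T1 : forall f, hnorm (T f) <= hnorm f := hnorm_toeplitz b_an b_le1.

(** The operator called P in the overview. *)
Definition defect f : hardy R := f - T (Ts f).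

Lemma dbr_operatorP : positive_operator A /\ forall f, A (A f) = defect f.
Proof.
have [] := @operator_sqrt_exists R (fun f => T (Ts f)).
- exact: linear_comp Tl (adjoint_linear Tl T1).
- by move=> f g; rewrite (hdot_adjoint Tl T1) (hdot_adjointl Tl T1).
- by move=> f; apply: le_trans (T1 _) _; exact: hnorm_adjoint.
move=> S SP; pose X := [set S : hardy R -> hardy R | positive_operator S /\ forall f, S (S f) = defect f].
exact: (@xgetPex _ (fun=> 0) X (ex_intro _ S SP)).
Qed.

Local Opaque dbr_operator.

Lemma dbr_operator_linear : linear A.
Proof. by have [[[]]] := dbr_operatorP. Qed.

Let Al := dbr_operator_linear.

Lemma dbr_operatorK f : A (A f) = defect f.
Proof. by have [_] := dbr_operatorP. Qed.

Lemma dbr_operator_sym f g : hdot (A f) g = hdot f (A g).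
Proof. by have [/positive_operator_sym] := dbr_operatorP. Qed.

Lemma rdot_dbr_operator f g : rdot (A f) g = rdot f (A g).
Proof. by rewrite /rdot dbr_operator_sym. Qed.

Lemma hnorm_dbr_operator f : hnorm (A f) ^+ 2 = hnorm f ^+ 2 - hnorm (Ts f) ^+ 2.
Proof.
rewrite -rdotff rdot_dbr_operator dbr_operatorK /defect rdotBr rdotff; congr (_ - _).
by rewrite -rdotff /rdot hdotC (hdot_adjoint Tl T1) -hdotC.
Qed.

Lemma dbr_lift_unique f u : A u = f -> ker_orthogonal A u -> dbr_lift b f = u.
Proof.
move=> uf uo; pose X := [set u | A u = f /\ ker_orthogonal A u].
have [vf vo] : X (dbr_lift b f) by apply: (@xgetPex _ 0 X); exists u.
apply/eqP; rewrite -subr_eq0; apply/eqP/hnorm_eq0/eqP.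
have k0 : A (dbr_lift b f - u) = 0 by rewrite (linB Al) vf uf subrr.
by rewrite -sqrf_eq0 -rdotff /rdot hdotBl vo // uo // subrr.
Qed.

(** The maximizer is a limit of vectors [A (G n)]. It lies in the closure of the range of the
    symmetric operator [A], hence is orthogonal to its kernel, as [dbr_lift] demands. *)
Lemma dbr_of_bound f (K : R) :
  (forall g, 2 * rdot f g - (hnorm g ^+ 2 - hnorm (Ts g) ^+ 2) <= K) ->
  exists u, [/\ A u = f, ker_orthogonal A u & hnorm u ^+ 2 <= K].
Proof.
move=> hK.
have zl : linear (fun _ : hardy R => 0 : hardy R) by move=> a x y; rewrite scaler0 addr0.
have [|G [u1 [u2 [h1 h2 rep nm]]]] := @quadratic_maximizer R A (fun=> 0) Al zl f K.
  by move=> g; rewrite hnorm_dbr_operator hnorm0 expr0n addr0.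
have u20 : u2 = 0 by apply: hcvg_unique h2 (hcvg_cst 0).
exists u1; split.
- apply: rdot_inj => h; rewrite rep u20 rdot0l addr0 -rdot_dbr_operator //.
- move=> k k0; have hd := hcvg_dot (f := k) h1.
  apply: (cvgC_unique hd).
  have -> : (fun n => hdot (A (G n)) k) = (fun=> 0).
    by apply/funext => n; rewrite dbr_operator_sym k0 hdot0r.
  exact: cvg_cst.
by move: nm; rewrite u20 hnorm0 expr0n addr0.
Qed.

(** This is |u - A g|^2 >= 0, expanded. *)
Lemma dbr_bound u g :
  2 * rdot (A u) g - (hnorm g ^+ 2 - hnorm (Ts g) ^+ 2) <= hnorm u ^+ 2.
Proof.
rewrite -hnorm_dbr_operator rdot_dbr_operator.
have := sqr_ge0 (hnorm (u - A g)); rewrite (hnormB_sqr u (A g)).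
by move: (hnorm u ^+ 2) (rdot _ _) (hnorm _ ^+ 2) => *; lra.
Qed.

(** An arbitrary preimage yields the bound, and the bound yields a preimage orthogonal to the
    kernel; this takes the place of an orthogonal projection and shows that the default of
    [dbr_lift] is not taken. *)
Lemma dbr_liftP f : dbr_space b f ->
  [/\ A (dbr_lift b f) = f, ker_orthogonal A (dbr_lift b f)
    & dbr_norm b f = hnorm (dbr_lift b f)].
Proof.
move=> [u _ uf]; have [v [vf vo _]] := dbr_of_bound (dbr_bound u).
rewrite uf in vf; have e := dbr_lift_unique vf vo.
rewrite e; split=> //; rewrite /dbr_norm /dbr_dot e hdotff /= sqrtr_sqr.
by rewrite ger0_norm ?hnorm_ge0.
Qed.

Lemma dbr_norm_unique f u : A u = f -> ker_orthogonal A u -> dbr_norm b f = hnorm u.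
Proof.
move=> uf uo; have fb : dbr_space b f by exists u.
by have [_ _ ->] := dbr_liftP fb; rewrite (dbr_lift_unique uf uo).
Qed.

Lemma dbr_space_bound f g : dbr_space b f ->
  2 * rdot f g - (hnorm g ^+ 2 - hnorm (Ts g) ^+ 2) <= dbr_norm b f ^+ 2.
Proof. by move=> /dbr_liftP[uf _ ->]; rewrite -{1}uf; exact: dbr_bound. Qed.

Lemma dbr_spaceP f (K : R) : 
  (forall g, 2 * rdot f g - (hnorm g ^+ 2 - hnorm (Ts g) ^+ 2) <= K) ->
  dbr_space b f /\ dbr_norm b f ^+ 2 <= K.
Proof.
move=> /dbr_of_bound[u [uf uo un]]; split; first by exists u.
by rewrite (dbr_norm_unique uf uo).
Qed.

Lemma dbr_space_defect g : dbr_space b (defect g).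
Proof. by exists (A g) => //; exact: dbr_operatorK. Qed.

(** The identity <P g, f>_b = <g, f> in terms of norms alone, the form that an equality of norms
    carries over to D(mu). *)
Lemma dbr_normD_defect g f : dbr_space b f ->
  dbr_space b (defect g + f) /\
  dbr_norm b (defect g + f) ^+ 2 =
    dbr_norm b (defect g) ^+ 2 + 2 * rdot g f + dbr_norm b f ^+ 2.
Proof.
move=> /dbr_liftP[uf uo ->]; set u := dbr_lift b f in uf uo *.
have go : ker_orthogonal A (A g) by move=> k k0; rewrite dbr_operator_sym k0 hdot0r.
have gu : A (A g + u) = defect g + f by rewrite (linD Al) uf dbr_operatorK.
have guo : ker_orthogonal A (A g + u) by move=> k k0; rewrite hdotDl go // uo // addr0.
split; first by exists (A g + u).
rewrite (dbr_norm_unique gu guo) (dbr_norm_unique (dbr_operatorK g) go).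
by rewrite hnormD_sqr rdot_dbr_operator uf.
Qed.

(** Multiplication by [b] commutes with the shift; take adjoints. *)
Lemma adjoint_shift_commute g : Ts (lshift g) = lshift (Ts g).
Proof.
apply: hdot_inj => f.
by rewrite -(hdot_adjoint Tl T1) -!hdot_shift -(hdot_adjoint Tl T1) (toeplitz_shift b_an b_le1).
Qed.

Local Notation beta := (symbol b_an b_le1).

Lemma taylor_adjoint0 g : taylor (Ts g) 0 = hdot g beta.
Proof.
by rewrite -hdot_monom (hdot_adjointl Tl T1) (toeplitz1 b_an b_le1).
Qed.

Lemma hnorm_dbr_operator_lshift g : hnorm (A (lshift g)) ^+ 2 =
  hnorm g ^+ 2 - cmod (taylor g 0) ^+ 2 - (hnorm (Ts g) ^+ 2 - cmod (hdot g beta) ^+ 2).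
Proof.
rewrite hnorm_dbr_operator adjoint_shift_commute; congr (_ - _).
  exact: hnorm_lshift_sqr.
by apply: etrans (hnorm_lshift_sqr _) _; congr (_ - cmod _ ^+ 2); exact: taylor_adjoint0.
Qed.

(** Put c = (Ts (S g))(0) = <S g, b>. Since Ts g = L Ts (S g), one has |Ts g|^2 <= |g|^2 - |c|^2, so
    the functional is at most 2 Re c - |c|^2 <= 1. *)
Lemma dbr_lshift_symbol :
  exists w, A w = lshift beta /\ hnorm w <= 1.
Proof.
have [g|w [wE _ wn]] := @dbr_of_bound (lshift beta) 1; last first.
  by exists w; split=> //; rewrite -(@expr_le1 _ 2) ?hnorm_ge0.
have e1 : Ts g = lshift (Ts (shift g)) by rewrite -adjoint_shift_commute lshiftK.
have e2 : rdot (lshift beta) g = complex.Re (taylor (Ts (shift g)) 0).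
  by rewrite taylor_adjoint0 rdotC /rdot hdot_shift.
rewrite e1 hnorm_lshift_sqr e2 -(hnorm_shift g).
have h := hnorm_adjoint Tl T1 (shift g).
have {h} : hnorm (Ts (shift g)) ^+ 2 <= hnorm (shift g) ^+ 2.
  by rewrite ler_sqr ?nnegrE ?hnorm_ge0.
have hre := Re_le_cmod (taylor (Ts (shift g)) 0).
have hre' := le_trans (ler_norm _) hre.
have := sqr_ge0 (1 - cmod (taylor (Ts (shift g)) 0)).
rewrite sqrrB expr1n mul1r mulr2n.
move: (hnorm _ ^+ 2) (hnorm _ ^+ 2) (complex.Re _) (cmod _) hre' => *; lra.
Qed.

(* On the orthogonal complement of [L b] in H(b) the shift is the adjoint of the
   contraction [L]; some nonzero [p + r z] lies in it. *)
Lemma dbr_norm_shift_le :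
  dbr_space b (monom 0) -> dbr_space b (monom 1) -> taylor beta 0 = 0 ->
  exists p r : C, (p != 0) || (r != 0) /\
    dbr_norm b (shift (p *: monom 0 + r *: monom 1)) <=
      dbr_norm b (p *: monom 0 + r *: monom 1).
Proof.
have [w [wE w1]] := dbr_lshift_symbol.
move=> /dbr_liftP[u0E u0o _] /dbr_liftP[u1E u1o _] b0.
move: (dbr_lift b (monom 0)) (dbr_lift b (monom 1)) u0E u0o u1E u1o => u0 u1 u0E u0o u1E u1o.
have [p [r [pr0 uw]]] : exists p r : C, (p != 0) || (r != 0) /\
    hdot (p *: u0 + r *: u1) w = 0.
  (* Orthogonality to [w] is one linear condition on (p, r); the case split keeps the solution
     nonzero. *)
  have [c1|c1] := eqVneq (hdot u1 w) 0.
    by exists 0, 1; rewrite oner_eq0 orbT hdotDl !hdotZl c1 mul0r mulr0 addr0.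
  exists (hdot u1 w), (- hdot u0 w); rewrite c1 hdotDl !hdotZl; split=> //.
  by rewrite mulNr mulrC subrr.
exists p, r; split=> //.
set f := p *: monom 0 + r *: monom 1.
have uE : A (p *: u0 + r *: u1) = f.
  by rewrite (linD Al) (linZ Al p u0) (linZ Al r u1) u0E u1E.
have uo : ker_orthogonal A (p *: u0 + r *: u1).
  by move=> k k0; rewrite hdotDl !hdotZl u0o // u1o // !mulr0 addr0.
move: (p *: u0 + r *: u1) uE uo uw => u uE uo uw.
rewrite (dbr_norm_unique uE uo).
have [|_] := @dbr_spaceP (shift f) (hnorm u ^+ 2); last first.
  by rewrite ler_sqr ?nnegrE ?hnorm_ge0 // sqrtr_ge0.
move=> g; rewrite rdot_shift -uE rdot_dbr_operator.
set t := hdot g beta.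
(* Subtracting t w does not change the product with [u], which is orthogonal to [w]. In the norm it
   compensates the term |t|^2 by which |A (L g)|^2 may exceed |g|^2 - |Ts g|^2. *)
have e1 : rdot u (A (lshift g)) = rdot u (A (lshift g) - t *: w).
  have tw : rdot u (t *: w) = 0 by rewrite /rdot hdotZr uw mulr0.
  by rewrite rdotBr tw subr0.
have e2 : hnorm (A (lshift g) - t *: w) ^+ 2 =
    hnorm (A (lshift g)) ^+ 2 - 2 * cmod t ^+ 2 + cmod t ^+ 2 * hnorm w ^+ 2.
  rewrite hnormB_sqr hnormZ_sqr.
  suff -> : rdot (A (lshift g)) (t *: w) = cmod t ^+ 2 by [].
  rewrite /rdot hdotZr dbr_operator_sym wE hdot_lshift.
  (* This is where b(0) = 0 enters: it gives S L b = b. *)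
  have -> : hdot g (shift (lshift beta)) = t.
    by rewrite /t {2}(shift_lshift beta) b0 scale0r add0r.
  by rewrite mulrC Re_mul_conj.
have e3 : hnorm (A (lshift g)) ^+ 2 =
    hnorm g ^+ 2 - cmod (taylor g 0) ^+ 2 - (hnorm (Ts g) ^+ 2 - cmod t ^+ 2).
  exact: hnorm_dbr_operator_lshift.
have w1' : hnorm w ^+ 2 <= 1 by rewrite expr_le1 ?hnorm_ge0.
have := ler_wpM2l (sqr_ge0 (cmod t)) w1'; rewrite mulr1 => hw.
have := sqr_ge0 (hnorm (u - (A (lshift g) - t *: w))).
rewrite (hnormB_sqr u (A (lshift g) - t *: w)) -e1 e2 e3.
have := sqr_ge0 (cmod (taylor g 0)).
move: hw; move: (cmod t ^+ 2) (cmod (taylor g 0) ^+ 2) (rdot _ _) (_ * hnorm w ^+ 2).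
move: (hnorm u ^+ 2) (hnorm g ^+ 2) (hnorm _ ^+ 2) => *; lra.
Qed.

End DeBrangesRovnyak.

(** * Difference quotients and local Dirichlet integrals *)

Section LocalDirichlet.
Variable R : realType.
Local Notation C := R[i].
Implicit Types (f g q r : hardy R) (c z lambda : C).

Definition divides_diff lambda f c q : Prop :=
  f = c *: monom 0 + (shift q - lambda *: q).

Lemma is_difference_quotientP lambda f c q :
  is_difference_quotient f lambda c q <-> divides_diff lambda f c q.
Proof.
have ev z : disk z -> heval (c *: monom 0 + (shift q - lambda *: q)) z =
    c + (z - lambda) * heval q z.
  move=> dz; rewrite hevalD // (hevalZ c (monom 0)) // heval_monom // expr0 mulr1.
  by rewrite hevalB // (hevalZ lambda q) // heval_shift // mulrBl.
split=> [h|-> z dz]; last by rewrite ev // [c + _]addrC addrK.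
by apply: heval_inj => z dz; rewrite ev // h // addrC subrK.
Qed.

(** The coefficients tend to 0. This is used both for the uniqueness of difference quotients and to
    discard the growing solution of the recurrence for [b]. *)
Lemma hardy_nondecreasing_eq0 r :
  (forall n, cmod (taylor r n) <= cmod (taylor r n.+1)) -> r = 0.
Proof.
move=> h; apply: hardyP => n; apply/eqP; rewrite taylor0 -cmod_eq0 -sqrf_eq0 eq_le sqr_ge0 andbT.
have c0 : (fun n => cmod (taylor r n) ^+ 2) @ \oo --> (0 : R).
  exact: cvg_series_cvg_0 (is_cvg_sqr r).
rewrite -(cvg_lim _ c0) //; apply: (@nondecreasing_cvgn_le _ (fun n => cmod (taylor r n) ^+ 2)).
  by apply/nondecreasing_seqP => k; rewrite ler_sqr ?nnegrE ?cmod_ge0.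
by apply/cvg_ex; exists 0.
Qed.

(** Comparing coefficients gives q_n = lambda q_(n+1), so |lambda| <= 1 makes the moduli
    nondecreasing. *)
Lemma divides_diff0 lambda c q : cmod lambda <= 1 -> divides_diff lambda 0 c q ->
  c = 0 /\ q = 0.
Proof.
move=> l1 h; have q0 : q = 0.
  apply: hardy_nondecreasing_eq0 => n.
  have := congr1 (fun f => taylor f n.+1) h.
  rewrite taylorD taylorB !taylorZ taylor_monom taylor_shift mulr0 add0r taylor0.
  by move=> /esym/eqP; rewrite subr_eq0 => /eqP ->; rewrite cmodM ler_piMl ?cmod_ge0.
split=> //; have := congr1 (fun f => taylor f 0) h.
rewrite taylorD taylorB !taylorZ taylor_monom taylor_shift q0 !taylor0 mulr0 mulr1.
by rewrite subrr addr0.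
Qed.

Lemma divides_diffB lambda f c q c' q' :
  divides_diff lambda f c q -> divides_diff lambda f c' q' ->
  divides_diff lambda 0 (c - c') (q - q').
Proof.
rewrite /divides_diff => e e'; rewrite -(subrr f) {1}e {1}e'; apply: hardyP => n.
by rewrite !(taylorD, taylorN, taylorZ) (linB (@shift_linear R)) !(taylorD, taylorN, taylorZ); ring.
Qed.

Lemma divides_diff_unique lambda f c q c' q' : cmod lambda <= 1 ->
  divides_diff lambda f c q -> divides_diff lambda f c' q' -> c = c' /\ q = q'.
Proof.
move=> l1 h h'; have [/eqP c0 /eqP q0] := divides_diff0 l1 (divides_diffB h h').
by split; apply/eqP; rewrite -subr_eq0.
Qed.

(** For lambda not in the disk, |q(z)|^2 <= |q|^2 / (1 - |z|) by the Szego bound, and |z - lambda| <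
    M (1 - |z|) in a Stolz region. Hence |(z - lambda) q(z)|^2 <= |z - lambda| M |q|^2, which tends
    to 0. *)
Lemma divides_diff_has_value lambda f c q : divides_diff lambda f c q ->
  has_value f lambda c.
Proof.
move=> /is_difference_quotientP h; rewrite /has_value; case: ifPn => [l1|_].
  have := h lambda l1; rewrite subrr mul0r => /esym/eqP; rewrite subr_eq0.
  by move=> /eqP ->.
move=> M M1; apply/cvgC_cmod.
have cl : (fun z => cmod (z - lambda)) @ nbhs lambda --> (0 : R).
  by apply/cvgC_cmod; exact: cvg_id.
apply/cvgrPdist_le => e e0.
(* The summand 1 keeps [D] positive when q = 0. *)
pose D := hnorm q ^+ 2 * M + 1.
have M0 : 0 < M by rewrite (lt_trans _ M1).
have D0 : 0 < D by rewrite ltr_wpDl // mulr_ge0 ?sqr_ge0 // ltW.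
have d0 : 0 < e ^+ 2 / D by rewrite divr_gt0 // exprn_gt0.
have /cvgrPdist_le/(_ _ d0) near_l := cl.
rewrite near_withinE; apply: filterS near_l => z.
rewrite !sub0r !normrN !ger0_norm ?cmod_ge0 // => zl [dz sz].
rewrite -h // cmodM -ler_sqr ?nnegrE ?(ltW e0) ?mulr_ge0 ?cmod_ge0 //.
have z1 : 0 < 1 - cmod z by rewrite subr_gt0.
have z2 : 1 - cmod z <= 1 - cmod z ^+ 2.
  by rewrite lerD2l lerN2 expr2 ler_piMl ?cmod_ge0 // ltW.
have hq : cmod (heval q z) ^+ 2 <= hnorm q ^+ 2 * (1 - cmod z)^-1.
  apply: (@le_trans _ _ (hnorm q ^+ 2 * (1 - cmod z ^+ 2)^-1)).
    have := heval_le q dz; rewrite -ler_sqr ?nnegrE ?mulr_ge0 ?cmod_ge0 ?hnorm_ge0 ?sqrtr_ge0 //.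
    have s0 : 0 <= (1 - cmod z ^+ 2)^-1 by rewrite invr_ge0 (le_trans _ z2) // ltW.
    by rewrite exprMn (sqr_sqrtr s0).
  by rewrite ler_wpM2l ?sqr_ge0 // lef_pV2 ?posrE // (lt_le_trans z1).
rewrite exprMn.
have d := cmod_ge0 (z - lambda).
have h1 : cmod (z - lambda) ^+ 2 * cmod (heval q z) ^+ 2 <=
    cmod (z - lambda) * (hnorm q ^+ 2 * M).
  apply: (@le_trans _ _ (cmod (z - lambda) ^+ 2 * (hnorm q ^+ 2 * (1 - cmod z)^-1))).
    by rewrite ler_wpM2l ?sqr_ge0.
  rewrite expr2 -mulrA ler_wpM2l // mulrCA ler_wpM2l ?sqr_ge0 //.
  by rewrite ler_pdivrMr // ltW.
apply: le_trans h1 _; move: zl; rewrite ler_pdivlMr // /D => zl.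
by apply: le_trans zl; rewrite ler_wpM2l // lerDl.
Qed.

Lemma local_dirichlet_inf lambda f : local_dirichlet lambda f =
  ereal_inf [set (hnorm q ^+ 2)%:E | q in [set q | exists c, divides_diff lambda f c q]].
Proof.
rewrite /local_dirichlet; congr (ereal_inf (_ @` _)); apply/seteqP; split=> q /=.
  by move=> [c _ /is_difference_quotientP]; exists c.
by move=> [c h]; exists c; [exact: divides_diff_has_value h|exact/is_difference_quotientP].
Qed.

Lemma local_dirichletE lambda f c q : cmod lambda <= 1 -> divides_diff lambda f c q ->
  local_dirichlet lambda f = (hnorm q ^+ 2)%:E.
Proof.
move=> l1 h; rewrite local_dirichlet_inf.
set X := (X in ereal_inf X); suff -> : X = [set (hnorm q ^+ 2)%:E] by rewrite ereal_inf1.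
apply/seteqP; split=> [_ [r [d hr] <-]|_ ->].
  by have [_ ->] := divides_diff_unique l1 h hr.
by exists q => //; exists c.
Qed.

Lemma local_dirichlet_lty lambda f : (local_dirichlet lambda f < +oo)%E ->
  exists c q, divides_diff lambda f c q.
Proof.
move=> h; apply/not_existsP => nh; move: h; rewrite local_dirichlet_inf.
set X := (X in ereal_inf X); suff -> : X = set0 by rewrite ereal_inf0 ltxx.
apply/seteqP; split=> [y|y []] //; case=> r [d hr] _.
by have := nh d; apply; exists r.
Qed.

Lemma local_dirichlet_ge0 lambda f : (0 <= local_dirichlet lambda f)%E.
Proof. by apply: le_ereal_inf_tmp => _ [q _ <-]; rewrite lee_fin sqr_ge0. Qed.

Lemma local_dirichletD1 lambda f (a : C) :
  local_dirichlet lambda (f + a *: monom 0) = local_dirichlet lambda f.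
Proof.
rewrite !local_dirichlet_inf; congr (ereal_inf (_ @` _)).
rewrite /divides_diff; apply/seteqP; split=> q /= -[c e]; last first.
  by exists (c + a); rewrite e scalerDl addrAC.
by exists (c - a); rewrite scalerBl addrAC -e addrK.
Qed.

End LocalDirichlet.

(** * Borel measurability and integration against point masses *)

Section PointMass.
Variable R : realType.
Local Notation C := R[i].
Local Notation T := (borelC R).

Lemma open_measurableC (U : set C) : open U -> measurable (U : set T).
Proof. by move=> oU; apply: sub_sigma_algebra. Qed.

Lemma continuous_measurableC (phi : C -> R) : continuous phi ->
  measurable_fun setT (phi : T -> R).
Proof.
move=> cphi; apply: (measurability _ (RGenOpens.measurableE R)).
move=> _ [_ [a [c ->] <-]]; rewrite setTI; apply: open_measurableC.
apply: open_comp => [z _|]; [exact: cphi|exact: interval_open].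
Qed.

Lemma cmod_continuous : continuous (@cmod R).
Proof. by move=> z; apply: (@cvg_cmod R _ (nbhs z) id z). Qed.

Lemma measurable_closed_disk : measurable (closed_disk : set T).
Proof.
rewrite -[X in measurable X]setCK; apply: measurableC.
have -> : ~` (closed_disk : set T) = (@cmod R) @^-1` `]1, +oo[%classic.
  by apply/seteqP; split=> z /=; rewrite in_itv /= andbT ltNge => /negP.
apply: open_measurableC; apply: open_comp => [z _|]; [exact: cmod_continuous|].
exact: interval_open.
Qed.

Lemma measurable_set1C (z : C) : measurable ([set z] : set T).
Proof.
rewrite -[X in measurable X]setCK; apply: measurableC; apply: open_measurableC.
rewrite openC; apply: accessible_closed_set1; apply: hausdorff_accessible.
exact: norm_hausdorff.
Qed.

(** The integral of a nonnegative function is a supremum over the simple functions below it, hence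
    monotone for arbitrary functions. *)
Lemma ge0_le_integral_nonmeasurable d (X : measurableType d)
    (mu : {measure set X -> \bar R}) (D : set X) (f g : X -> \bar R) :
  (forall x, D x -> (0 <= f x)%E) -> (forall x, D x -> (f x <= g x)%E) ->
  (\int[mu]_(x in D) f x <= \int[mu]_(x in D) g x)%E.
Proof.
move=> f0 fg; rewrite !ge0_integralE //; last first.
  by move=> x Dx; rewrite (le_trans (f0 _ Dx)) // fg.
apply: ereal_sup_le => _ [h hf <-]; exists h => // x /=.
apply: le_trans (hf x) _; rewrite /patch; case: ifP => // /[!inE] xD.
exact: fg.
Qed.

(* [f] need not be measurable: it lies between two measurable functions that
   agree with it at [lambda]. *)
Lemma integral_point_mass (mu : {measure set T -> \bar R}) (a : R) (lambda : T)
    (D : set T) (f : T -> \bar R) :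
  0 <= a -> measurable D -> D lambda ->
  (forall E, measurable E -> mu E = (a%:E * dirac lambda E)%E) ->
  (forall x, D x -> (0 <= f x)%E) ->
  (\int[mu]_(x in D) f x = a%:E * f lambda)%E.
Proof.
move=> a0 mD Dl muE f0.
pose g c x := if `[< x = lambda >] then f lambda else c.
have mg c : measurable_fun D (g c).
  apply: measurable_funTS; apply: measurable_fun_ifT => //.
  apply: (measurable_fun_bool true); rewrite setTI.
  rewrite (_ : _ @^-1` _ = [set lambda]); first exact: measurable_set1C.
  by apply/seteqP; split=> x /= => [/asboolP|->]; [|apply/asboolP].
have intg c : (0 <= c)%E -> (\int[mu]_(x in D) g c x = a%:E * f lambda)%E.
  move=> c0; rewrite (eq_measure_integral (mscale (NngNum a0) (dirac lambda))); last first.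
    by move=> A mA _; rewrite muE.
  rewrite ge0_integral_mscale //=; last first.
    by move=> x Dx; rewrite /g; case: ifP => // _; exact: f0.
  rewrite integral_dirac // diracE mem_set // mul1e /g.
  by rewrite (_ : `[< _ >] = true) //; apply/asboolP.
apply/eqP; rewrite eq_le; apply/andP; split.
  rewrite -(intg +oo%E) //; apply: ge0_le_integral_nonmeasurable => // x Dx.
  by rewrite /g; case: asboolP => [->|_] //; rewrite leey.
rewrite -(intg 0%E) //; apply: ge0_le_integral_nonmeasurable => x Dx; rewrite /g.
  by case: ifP => // _; exact: f0.
by case: asboolP => [->|_] //; exact: f0.
Qed.

Lemma point_mass_of_null_complement (mu : {finite_measure set T -> \bar R}) (lambda : C) :
  mu (~` closed_disk : set T) = 0%E -> mu (~` [set lambda] : set T) = 0%E ->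
  exists (l : C) (a : R), [/\ closed_disk l, 0 <= a &
    forall E, measurable E -> mu E = (a%:E * dirac (l : T) E)%E].
Proof.
move=> muD mul.
have null E F : measurable E -> measurable F -> E `<=` F -> mu F = 0%E -> mu E = 0%E.
  move=> mE mF EF F0; apply/eqP; rewrite eq_le measure_ge0 andbT -F0.
  by rewrite le_measure ?inE.
have ml := measurable_set1C lambda; have mD := measurable_closed_disk.
have split_mu E : measurable E -> mu E = mu (E `&` [set lambda]).
  move=> mE; rewrite -{1}(setIT E) -(setUv [set lambda]) setIUr measureU //.
  - rewrite -[RHS]adde0; congr (_ + _)%E; apply: null mul; [by apply: measurableI => //; exact: measurableC|exact: measurableC|by move=> x []].
  - exact: measurableI.
  - by apply: measurableI => //; exact: measurableC.
  - by apply/seteqP; split=> [x [[_ ->] [_ nl]]|x []] //; case: nl.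
have finl : mu [set lambda] \is a fin_num by rewrite fin_num_measure.
have [Dl|nDl] := pselect (closed_disk lambda).
  exists lambda, (fine (mu [set lambda])); split=> // [|E mE].
    by rewrite fine_ge0.
  rewrite fineK // split_mu // diracE.
  have [lE|lE] := pselect (E lambda).
    rewrite mem_set // mule1; congr (mu _).
    by apply/seteqP; split=> [x []//|x ->].
  rewrite memNset // mule0 (_ : E `&` _ = set0) ?measure0 //.
  by apply/seteqP; split=> // x [] /[swap] ->.
(* A point outside the disk carries no mass, so the measure is zero; it is recorded as mass 0 at the
   origin because the point has to lie in the closed disk. *)
exists 0, 0; split=> // [|E mE]; first by rewrite /closed_disk /= cmod0.
rewrite mul0e split_mu //; apply: null muD => //.
- exact: measurableI.
- exact: measurableC.
- by move=> x [_ ->].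
Qed.

End PointMass.

(** * D(mu) for a point mass *)

Section DirichletPointMass.
Variable R : realType.
Local Notation C := R[i].
Implicit Types (f g q r : hardy R) (c lambda : C).

(** Applying L removes the constant c from f = c + (z - lambda) q and leaves a linear relation
    between [f] and [q]; c is recovered from the coefficients of index 0. *)
Lemma divides_diffP lambda f q :
  (exists c, divides_diff lambda f c q) <-> lshift f = q - lambda *: lshift q.
Proof.
split=> [[c fE]|h].
  apply: hardyP => n; rewrite taylor_lshift fE !(taylorD, taylorN, taylorZ) taylor_monom.
  by rewrite taylor_shift mulr0 add0r taylor_lshift.
exists (taylor f 0 + lambda * taylor q 0); apply: hardyP => n.
rewrite taylorD taylorB !taylorZ taylor_monom taylor_shift.
case: n => [|n]; first by rewrite mulr1 sub0r addrK.
have := congr1 (fun f => taylor f n) h; rewrite taylor_lshift taylorB taylorZ taylor_lshift => ->.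
by rewrite mulr0 add0r.
Qed.

Variables (mu : {finite_measure set (borelC R) -> \bar R}) (a : R) (lambda : C).
Hypotheses (a0 : 0 <= a) (l1 : closed_disk lambda).
Hypothesis muE : forall E : set (borelC R), measurable E ->
  mu E = (a%:E * dirac (lambda : borelC R) E)%E.

Lemma dirichlet_integral_point_mass f :
  dirichlet_integral mu f = (a%:E * local_dirichlet lambda f)%E.
Proof.
apply: (@integral_point_mass R mu a lambda) => // [|x _]; last exact: local_dirichlet_ge0.
exact: measurable_closed_disk.
Qed.

Lemma dirichlet_zero_mass f : a = 0 -> dirichlet_space mu f /\ dirichlet_norm mu f = hnorm f.
Proof.
move=> az; rewrite /dirichlet_space /dirichlet_norm /= dirichlet_integral_point_mass az mul0e.
by split; rewrite ?ltry // addr0 sqrtr_sqr ger0_norm ?hnorm_ge0.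
Qed.

Hypothesis a_gt0 : 0 < a.

Lemma dirichlet_norm_point_mass f q : lshift f = q - lambda *: lshift q ->
  dirichlet_space mu f /\ dirichlet_norm mu f ^+ 2 = hnorm f ^+ 2 + a * hnorm q ^+ 2.
Proof.
move=> /divides_diffP[c h].
rewrite /dirichlet_space /dirichlet_norm /= dirichlet_integral_point_mass.
rewrite (local_dirichletE l1 h) -EFinM ltry; split=> //=.
by apply: sqr_sqrtr; apply: addr_ge0; [|apply: mulr_ge0 => //]; exact: sqr_ge0.
Qed.

Lemma dirichlet_space_point_mass f : dirichlet_space mu f ->
  exists q, lshift f = q - lambda *: lshift q.
Proof.
rewrite /dirichlet_space /= dirichlet_integral_point_mass => h.
have {h} /local_dirichlet_lty[c [q /(ex_intro _ c)/divides_diffP]] : (local_dirichlet lambda f < +oo)%E.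
  by have := local_dirichlet_ge0 lambda f; case: local_dirichlet h => [r| |] //; rewrite ?ltry // gt0_muley ?lte_fin // ltxx.
by exists q.
Qed.

End DirichletPointMass.

(** * The reproducing identity in D(mu) for a rational symbol *)

Section RationalSymbol.
Variable R : realType.
Local Notation C := R[i].
Implicit Types (f g q r : hardy R).
Variables (b : C -> C) (A B lambda : C) (a : R).
Hypothesis b_an : analytic_on_disk b.
Hypothesis b_le1 : forall z, disk z -> cmod (b z) <= 1.
Hypothesis bE : forall z, disk z -> (1 - B * z) * b z = A * z.
Hypothesis a_gt0 : 0 < a.

Local Notation x := (cmod A ^+ 2).
Hypothesis BE : B = x%:C%C * lambda^* / a%:C%C.
(** With x = a y and B = y conj lambda this is a times the equation (1 + a + |lambda|^2) y = 1 +
    |lambda|^2 y^2 behind [A_sqr]. *)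
Hypothesis quad : x * (1 + a + cmod lambda ^+ 2) = a * (1 + cmod B ^+ 2).

Local Notation T := (toeplitz b).
Local Notation Ts := (adjoint (toeplitz b)).
Let Tl : linear T := toeplitz_linear b_an b_le1.
Let T1 : forall f, hnorm (T f) <= hnorm f := hnorm_toeplitz b_an b_le1.

Lemma toeplitz_rational f : T f = B *: shift (T f) + A *: shift f.
Proof.
apply: heval_inj => z dz.
rewrite hevalD // (hevalZ B) // (hevalZ A) // !heval_shift // (heval_toeplitz b_an b_le1) //.
by rewrite [A * _]mulrA -bE //; ring.
Qed.

Lemma adjoint_rational g : Ts g = B^* *: lshift (Ts g) + A^* *: lshift g.
Proof.
apply: hdot_inj => f; rewrite -(hdot_adjoint Tl T1) toeplitz_rational.
rewrite hdotDl hdotDr !hdotZl !hdotZr !conjCK !hdot_shift.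
by rewrite (hdot_adjoint Tl T1) (adjoint_shift_commute b_an b_le1).
Qed.

(** This is p / z for p = T (Ts g), which vanishes at 0 because b(0) = 0. *)
Definition quotient_part g : hardy R := lshift (T (Ts g)).

Lemma shift_quotient_part g : T (Ts g) = shift (quotient_part g).
Proof.
rewrite [LHS]shift_lshift; suff -> : taylor (T (Ts g)) 0 = 0 by rewrite scale0r add0r.
rewrite toeplitz_rational taylorD !taylorZ !taylor_shift; ring.
Qed.

Lemma quotient_part_eq g : quotient_part g = B *: T (Ts g) + A *: Ts g.
Proof.
rewrite /quotient_part {1}toeplitz_rational; apply: hardyP => n.
by rewrite taylor_lshift !(taylorD, taylorZ) !taylor_shift.
Qed.

(** The formula is forced: <P g, f> + a <q, r> = <g, f> means <p, f> = a <q, r>. With p = S s and L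
    f = r - lambda L r, the left side is <s - conj lambda S s, r>. *)
Definition diff_quotient g : hardy R :=
  (a^-1)%:C%C *: (quotient_part g - lambda^* *: shift (quotient_part g)).

Lemma diff_quotientP g :
  lshift (defect b g) = diff_quotient g - lambda *: lshift (diff_quotient g).
Proof.
set s := quotient_part g.
have x0 : x%:C%C != 0 :> C.
  apply/eqP => /(@complex.complexI R) x0; move: quad; rewrite x0 mul0r => /eqP.
  by rewrite eq_sym mulf_eq0 gt_eqF //= gt_eqF // ltr_pwDl // sqr_ge0.
have az : a%:C%C != 0 :> C by rewrite (inj_eq (@complex.complexI R) a 0) gt_eqF.
have quadC : x%:C%C * (1 + a%:C%C + lambda * lambda^*) = a%:C%C * (1 + B * B^*) :> C.
  by rewrite !mul_conjC -[1]/((1 : R)%:C%C) -!rmorphD -!rmorphM quad.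
have Bc : B^* = x%:C%C * lambda / a%:C%C.
  by rewrite BE !rmorphM fmorphV /= !conjR conjCK.
apply: hardyP => n; rewrite /diff_quotient -/s.
rewrite taylor_lshift /defect !(taylorB, taylorZ) !taylor_lshift !(taylorB, taylorZ) !taylor_shift.
rewrite -[taylor (T (Ts g)) n.+1]taylor_lshift -/(quotient_part g) -/s.
set Ss := match n with 0%N => 0 | m.+1 => taylor s m end.
have e1 k : A * taylor (Ts g) k = taylor s k - B * taylor (shift s) k.
  rewrite /s -(shift_quotient_part g) quotient_part_eq !(taylorD, taylorZ).
  by rewrite addrC addKr.
have e2 := congr1 (fun f => taylor f n) (adjoint_rational g).
rewrite !(taylorD, taylorZ) !taylor_lshift in e2.
(* Eliminating [Ts g] between its own recursion and A (Ts g) = s - B S s leaves a three-term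
   relation between [g] and [s]; [quad] and the value of B turn it into the claim. [Ss] stands for
   s_(n-1), read as 0 at n = 0. *)
have e3 : x%:C%C * taylor g n.+1 =
    (1 + B * B^*) * taylor s n - B * Ss - B^* * taylor s n.+1.
  have e4 : A * taylor (Ts g) n = B^* * (A * taylor (Ts g) n.+1) + (A * A^*) * taylor g n.+1.
    by rewrite {1}e2; ring.
  rewrite mul_conjC !e1 !taylor_shift -/Ss in e4.
  have -> : x%:C%C * taylor g n.+1 = B^* * (taylor s n.+1 - B * taylor s n)
      + x%:C%C * taylor g n.+1 - B^* * (taylor s n.+1 - B * taylor s n) by ring.
  by rewrite -e4; ring.
move: (taylor g n.+1) (taylor s n) (taylor s n.+1) Ss e3 => G u v w e3.
apply: (mulfI x0); rewrite mulrBr e3 fmorphV /=.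
have -> : 1 + B * B^* = x%:C%C * (1 + a%:C%C + lambda * lambda^*) / a%:C%C.
  by rewrite quadC mulrAC mulfV // mul1r.
by rewrite Bc BE; field.
Qed.

Lemma hdot_defect g f r : lshift f = r - lambda *: lshift r ->
  hdot (defect b g) f + a%:C%C * hdot (diff_quotient g) r = hdot g f.
Proof.
move=> fr; have az : a%:C%C != 0 :> C by rewrite (inj_eq (@complex.complexI R) a 0) gt_eqF.
rewrite /defect hdotBl shift_quotient_part hdot_shift fr hdotBr hdotZr.
rewrite /diff_quotient hdotZl hdotBl hdotZl fmorphV mulrA mulfV // mul1r -hdot_shift.
by rewrite -addrA [X in _ + X]addrC subrr addr0.
Qed.

Lemma rdot_defect g f r : lshift f = r - lambda *: lshift r ->
  rdot (defect b g) f + a * rdot (diff_quotient g) r = rdot g f.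
Proof. by move=> fr; rewrite /rdot -(hdot_defect g fr) ReD ReZ. Qed.

Lemma rdot_defect_self g :
  hnorm g ^+ 2 - hnorm (Ts g) ^+ 2 = hnorm (defect b g) ^+ 2 + a * hnorm (diff_quotient g) ^+ 2.
Proof.
rewrite -(hnorm_dbr_operator b_an b_le1) -rdotff.
rewrite (rdot_dbr_operator b_an b_le1) (dbr_operatorK b_an b_le1).
by rewrite -(rdot_defect g (diff_quotientP g)) !rdotff.
Qed.

(** With q the quotient of P g, this is |P g - f|^2 + a |q - r|^2 >= 0, expanded by the reproducing
    identity. *)
Lemma dbr_bound_of_quotient f r g : lshift f = r - lambda *: lshift r ->
  2 * rdot f g - (hnorm g ^+ 2 - hnorm (Ts g) ^+ 2) <= hnorm f ^+ 2 + a * hnorm r ^+ 2.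
Proof.
move=> fr; rewrite rdot_defect_self rdotC -(rdot_defect g fr).
have h1 := sqr_ge0 (hnorm (defect b g - f)); have h2 := sqr_ge0 (hnorm (diff_quotient g - r)).
rewrite (hnormB_sqr (defect b g) f) in h1; rewrite (hnormB_sqr (diff_quotient g) r) in h2.
have := mulr_ge0 (ltW a_gt0) h2.
move: h1; move: (hnorm (defect b g) ^+ 2) (hnorm (diff_quotient g) ^+ 2) (rdot (defect b g) f).
by move: (rdot (diff_quotient g) r) (hnorm f ^+ 2) (hnorm r ^+ 2) => *; lra.
Qed.

Lemma defect_linear : linear (defect b).
Proof.
apply: linear_add; first exact: linear_id.
by apply: linear_opp; apply: linear_comp => //; exact: adjoint_linear.
Qed.

Lemma diff_quotient_linear : linear diff_quotient.
Proof.
have ql : linear quotient_part.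
  apply: linear_comp; first exact: lshift_linear.
  by apply: linear_comp => //; exact: adjoint_linear.
apply: linear_scale; apply: linear_add => //; apply: linear_opp; apply: linear_scale.
by apply: linear_comp => //; exact: shift_linear.
Qed.

(** The factor sqrt a makes the norm of the pair that of D(mu). The limits [u1] and [r] inherit the
    quotient relation coefficient by coefficient. *)
Lemma quotient_of_dbr_bound f (K : R) :
  (forall g, 2 * rdot f g - (hnorm g ^+ 2 - hnorm (Ts g) ^+ 2) <= K) ->
  exists2 r, lshift f = r - lambda *: lshift r & hnorm f ^+ 2 + a * hnorm r ^+ 2 <= K.
Proof.
move=> hK; pose ra : R := Num.sqrt a.
have ra0 : 0 < ra by rewrite sqrtr_gt0.
have ra2 : ra ^+ 2 = a by rewrite sqr_sqrtr // ltW.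
have Jl : linear (fun g => ra%:C%C *: diff_quotient g).
  exact: linear_scale diff_quotient_linear.
have Jn g : hnorm (ra%:C%C *: diff_quotient g) ^+ 2 = a * hnorm (diff_quotient g) ^+ 2.
  by rewrite (hnormZ_sqr ra%:C%C) cmodR real_normK ?num_real // ra2.
have [|G [u1 [u2 [h1 h2 rep nm]]]] := quadratic_maximizer defect_linear Jl (f := f) (K := K).
  by move=> g; rewrite Jn -rdot_defect_self.
have raC : ra%:C%C != 0 :> C by rewrite (inj_eq (@complex.complexI R) ra 0) gt_eqF.
pose r : hardy R := (ra^-1)%:C%C *: u2.
have u2E : u2 = ra%:C%C *: r by rewrite /r scalerA -rmorphM /= mulfV ?gt_eqF // scale1r.
have Gr : hcvg (fun n => diff_quotient (G n)) r.
  have -> : (fun n => diff_quotient (G n)) =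
      (fun n => (ra^-1)%:C%C *: (ra%:C%C *: diff_quotient (G n))).
    by apply/funext => n; rewrite scalerA -rmorphM /= mulVf ?gt_eqF // scale1r.
  apply: (@hcvg_lin R _ (cmod (ra^-1)%:C%C)) h2; first exact: linear_scale (@linear_id R).
  by move=> g; rewrite hnormZ.
have u1r : lshift u1 = r - lambda *: lshift r.
  apply: hardyP => n; rewrite taylor_lshift taylorB taylorZ taylor_lshift.
  apply: cvgC_unique (cvg_taylor (k := n.+1) h1) _.
  have -> : (fun n0 => taylor (defect b (G n0)) n.+1) =
    (fun n0 => taylor (diff_quotient (G n0)) n - lambda * taylor (diff_quotient (G n0)) n.+1).
    by apply/funext => m; rewrite -taylor_lshift diff_quotientP taylorB taylorZ taylor_lshift.
  apply: cvgB; first exact: cvg_taylor.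
  by apply: cvgM; [exact: cvg_cst|exact: cvg_taylor].
(* Both have the same products with every h: [rep] says it for [f], the reproducing identity for
   [u1]. *)
have fu : f = u1.
  apply: rdot_inj => h; rewrite rep u2E rdotZl rdotZr mulrA -expr2 ra2.
  by rewrite rdotC [rdot r _]rdotC (rdot_defect h u1r) rdotC.
exists r; first by rewrite fu.
move: nm; rewrite fu u2E (hnormZ_sqr ra%:C%C) cmodR real_normK ?num_real // ra2.
exact.
Qed.

End RationalSymbol.

(** * The constants of the statement *)

Section Coefficients.
Variable R : realType.
Local Notation C := R[i].
Implicit Types alpha lambda A B : C.

(** y is [A_sqr] divided by |alpha|^2. For lambda = 0 the quadratic degenerates to (1 + a) y = 1,
    which is why that case has its own formula. *)
Lemma A_sqr_root alpha lambda : alpha != 0 -> cmod lambda <= 1 ->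
  exists y : R, [/\ 0 < y, A_sqr alpha lambda = cmod alpha ^+ 2 * y,
    (1 + cmod alpha ^+ 2 + cmod lambda ^+ 2) * y = 1 + cmod lambda ^+ 2 * y ^+ 2
    & cmod lambda * y <= 1].
Proof.
move=> al0 l1; rewrite /A_sqr.
have a0 : 0 < cmod alpha ^+ 2 by rewrite exprn_gt0 // cmod_gt0.
move: (cmod alpha ^+ 2) a0 => a a0.
case: eqVneq => [->|l0].
  exists (1 + a)^-1; rewrite invr_gt0 cmod0 expr0n addr0 !mul0r addr0.
  by split; rewrite ?ltr_pwDl // ?ltW // divff // gt_eqF // ltr_pwDl // ltW.
have L0 : 0 < cmod lambda by rewrite cmod_gt0.
set l := cmod lambda ^+ 2; have l_gt0 : 0 < l by rewrite exprn_gt0.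
have l_le1 : l <= 1 by rewrite /l expr_le1 // ltW.
set t := 1 + a + l; set s := Num.sqrt (t ^+ 2 - 4 * l).
have t0 : 0 < t by rewrite /t; lra.
have D0 : 0 <= t ^+ 2 - 4 * l.
  have -> : t ^+ 2 - 4 * l = (1 - l) ^+ 2 + a * (2 + 2 * l + a) by rewrite /t; ring.
  by rewrite addr_ge0 ?sqr_ge0 // mulr_ge0 ?ltW //; lra.
have s2 : s ^+ 2 = t ^+ 2 - 4 * l by rewrite sqr_sqrtr.
have s0 : 0 <= s by exact: sqrtr_ge0.
have st : s < t.
  by rewrite -(ltr_pXn2r (n := 2)) ?nnegrE // ?(ltW t0) // s2 gtrBl mulr_gt0.
have root : t * ((t - s) / (2 * l)) = 1 + l * ((t - s) / (2 * l)) ^+ 2.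
  have : s ^+ 2 = t ^+ 2 - 4 * l by [].
  have l0' : l != 0 by rewrite gt_eqF.
  clearbody s t l => e; apply/eqP; rewrite -subr_eq0; apply/eqP.
  have -> : t * ((t - s) / (2 * l)) - (1 + l * ((t - s) / (2 * l)) ^+ 2) =
     (t ^+ 2 - 4 * l - s ^+ 2) / (4 * l) by field.
  by rewrite e subrr mul0r.
exists ((t - s) / (2 * l)); split=> //.
- by rewrite divr_gt0 ?subr_gt0 // mulr_gt0.
- by rewrite mulrAC mulrA.
have y0 : 0 <= (t - s) / (2 * l) by rewrite divr_ge0 ?subr_ge0 ?ltW // mulr_gt0.
have e0 := mulr_ge0 (cmod_ge0 lambda) y0.
rewrite -(@expr_le1 _ 2) // exprMn -/l.
(* By the equation of the root, l y^2 = t y - 1, and t y <= 2 amounts to s^2 <= s t. *)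
suff : t * ((t - s) / (2 * l)) <= 2 by rewrite root; lra.
rewrite mulrA ler_pdivrMr ?mulr_gt0 //.
have h := ler_wpM2r s0 (ltW st); rewrite -expr2 s2 in h.
by rewrite mulrBr -expr2; lra.
Qed.

Lemma Mobius_denominator_neq0 (B z : C) : cmod B <= 1 -> disk z -> 1 - B * z != 0.
Proof.
move=> B1 dz; apply/eqP => /eqP; rewrite subr_eq0 => /eqP e.
have : cmod (B * z) < 1.
  by rewrite cmodM (le_lt_trans _ dz) // ler_piMl ?cmod_ge0.
by rewrite -e cmod1 ltxx.
Qed.

Lemma B_coefE alpha lambda A (y : R) : alpha != 0 ->
  cmod A ^+ 2 = cmod alpha ^+ 2 * y -> B_coef alpha lambda A = y%:C%C * lambda^*.
Proof.
move=> al0 xE; rewrite /B_coef (negbTE al0) xE rmorphM /=.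
have a0 : (cmod alpha ^+ 2)%:C%C != 0 :> C.
  by rewrite (inj_eq (@complex.complexI R) _ 0) sqrf_eq0 cmod_eq0.
by rewrite -[_ * y%:C%C * _]mulrA [X in X / _]mulrC mulfK.
Qed.

Lemma Hinf_ball_le1 (b : C -> C) : Hinf b -> Hinf_norm b <= 1 ->
  forall z, disk z -> cmod (b z) <= 1.
Proof.
move=> [_ [M hM]] b1 z dz; apply: le_trans b1; apply: sup_ubound; last by exists z.
by exists M => _ [w dw <-]; exact: hM.
Qed.

End Coefficients.

(** * Sufficiency *)

Section PointMassToSymbol.
Variable R : realType.
Local Notation C := R[i].
Variables (mu : {finite_measure set (borelC R) -> \bar R}) (b : C -> C).
Hypothesis b_an : analytic_on_disk b.
Hypothesis b_le1 : forall z, disk z -> cmod (b z) <= 1.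

Lemma dirichlet_norm_ge0 f : 0 <= dirichlet_norm mu f.
Proof. exact: sqrtr_ge0. Qed.

Lemma dbr_norm_ge0 f : 0 <= dbr_norm b f.
Proof. exact: sqrtr_ge0. Qed.

Lemma point_mass_sufficient (alpha lambda A B : C) :
  closed_disk lambda ->
  (forall E : set (borelC R), measurable E ->
    mu E = ((cmod alpha ^+ 2)%:E * dirac (lambda : borelC R) E)%E) ->
  (forall z, disk z -> b z = A * z / (1 - B * z)) ->
  cmod A ^+ 2 = A_sqr alpha lambda -> B = B_coef alpha lambda A ->
  dirichlet_space mu = dbr_space b /\
  forall f, dirichlet_space mu f -> dirichlet_norm mu f = dbr_norm b f.
Proof.
move=> l1 muE bE AE BE; have a0 := sqr_ge0 (cmod alpha).
(* The quotient formulas divide by a = |alpha|^2. When it is 0, both mu and [b] vanish and both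
   spaces are H^2 with its own norm. *)
have [al0|al0] := eqVneq alpha 0.
  have az : cmod alpha ^+ 2 = 0 by rewrite al0 cmod0 expr0n.
  have A0 : A = 0.
    apply/eqP; rewrite -cmod_eq0 -sqrf_eq0 AE /A_sqr az.
    by case: ifP => _; rewrite !mul0r.
  have b0 z : disk z -> b z = 0 by move=> dz; rewrite bE // A0 !mul0r.
  have T0 f : toeplitz b f = 0.
    apply: heval_inj => z dz; rewrite (heval_toeplitz b_an b_le1) // b0 // mul0r.
    by rewrite -(scale0r (0 : hardy R)) (hevalZ 0) // mul0r.
  have Ts0 g : adjoint (toeplitz b) g = 0.
    apply: hdot_inj => f.
    rewrite -(hdot_adjoint (toeplitz_linear b_an b_le1) (hnorm_toeplitz b_an b_le1)).
    by rewrite T0 hdot0l hdot0r.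
  have key f : dbr_space b f /\ dbr_norm b f = hnorm f.
    have [|fb fn] := @dbr_spaceP R b b_an b_le1 f (hnorm f ^+ 2).
      move=> g; rewrite Ts0 hnorm0 expr0n subr0; have := sqr_ge0 (hnorm (f - g)).
      rewrite (hnormB_sqr f g).
      by move: (hnorm f ^+ 2) (hnorm g ^+ 2) (rdot f g) => *; lra.
    split=> //; have := dbr_space_bound b_an b_le1 f fb.
    rewrite Ts0 hnorm0 expr0n subr0 rdotff => fn'.
    apply/eqP; rewrite -(@eqrXn2 _ 2) ?dbr_norm_ge0 ?hnorm_ge0 // eq_le fn /=.
    by move: fn'; move: (hnorm f ^+ 2) (dbr_norm b f ^+ 2) => *; lra.
  split=> [|f _].
    apply/seteqP; split=> f _; first by have [] := key f.
    by have [] := dirichlet_zero_mass a0 l1 muE f az.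
  by have [_ ->] := dirichlet_zero_mass a0 l1 muE f az; have [_ ->] := key f.
have [y [y0 xE root By]] := A_sqr_root al0 l1.
rewrite -AE in xE.
have a_gt0 : 0 < cmod alpha ^+ 2 by rewrite exprn_gt0 // cmod_gt0.
have BE' := B_coefE lambda al0 xE; rewrite -BE in BE'.
have cB : cmod B = y * cmod lambda.
  by rewrite BE' cmodM cmodR gtr0_norm // cmod_conj.
have quad : cmod A ^+ 2 * (1 + cmod alpha ^+ 2 + cmod lambda ^+ 2) =
    cmod alpha ^+ 2 * (1 + cmod B ^+ 2).
  by rewrite xE -mulrA [y * _]mulrC root cB exprMn [y ^+ 2 * _]mulrC.
have bE' z : disk z -> (1 - B * z) * b z = A * z.
  move=> dz; rewrite bE // mulrC divfK // Mobius_denominator_neq0 //.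
  by rewrite cB mulrC.
rewrite /B_coef (negbTE al0) in BE.
have M2D f q := @dirichlet_norm_point_mass R mu _ lambda a0 l1 muE f q.
have D2M f := @dirichlet_space_point_mass R mu _ lambda a0 l1 muE a_gt0 f.
have bnd f r g := @dbr_bound_of_quotient R b A B lambda _ b_an b_le1 bE' a_gt0 BE quad f r g.
have quo f K := @quotient_of_dbr_bound R b A B lambda _ b_an b_le1 bE' a_gt0 BE quad f K.
split=> [|f fD].
  apply/seteqP; split=> f.
    move=> /D2M[q fq].
    by have [] := dbr_spaceP b_an b_le1 (fun g => bnd f q g fq).
  by move=> fb; have [q fq _] := quo f _ (fun g => dbr_space_bound b_an b_le1 g fb); have [] := M2D f q fq.
have [q fq] := D2M f fD; have [_ Nf] := M2D f q fq.
have [fb fn] := dbr_spaceP b_an b_le1 (fun g => bnd f q g fq).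
(* The quotient [q'] comes from the bound in H(b) and gives the inequality opposite to [fn]. *)
have [q' fq' fn'] := quo f _ (fun g => dbr_space_bound b_an b_le1 g fb).
have [_ Nf'] := M2D f q' fq'.
apply/eqP; rewrite -(@eqrXn2 _ 2) ?dirichlet_norm_ge0 ?dbr_norm_ge0 // eq_le.
by rewrite {1}Nf' fn' Nf fn.
Qed.

End PointMassToSymbol.

(** * Dirichlet integrals of p + r z and of its shift *)

Lemma measurable_cmod_affine (R : realType) (p r : R[i]) :
  measurable_fun setT (fun z : borelC R => cmod (p + r * z) ^+ 2).
Proof.
apply: continuous_measurableC => z.
have h : (fun z : R[i] => cmod (p + r * z)) @ z --> cmod (p + r * z).
  apply: (@cvg_cmod R _ (nbhs z) (fun w => p + r * w)); apply: cvgD; first exact: cvg_cst.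
  by apply: cvgM; [exact: cvg_cst|exact: cvg_id].
exact: (cvgM h h).
Qed.
Section PolynomialDirichlet.
Variable R : realType.
Local Notation C := R[i].
Variable mu : {finite_measure set (borelC R) -> \bar R}.
Implicit Types (p r zeta : C) (f : hardy R).

Definition affine p r : hardy R := p *: monom 0 + r *: monom 1.

Lemma taylor_affine p r n : taylor (affine p r) n =
  match n with 0%N => p | 1%N => r | _ => 0 end.
Proof.
rewrite /affine taylorD !taylorZ !taylor_monom.
by case: n => [|[|n]]; rewrite ?mulr1 ?mulr0 ?addr0 ?add0r.
Qed.

Lemma hnorm_affine p r : hnorm (affine p r) ^+ 2 = cmod p ^+ 2 + cmod r ^+ 2.
Proof.
rewrite /affine hnormD_sqr (hnormZ_sqr p) (hnormZ_sqr r) !hnorm_monom !expr1n !mulr1.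
suff -> : rdot (p *: monom 0) (r *: monom 1) = 0 by rewrite mulr0 addr0.
by rewrite /rdot hdotZl hdotZr hdot_monom taylor_monom /= !mulr0.
Qed.

Lemma lshift_affine p r : lshift (affine p r) = r *: monom 0.
Proof.
apply: hardyP => n; rewrite taylor_lshift taylor_affine taylorZ taylor_monom.
by case: n => [|n]; rewrite ?mulr1 ?mulr0.
Qed.

Lemma lshift_monom0 : lshift (monom 0 : hardy R) = 0.
Proof. by apply: hardyP => n; rewrite taylor_lshift taylor_monom. Qed.

Lemma local_dirichlet_affine p r zeta : cmod zeta <= 1 ->
  local_dirichlet zeta (affine p r) = (cmod r ^+ 2)%:E.
Proof.
move=> z1; have : lshift (affine p r) = r *: monom 0 - zeta *: lshift (r *: monom 0).
  by rewrite lshift_affine (linZ (@lshift_linear R)) lshift_monom0 !scaler0 subr0.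
move=> /divides_diffP[c h]; rewrite (local_dirichletE z1 h) (hnormZ_sqr r).
by rewrite hnorm_monom expr1n mulr1.
Qed.

(** The quotient of z (p + r z) at zeta is (p + r zeta) + r z. Its constant term produces the
    integral of |f|^2 by which the shift increases the norm of D(mu). *)
Lemma local_dirichlet_shift_affine p r zeta : cmod zeta <= 1 ->
  local_dirichlet zeta (shift (affine p r)) = (cmod (p + r * zeta) ^+ 2 + cmod r ^+ 2)%:E.
Proof.
move=> z1; have : lshift (shift (affine p r)) =
    affine (p + r * zeta) r - zeta *: lshift (affine (p + r * zeta) r).
  rewrite lshiftK lshift_affine scalerA mulrC /affine scalerDl.
  by rewrite [RHS]addrAC addrK.
by move=> /divides_diffP[c h]; rewrite (local_dirichletE z1 h) hnorm_affine.
Qed.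

Let m : R := fine (mu closed_disk).

Let muE : mu closed_disk = m%:E.
Proof. by rewrite fineK // fin_num_measure //; exact: measurable_closed_disk. Qed.

Let m0 : 0 <= m.
Proof. by rewrite fine_ge0. Qed.

Lemma dirichlet_integral_affine p r :
  dirichlet_integral mu (affine p r) = (cmod r ^+ 2 * m)%:E.
Proof.
rewrite /dirichlet_integral (eq_integral (cst (cmod r ^+ 2)%:E)); last first.
  by move=> z /[!inE] z1; exact: local_dirichlet_affine.
apply: etrans (integral_cst mu (@measurable_closed_disk R) _) _.
exact: (congr1 (fun t => ((cmod r ^+ 2)%:E * t)%E) muE).
Qed.

Lemma dirichlet_integral_shift_affine p r :
  dirichlet_integral mu (shift (affine p r)) =
  (\int[mu]_(z in (closed_disk : set (borelC R))) (cmod (p + r * z) ^+ 2)%:E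
     + (cmod r ^+ 2 * m)%:E)%E.
Proof.
have mD := @measurable_closed_disk R.
rewrite /dirichlet_integral.
rewrite (eq_integral (fun z : borelC R => (cmod (p + r * z) ^+ 2)%:E + (cmod r ^+ 2)%:E)%E); last first.
  by move=> z /[!inE] z1; exact: local_dirichlet_shift_affine.
rewrite ge0_integralD //=.
- by congr (_ + _)%E; apply: etrans (integral_cst mu mD _) _; exact: (congr1 (fun t => ((cmod r ^+ 2)%:E * t)%E) muE).
- by move=> z _; rewrite lee_fin sqr_ge0.
- apply: measurable_funTS; apply/measurable_EFinP; exact: measurable_cmod_affine.
- by move=> z _; rewrite lee_fin sqr_ge0.
Qed.

End PolynomialDirichlet.

(** * Necessity *)

Section SymbolFromNorms.
Variable R : realType.
Local Notation C := R[i].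
Variables (mu : {finite_measure set (borelC R) -> \bar R}) (b : C -> C).
Hypothesis mu_supp : mu (~` closed_disk : set (borelC R)) = 0%E.
Hypothesis b_an : analytic_on_disk b.
Hypothesis b_le1 : forall z, disk z -> cmod (b z) <= 1.
Hypothesis spaces : dirichlet_space mu = dbr_space b.
Hypothesis norms : forall f, dirichlet_space mu f -> dirichlet_norm mu f = dbr_norm b f.

Local Notation T := (toeplitz b).
Local Notation Ts := (adjoint (toeplitz b)).
Local Notation beta := (symbol b_an b_le1).
Let Tl : linear T := toeplitz_linear b_an b_le1.
Let T1 : forall f, hnorm (T f) <= hnorm f := hnorm_toeplitz b_an b_le1.

Lemma dirichlet_integral_ge0 f : (0 <= dirichlet_integral mu f)%E.
Proof. by apply: integral_ge0 => z _; exact: local_dirichlet_ge0. Qed.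

Lemma dirichlet_norm_sqr f :
  dirichlet_norm mu f ^+ 2 = hnorm f ^+ 2 + fine (dirichlet_integral mu f).
Proof.
rewrite /dirichlet_norm; apply: sqr_sqrtr; apply: addr_ge0; first exact: sqr_ge0.
by rewrite fine_ge0 // dirichlet_integral_ge0.
Qed.

Lemma dirichlet_integralD1 f (c : C) :
  dirichlet_integral mu (f + c *: monom 0) = dirichlet_integral mu f.
Proof. by apply: eq_integral => z _; exact: local_dirichletD1. Qed.

Lemma dirichlet_norm_sqrD1 f : dirichlet_norm mu (f + monom 0) ^+ 2 =
  dirichlet_norm mu f ^+ 2 + 2 * complex.Re (taylor f 0) + 1.
Proof.
have e := dirichlet_integralD1 f 1; rewrite scale1r in e.
apply: etrans (dirichlet_norm_sqr _) _; rewrite e hnormD_sqr hnorm_monom expr1n.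
rewrite (dirichlet_norm_sqr f) /rdot hdot_monom.
by move: (hnorm f ^+ 2) (fine _) (complex.Re _) => u v w; ring.
Qed.

Lemma dirichlet_integral_shift_le f :
  dirichlet_norm mu (shift f) <= dirichlet_norm mu f ->
  fine (dirichlet_integral mu (shift f)) <= fine (dirichlet_integral mu f).
Proof.
have hn := dirichlet_norm_sqr; have h0 := dirichlet_norm_ge0 mu.
have hs := @hnorm_shift R.
move: (dirichlet_norm mu) hn h0 => N; move: (@hnorm R) hs => h hs hn h0 Nf.
have : N (shift f) ^+ 2 <= N f ^+ 2 by apply: lerXn2r Nf; rewrite nnegrE.
by rewrite !hn hs lerD2l.
Qed.

Lemma dirichlet_space_affine p r : dirichlet_space mu (affine p r).
Proof. by rewrite /dirichlet_space /= dirichlet_integral_affine ltry. Qed.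

Lemma integral_cmod_affine_lty (p r : C) :
  (\int[mu]_(z in (closed_disk : set (borelC R))) (cmod (p + r * z) ^+ 2)%:E < +oo)%E.
Proof.
have mD := @measurable_closed_disk R.
apply: (@le_lt_trans _ _ (((cmod p + cmod r) ^+ 2)%:E * mu closed_disk)%E); last first.
  by rewrite lte_mul_pinfty ?lee_fin ?sqr_ge0 // ltey_eq fin_num_measure.
rewrite -integral_cst //; apply: ge0_le_integral_nonmeasurable => z.
  by rewrite lee_fin sqr_ge0.
move=> z1; rewrite lee_fin ler_sqr ?nnegrE ?addr_ge0 ?cmod_ge0 //.
apply: le_trans (ler_cmodD _ _) _; rewrite lerD2l cmodM.
by rewrite ler_piMr ?cmod_ge0.
Qed.

Lemma dirichlet_space_shift_affine p r : dirichlet_space mu (shift (affine p r)).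
Proof.
rewrite /dirichlet_space /= dirichlet_integral_shift_affine lte_add_pinfty ?ltry //.
exact: integral_cmod_affine_lty.
Qed.

Lemma dirichlet_monom0 : dirichlet_space mu (monom 0) /\ dirichlet_norm mu (monom 0) = 1.
Proof.
have e : monom 0 = affine 1 0 :> hardy R by rewrite /affine scale0r addr0 scale1r.
split; first by rewrite e; exact: dirichlet_space_affine.
rewrite /dirichlet_norm hnorm_monom e dirichlet_integral_affine cmod0 expr0n mul0r /=.
by rewrite expr1n addr0 sqrtr1.
Qed.

Lemma dirichlet_normD_defect g f : dirichlet_space mu f ->
  [/\ dirichlet_space mu (defect b g), dirichlet_space mu (defect b g + f) &
    dirichlet_norm mu (defect b g + f) ^+ 2 =
      dirichlet_norm mu (defect b g) ^+ 2 + 2 * rdot g f + dirichlet_norm mu f ^+ 2].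
Proof.
move=> fD; have gD := dbr_space_defect b_an b_le1 g.
have fb : dbr_space b f by rewrite -spaces.
have [sD e] := dbr_normD_defect b_an b_le1 g fb.
rewrite -spaces in gD sD; split=> //.
have aux (x y z x' y' z' c : R) : x = x' -> y = y' -> z = z' ->
    x' ^+ 2 = y' ^+ 2 + c + z' ^+ 2 -> x ^+ 2 = y ^+ 2 + c + z ^+ 2.
  by move=> -> -> ->.
exact: aux (norms sD) (norms gD) (norms fD) e.
Qed.

Lemma heval0 (f : hardy R) : heval f 0 = taylor f 0.
Proof.
have d0 : disk (0 : C) by rewrite /disk /= cmod0.
rewrite {1}(shift_lshift f) hevalD // (hevalZ (taylor f 0)) // heval_monom // heval_shift //.
by rewrite expr0 mulr1 mul0r addr0.
Qed.

(* The constant 1 is a unit vector of D(mu) orthogonal to the functions that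
   vanish at 0; the kernel [1 - conj (b 0) b] of H(b) at 0 must then be 1. *)
Lemma symbol0 : taylor beta 0 = 0.
Proof.
have [D1 n1] := dirichlet_monom0.
have [_ _ e] := dirichlet_normD_defect (monom 0) D1.
have {e} := etrans (esym (dirichlet_norm_sqrD1 (defect b (monom 0)))) e.
move: (dirichlet_norm mu) n1 => N n1; move: (N (defect b (monom 0)) ^+ 2) => Nd.
rewrite n1 rdotff hnorm_monom !expr1n.
(* The two expansions of |P 1 + 1|^2 agree only if Re (P 1)(0) = 1, while (P 1)(0) = 1 -
   |b(0)|^2. *)
have -> : taylor (defect b (monom 0)) 0 = 1 - (cmod (taylor beta 0) ^+ 2)%:C%C.
  rewrite /defect taylorB taylor_monom -(heval0 (T _)) (heval_toeplitz b_an b_le1); last first.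
    by rewrite /disk /= cmod0.
  rewrite heval0 (taylor_adjoint0 b_an b_le1) hdotC hdot_monom -mul_conjC; congr (_ - _ * _).
  by rewrite -(heval_symbol b_an b_le1) ?heval0 // /disk /= cmod0.
rewrite ReD ReN /=; move: (cmod (taylor beta 0)) (@cmod_eq0 R (taylor beta 0)) => t t0 e.
have : t ^+ 2 = 0 by move: (t ^+ 2) e => u; lra.
by move=> /eqP; rewrite sqrf_eq0 t0 => /eqP.
Qed.

Lemma point_mass_necessary :
  exists (l : C) (a : R), [/\ closed_disk l, 0 <= a &
    forall E : set (borelC R), measurable E -> mu E = (a%:E * dirac (l : borelC R) E)%E].
Proof.
have mD := @measurable_closed_disk R.
have m1 : dbr_space b (monom 1).
  have e : monom 1 = affine 0 1 :> hardy R by rewrite /affine scale0r add0r scale1r.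
  by rewrite e -spaces; exact: dirichlet_space_affine.
have m0 : dbr_space b (monom 0) by rewrite -spaces; have [] := dirichlet_monom0.
have [p [r [pr0]]] := @dbr_norm_shift_le R b b_an b_le1 m0 m1 symbol0.
rewrite -/(affine p r) -!norms; [|exact: dirichlet_space_affine|exact: dirichlet_space_shift_affine].
move=> /dirichlet_integral_shift_le.
rewrite dirichlet_integral_shift_affine dirichlet_integral_affine.
have I0 : (0 <= \int[mu]_(z in (closed_disk : set (borelC R))) (cmod (p + r * z) ^+ 2)%:E)%E.
  by apply: integral_ge0 => z _; rewrite lee_fin sqr_ge0.
have If : (\int[mu]_(z in (closed_disk : set (borelC R))) (cmod (p + r * z) ^+ 2)%:E)%E
    \is a fin_num by rewrite ge0_fin_numE // integral_cmod_affine_lty.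
(* The term |r|^2 mu(closed disk) occurs on both sides and cancels, so the integral of |p + r z|^2
   is at most 0. *)
rewrite fineD // gerDr => I1.
have {I0 I1 If} I00 : (\int[mu]_(z in (closed_disk : set (borelC R))) (cmod (p + r * z) ^+ 2)%:E = 0)%E.
  by rewrite -(fineK If); congr (_%:E); apply/eqP; rewrite eq_le I1 fine_ge0.
have mf : measurable_fun (closed_disk : set (borelC R))
    (fun z : borelC R => (cmod (p + r * z) ^+ 2)%:E).
  by apply: measurable_funTS; apply/measurable_EFinP; exact: measurable_cmod_affine.
have : ae_eq mu (closed_disk : set (borelC R)) (fun z : borelC R => (cmod (p + r * z) ^+ 2)%:E) (cst 0%E).
  apply/ae_eq_integral_abs => //; rewrite -[RHS]I00; apply: eq_integral => z _.
  by rewrite gee0_abs // lee_fin sqr_ge0.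
move=> [N [mN N0 sN]]; apply: (point_mass_of_null_complement (lambda := - p / r) mu_supp).
apply/eqP; rewrite eq_le measure_ge0 andbT.
have U0 : mu (N `|` ~` closed_disk) = 0%E.
  apply/eqP; rewrite eq_le measure_ge0 andbT.
  apply: le_trans (measureU2 _ _ _) _ => //; first exact: measurableC.
  rewrite [X in (X <= _)%E](_ : _ = 0%E) //.
  exact: etrans (f_equal2 _ N0 mu_supp) (adde0 0%E).
rewrite -[X in (_ <= X)%E]U0; apply: le_measure; rewrite ?inE.
- by apply: measurableC; exact: measurable_set1C.
- by apply: measurableU => //; exact: measurableC.
move=> z zl; have [Dz|] := pselect (closed_disk z); last by right.
left; apply: sN => /= h; apply: zl; have /eqP := h Dz.
rewrite eqe sqrf_eq0 cmod_eq0 => /eqP prz.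
(* If r = 0 then p <> 0 and p + r z has no zero at all, which contradicts its vanishing at this
   z. *)
have [r0|r0] := eqVneq r 0.
  by move: prz pr0; rewrite r0 mul0r addr0 => ->; rewrite eqxx.
rewrite /=; apply: (mulfI r0); rewrite mulrCA divff // mulr1.
by apply/eqP; rewrite -subr_eq0 opprK addrC prz.
Qed.


(** This is the case mu = 0. The norm identity of [defect] gives P = 1, so T Ts = 0 and Ts = 0, and
    |b|^2 = (Ts b)(0) = 0. *)
Lemma symbol_eq0 : (forall f, dirichlet_space mu f /\ dirichlet_norm mu f = hnorm f) ->
  forall z, disk z -> b z = 0.
Proof.
move=> iso.
have defE g : defect b g = g.
  apply: rdot_inj => f; have [fD _] := iso f; have [_ _] := dirichlet_normD_defect g fD.
  have -> : dirichlet_norm mu = @hnorm R by apply/funext => h; have [] := iso h.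
  rewrite hnormD_sqr; move: (defect b g) => d.
  by move: (hnorm d ^+ 2) (hnorm f ^+ 2) (rdot d f) (rdot g f) => *; lra.
have Ts0 g : Ts g = 0.
  have TT0 : T (Ts g) = 0.
    have /eqP := defE g; rewrite /defect subr_eq -[X in X == _]addr0 (inj_eq (addrI g)).
    by rewrite eq_sym => /eqP.
  apply/hnorm_eq0/eqP; rewrite -sqrf_eq0 -rdotff /rdot -(hdot_adjoint Tl T1) TT0.
  by rewrite hdot0l.
have b0 : beta = 0.
  apply/hnorm_eq0/eqP; rewrite -sqrf_eq0 -rdotff /rdot -(taylor_adjoint0 b_an b_le1).
  by rewrite Ts0.
move=> z dz; rewrite -(heval_symbol b_an b_le1 dz) b0.
by rewrite -(scale0r (0 : hardy R)) (hevalZ 0) // mul0r.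
Qed.

Variables (lambda : C) (a : R).
Hypotheses (l1 : closed_disk lambda) (a_gt0 : 0 < a).
Hypothesis muE : forall E : set (borelC R), measurable E ->
  mu E = (a%:E * dirac (lambda : borelC R) E)%E.

Let a0 : 0 <= a := ltW a_gt0.

(** The difference quotient is additive in the function, so the norm identity for P g + f splits
    into real inner products. *)
Lemma rdot_defect_quotient g q f r :
  lshift (defect b g) = q - lambda *: lshift q -> lshift f = r - lambda *: lshift r ->
  rdot (defect b g) f + a * rdot q r = rdot g f.
Proof.
move=> gq fr.
have [_ n1] := dirichlet_norm_point_mass a0 l1 muE gq.
have [fD n2] := dirichlet_norm_point_mass a0 l1 muE fr.
have gfqr : lshift (defect b g + f) = (q + r) - lambda *: lshift (q + r).
  rewrite (linD (@lshift_linear R) (defect b g) f) (linD (@lshift_linear R) q r).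
  by rewrite gq fr scalerDr opprD addrACA.
have [_ n3] := dirichlet_norm_point_mass a0 l1 muE gfqr.
have [_ _ e] := dirichlet_normD_defect g fD.
have {n3 e} := etrans (esym n3) e; move: (dirichlet_norm mu) n1 n2 => N n1 n2.
rewrite n1 n2; move: (defect b g) => d.
have := hnormD_sqr d f; have := hnormD_sqr q r.
move: (hnorm (d + f) ^+ 2) (hnorm (q + r) ^+ 2) => u v -> ->.
move: (hnorm d ^+ 2) (hnorm q ^+ 2) (hnorm f ^+ 2) (hnorm r ^+ 2) => x1 x2 x3 x4.
move: (rdot d f) (rdot q r) (rdot g f) => y1 y2 y3 e.
lra.
Qed.

Lemma defect_quotient g : exists q,
  [/\ lshift (defect b g) = q - lambda *: lshift q, taylor (T (Ts g)) 0 = 0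
    & lshift (T (Ts g)) - lambda^* *: T (Ts g) = a%:C%C *: q].
Proof.
have [gD _ _] := dirichlet_normD_defect g dirichlet_monom0.1.
have [q gq] := dirichlet_space_point_mass a0 l1 muE a_gt0 gD.
exists q; set p := T (Ts g).
(* The error of the desired identity is used as the quotient of a test function whose value at
   lambda is p(0); the reproducing identity then reads |p(0)|^2 + |w|^2 = 0. *)
pose w := lshift p - lambda^* *: p - a%:C%C *: q.
pose f := taylor p 0 *: monom 0 + (shift w - lambda *: w).
have fw : lshift f = w - lambda *: lshift w by apply/divides_diffP; exists (taylor p 0).
have := rdot_defect_quotient gq fw; rewrite /defect rdotBl -/p => e0.
have e1 : rdot p f = a * rdot q w by move: e0; move: (rdot g f) (rdot p f) (rdot q w) => *; lra.
have e2 : rdot p f = cmod (taylor p 0) ^+ 2 + rdot (lshift p - lambda^* *: p) w.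
  rewrite /f rdotDr {1}/rdot hdotZr hdot_monom mulrC Re_mul_conj; congr (_ + _).
  by rewrite rdotBr rdotBl rdotC rdot_shift rdotC; congr (_ - _); rewrite /rdot hdotZr hdotZl.
have e3 : rdot (lshift p - lambda^* *: p) w = hnorm w ^+ 2 + a * rdot q w.
  by rewrite -rdotff -rdotZl -rdotDl /w subrK.
have e4 : cmod (taylor p 0) ^+ 2 + hnorm w ^+ 2 = 0.
  move: e1; rewrite e2 e3.
  by move: (cmod _ ^+ 2) (hnorm w ^+ 2) (rdot q w) => *; lra.
have /eqP := e4; rewrite paddr_eq0 ?sqr_ge0 // !sqrf_eq0 cmod_eq0 => /andP[/eqP p0 /eqP w0].
split=> //; apply/eqP; rewrite -subr_eq0; apply/eqP; exact: hnorm_eq0.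
Qed.

(** Since b(0) = 0, Ts 1 = 0 and Ts z is the constant conj b_1. Thus z is the first monomial whose
    image under P involves [b], and it involves [b] only through a multiple. *)
Lemma adjoint_toeplitz_monom1 : T (Ts (monom 1)) = (taylor beta 1)^* *: beta.
Proof.
have Tsl := adjoint_linear Tl T1.
have L0 : lshift (monom 0 : hardy R) = 0 by exact: lshift_monom0.
have Ts1 : Ts (monom 0) = 0.
  rewrite [LHS]shift_lshift -(adjoint_shift_commute b_an b_le1) L0 (lin0 Tsl).
  rewrite (taylor_adjoint0 b_an b_le1) hdotC hdot_monom symbol0 rmorph0 scale0r.
  by rewrite (lin0 (@shift_linear R)) addr0.
have Ts2 : Ts (monom 1) = (taylor beta 1)^* *: monom 0.
  rewrite [LHS]shift_lshift -(adjoint_shift_commute b_an b_le1) -shift_monom lshiftK Ts1.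
  rewrite (taylor_adjoint0 b_an b_le1) hdotC shift_monom hdot_monom.
  by rewrite (lin0 (@shift_linear R)) addr0.
by rewrite Ts2 (linZ Tl) (toeplitz1 b_an b_le1).
Qed.

Lemma symbol_necessary (alpha : C) : cmod alpha ^+ 2 = a -> exists A B : C,
  [/\ forall z, disk z -> b z = A * z / (1 - B * z),
      cmod A ^+ 2 = A_sqr alpha lambda & B = B_coef alpha lambda A].
Proof.
move=> alE; have al0 : alpha != 0.
  by rewrite -cmod_eq0 -sqrf_eq0 alE gt_eqF.
have [y [y0 xE root By]] := A_sqr_root al0 l1.
rewrite alE in xE root.
have [q [eq1 p0 eq2]] := defect_quotient (monom 1).
move: eq1; rewrite /defect; set p := T (Ts (monom 1)) in p0 eq2 * => eq1.
pose s := lshift p.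
have sn n : taylor s n = (taylor beta 1)^* * taylor beta n.+1.
  by rewrite taylor_lshift /p adjoint_toeplitz_monom1 taylorZ.
pose K : C := 1 + a%:C%C + lambda * lambda^*.
(* Elimination of [q] from the two relations of [defect_quotient]. As p(0) = 0, the coefficient p_n
   is s_(n-1), read as 0 at n = 0. *)
have rec n : a%:C%C * (n == 0)%:R =
    K * taylor s n - lambda^* * taylor p n - lambda * taylor s n.+1 :> C.
  have f1 : taylor (monom 1) n.+1 - taylor s n = taylor q n - lambda * taylor q n.+1.
    rewrite -[taylor q n.+1]taylor_lshift -taylorZ -taylorB -eq1 taylor_lshift.
    by rewrite taylorB [taylor s n]taylor_lshift.
  have f2 k : a%:C%C * taylor q k = taylor s k - lambda^* * taylor p k.
    by rewrite -taylorZ -eq2 taylorB taylorZ.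
  have f3 := f2 n; have f4 := f2 n.+1; rewrite -[taylor p n.+1]taylor_lshift -/s in f4.
  rewrite taylor_monom eqSS in f1.
  move: (n == 0)%:R (taylor q n) (taylor q n.+1) f1 f3 f4 => d u v f1 f3 f4.
  have -> : d = taylor s n + (u - lambda * v) by rewrite -f1; ring.
  have -> : a%:C%C * (taylor s n + (u - lambda * v)) =
    a%:C%C * taylor s n + (a%:C%C * u - lambda * (a%:C%C * v)) by ring.
  by rewrite f3 f4 /K; ring.
have rootC : K * y%:C%C = 1 + lambda * lambda^* * y%:C%C ^+ 2.
  by rewrite /K mul_conjC -[1]/((1 : R)%:C%C) -!rmorphXn -!rmorphM -!rmorphD -rmorphM root.
pose B : C := y%:C%C * lambda^*.
have sB n : taylor s n.+1 = B * taylor s n.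
  (* The combination L s - B s cancels the root B of the recurrence. Its coefficients satisfy e_k =
     lambda y e_(k+1) with |lambda y| <= 1, so their moduli are nondecreasing and they vanish. *)
  have e0 : lshift s - B *: s = 0.
    apply: hardy_nondecreasing_eq0 => k.
    have -> : taylor (lshift s - B *: s) k =
        lambda * y%:C%C * taylor (lshift s - B *: s) k.+1.
      have := rec k.+1; rewrite -[taylor p k.+1]taylor_lshift -/s mulr0 => rk.
      rewrite !taylorB !taylorZ (taylor_lshift s k) (taylor_lshift s k.+1) /B.
      move: (taylor s k) (taylor s k.+1) (taylor s k.+2) rk => u v w rk.
      have e1 : y%:C%C * (lambda * w) = K * y%:C%C * v - y%:C%C * (lambda^* * u).
        have -> : lambda * w = K * v - lambda^* * u.
          by apply/eqP; rewrite eq_sym -subr_eq0 -rk.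
        by ring.
      have -> : lambda * y%:C%C * (w - y%:C%C * lambda^* * v) =
        y%:C%C * (lambda * w) - lambda * lambda^* * y%:C%C ^+ 2 * v by ring.
      by rewrite e1 rootC; ring.
    rewrite !cmodM cmodR gtr0_norm // ler_piMl ?cmod_ge0 //.
  have := congr1 (fun f => taylor f n) e0.
  by rewrite taylorB taylorZ taylor_lshift taylor0 => /eqP; rewrite subr_eq0 => /eqP.
(* At n = 0 the recurrence is inhomogeneous and fixes the scale: (K - lambda B) s_0 = a, while y (K
   - lambda B) = 1. *)
have s0 : taylor s 0 = (a * y)%:C%C.
  have := rec 0; rewrite p0 sB mulr1 mulr0 subr0 /B => e.
  rewrite rmorphM /= e.
  have -> : (K * taylor s 0 - lambda * (y%:C%C * lambda^* * taylor s 0)) * y%:C%C =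
    K * y%:C%C * taylor s 0 - lambda * lambda^* * y%:C%C ^+ 2 * taylor s 0 by ring.
  by rewrite rootC; ring.
(* The coefficient s_0 is conj b_1 times b_1, so |A|^2 = a y. In particular A <> 0, and the
   geometric law passes from [s] to [b]. *)
pose A := taylor beta 1.
have AE : cmod A ^+ 2 = a * y.
  by apply: (@complex.complexI R); rewrite -s0 sn mulrC mul_conjC.
have A0 : A^* != 0.
  rewrite conjC_eq0 -cmod_eq0 -sqrf_eq0 AE mulf_neq0 // gt_eqF //.
have betaE : beta = A *: monom 1 + B *: shift beta.
  apply: hardyP => -[|[|n]]; rewrite taylorD !taylorZ taylor_monom taylor_shift.
  - by rewrite symbol0 !mulr0 addr0.
  - by rewrite symbol0 mulr1 mulr0 addr0.
  rewrite mulr0 add0r; apply: (mulfI A0).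
  by rewrite mulrCA -!sn sB.
exists A, B; split; first move=> z dz.
- have e : b z = A * z + B * (z * b z).
    rewrite -{1}(heval_symbol b_an b_le1 dz) {1}betaE hevalD // (hevalZ A) // (hevalZ B) //.
    by rewrite heval_monom // heval_shift // (heval_symbol b_an b_le1 dz) expr1.
  have den : 1 - B * z != 0.
    apply: Mobius_denominator_neq0 => //.
    by rewrite /B cmodM cmodR gtr0_norm // cmod_conj mulrC.
  apply: (mulIf den); rewrite divfK //.
  by rewrite mulrBr mulr1 {1}e; ring.
- by rewrite AE xE.
by rewrite (@B_coefE _ _ _ _ y) // alE.
Qed.

End SymbolFromNorms.

Theorem theorem1p3 (R : realType)
    (mu : {finite_measure set (borelC R) -> \bar R})
    (mu_supp : mu (~` closed_disk : set (borelC R)) = 0%E)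
    (b : R[i] -> R[i])
    (b_Hinf : Hinf b)
    (b_le1 : Hinf_norm b <= 1)
    (b_nonextreme : nonextreme b) :
  (dirichlet_space mu = dbr_space b /\
   forall f, dirichlet_space mu f -> dirichlet_norm mu f = dbr_norm b f)
  <->
  exists alpha lambda A B : R[i],
    [/\ closed_disk lambda,
        forall E : set (borelC R), measurable E ->
          mu E = ((cmod alpha ^+ 2)%:E * dirac (lambda : borelC R) E)%E,
        forall z, disk z -> b z = A * z / (1 - B * z),
        cmod A ^+ 2 = A_sqr alpha lambda
      & B = B_coef alpha lambda A].
Proof.
have b_an : analytic_on_disk b by case: b_Hinf.
have b_le := Hinf_ball_le1 b_Hinf b_le1.
split=> [[spaces norms]|[alpha [lambda [A [B [l1 muE bE AE BE]]]]]]; last first.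
  exact: (point_mass_sufficient b_an b_le l1 muE bE AE BE).
have [lambda [a [l1 a0 muE]]] := point_mass_necessary mu_supp b_an b_le spaces norms.
(* With no mass the quotient of an element of D(mu) is not controlled, so this case is settled by b
   = 0 with alpha = A = B = 0. *)
have [a_eq0|a_neq0] := eqVneq a 0.
  have iso f := dirichlet_zero_mass a0 l1 muE f a_eq0.
  have b0 := symbol_eq0 b_an b_le spaces norms iso.
  have c0 : cmod (0 : R[i]) ^+ 2 = 0 by rewrite cmod0 expr0n.
  exists 0, lambda, 0, 0; rewrite /A_sqr /B_coef eqxx c0 -a_eq0; split=> //.
    by move=> z dz; rewrite b0 // !mul0r.
  by rewrite a_eq0; case: ifP; rewrite !mul0r.
have a_gt0 : 0 < a by rewrite lt0r a_neq0.
(* Only |alpha| is determined by mu; the nonnegative root of a is taken. *)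
have aE : cmod ((Num.sqrt a)%:C%C : R[i]) ^+ 2 = a.
  by rewrite cmodR ger0_norm ?sqrtr_ge0 // sqr_sqrtr.
have [A [B [bE AE BE]]] := symbol_necessary b_an b_le spaces norms l1 a_gt0 muE aE.
by exists (Num.sqrt a)%:C%C, lambda, A, B; rewrite aE.
Qed.
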